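(* Let $\mu$ be a Radon measure on $\mathbb{R}^n$ and let $T$ be the Haar multiplier adapted to $\mu$ and a bounded sequence of real numbers $\{\varepsilon_Q\}_{Q\in\mathcal{D}}$ such that $$\lim_{\ell(Q)\to\infty}|\varepsilon_Q|=\lim_{\ell(Q)\to0}|\varepsilon_Q|=\lim_{c(Q)\to\infty}|\varepsilon_Q|=0,$$ where $\ell(Q)$ and $c(Q)$ denote the side length and center of $Q$ respectively. If $1<p<\infty$ and $w\in A_p$, then $T$ is compact on $L^p(w)$.
   Context: $\mathcal{D}$ is the standard dyadic grid on $\mathbb{R}^n$: cubes $\prod_{i=1}^n[2^km_i,2^k(m_i+1))$ with $k,m_i\in\mathbb{Z}$. $\widehat Q$ is the dyadic parent of $Q$ (the dyadic cube containing $Q$ of twice its side length). $c(Q)\to\infty$ means $|c(Q)|\to\infty$; each limit is over cubes $Q\in\mathcal{D}$, uniformly in the other parameters. All integrals, averages and inner products are with respect to $\mu$: $\langle f\rangle_Q:=\frac1{\mu(Q)}\int_Q f\,d\mu$, $\langle f,g\rangle:=\int_{\mathbb{R}^n} fg\,d\mu$, and $L^p(w)$ is the $L^p$ space of the measure $w\,d\mu$. Only cubes of positive $\mu$-measure are considered in averages and in sums involving Haar functions. For $Q\in\mathcal{D}$ with $\mu(Q)>0$, $h_Q:=\mu(Q)^{-1/2}\big(\mathbb{1}_Q-\frac{\mu(Q)}{\mu(\widehat Q)}\mathbb{1}_{\widehat Q}\big)$. The Haar multiplier adapted to $\mu$ and a bounded real sequence $\{\varepsilon_Q\}_{Q\in\mathcal{D}}$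 is $Tf=\sum_{Q\in\mathcal{D}}\varepsilon_Q\langle f,h_Q\rangle h_Q$, understood as the almost everywhere pointwise limit, as $M\to\infty$, of the sums over the finite family of dyadic cubes $Q$ with $Q\subsetneq\mathbb{B}_M$ and $\ell(Q)>M^{-1}$, where $\mathbb{B}_M$ is the ball centered at the origin with diameter $M$. For $1<p<\infty$ with $\frac1p+\frac1{p'}=1$, an almost everywhere positive, locally integrable function $w$ is an $A_p$ weight if $[w]_{A_p}:=\sup_Q\langle w\rangle_Q\langle w^{1-p'}\rangle_Q^{p-1}<\infty$, the supremum being over all cubes $Q\subseteq\mathbb{R}^n$ with sides parallel to the coordinate axes (averages with respect to $\mu$). *)

(* Defs.v *)
From HB Require Import structures.
From mathcomp Require Import all_boot all_order all_algebra.
From mathcomp Require Import all_classical all_reals all_analysis.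
From mathcomp Require Import measurable_realfun.

Set Implicit Arguments.
Unset Strict Implicit.
Unset Printing Implicit Defensive.
Import Order.TTheory GRing.Theory Num.Theory.
Import numFieldNormedType.Exports.

Local Open Scope classical_set_scope.
Local Open Scope ring_scope.

(* R^n with its Borel sigma-algebra: an alias of 'rV[R]_n, whose topology comes
   from the sup norm (hence is the Euclidean one). *)
Notation borelRn R n := (g_sigma_algebraType (@open 'rV[R]_n)).

Section Euclidean.
Context {R : realType} {n : nat}.

Definition enorm (x : 'rV[R]_n) : R := Num.sqrt (\sum_(i < n) x 0 i ^+ 2).

Definition eball (M : R) : set 'rV[R]_n := [set x | enorm x < M / 2].

Definition hcube (a : 'rV[R]_n) (s : R) : set 'rV[R]_n :=
  [set x | forall i, a 0 i <= x 0 i < a 0 i + s].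

End Euclidean.

(* (k, m) is the code of the cube prod_i [2^k m_i, 2^k (m_i + 1)); for 0 < n
   distinct codes denote distinct cubes. *)
Definition dyadic (n : nat) : choiceType := (int * {ffun 'I_n -> int})%type.

Section Dyadic.
Context {R : realType} {n : nat}.
Implicit Type Q : dyadic n.

Definition side Q : R := 2 ^ Q.1.

Definition cube Q : set 'rV[R]_n :=
  [set x | forall i, side Q * (Q.2 i)%:~R <= x 0 i < side Q * (Q.2 i + 1)%:~R].

Definition cube_center Q : 'rV[R]_n :=
  \row_i (side Q * ((Q.2 i)%:~R + 2^-1)).

(* %/ on int rounds downwards for a positive divisor. *)
Definition parent Q : dyadic n := (Q.1 + 1, [ffun i => (Q.2 i %/ 2)%Z]).

Definition vanishing_at_large_side (eps : dyadic n -> R) :=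
  forall e : R, 0 < e -> exists L : R, forall Q, L < side Q -> `|eps Q| < e.

Definition vanishing_at_small_side (eps : dyadic n -> R) :=
  forall e : R, 0 < e ->
    exists2 d : R, 0 < d & forall Q, side Q < d -> `|eps Q| < e.

Definition vanishing_at_far_center (eps : dyadic n -> R) :=
  forall e : R, 0 < e ->
    exists L : R, forall Q, L < enorm (cube_center Q) -> `|eps Q| < e.

End Dyadic.

Section Measures.
Context {R : realType} {n : nat}.
Variable mu : {measure set (borelRn R n) -> \bar R}.
Local Open Scope ereal_scope.

Definition radon :=
  [/\ forall K : set 'rV[R]_n, compact K -> mu K < +oo,
      forall A : set (borelRn R n), measurable A ->
        mu A = ereal_inf
          [set mu U | U in [set U : set 'rV[R]_n | open U /\ A `<=` U]]
    & forall U : set 'rV[R]_n, open U ->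
        mu U = ereal_sup
          [set mu K | K in [set K : set 'rV[R]_n | compact K /\ K `<=` U]]].

Definition locally_integrable_wrt (w : borelRn R n -> R) :=
  measurable_fun setT w /\
  forall K : set 'rV[R]_n, compact K -> \int[mu]_(x in K) `|w x|%:E < +oo.

Definition average (f : borelRn R n -> \bar R) (Q : set 'rV[R]_n) : \bar R :=
  (fine (mu Q))^-1%:E * \int[mu]_(x in Q) f x.

(* p' stands for the conjugate exponent of p. Averages are extended-real valued,
   so finiteness of the constant includes that of the average of w^(1-p').
   Half-open cubes are used, as for the dyadic grid; by monotone convergence
   open or closed cubes yield the same class of weights. *)
Definition Ap_constant (p p' : R) (w : borelRn R n -> R) : \bar R :=
  ereal_sup [set average (EFin \o w) Q *
                 average (fun x => (w x `^ (1 - p'))%:E) Q `^ (p - 1)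
            | Q in [set Q | 0 < mu Q /\
                            exists a s, (0 < s)%R /\ Q = hcube a s]].

Definition Ap_weight (p p' : R) (w : borelRn R n -> R) :=
  [/\ {ae mu, forall x, (0 < w x)%R},
      locally_integrable_wrt w
    & Ap_constant p p' w < +oo].

End Measures.

Section Weighted.
Context {R : realType} {n : nat}.
Variables (mu : {measure set (borelRn R n) -> \bar R}).
Variable w : {mfun borelRn R n >-> R}.
Local Open Scope ereal_scope.

(* The measure w dmu. Taking the positive part makes this a measure for every w
   and has no effect when w is positive mu-almost everywhere. *)
Definition weighted (A : set (borelRn R n)) : \bar R :=
  \int[mu]_(x in A) (w^\+ x)%:E.

Let weighted0 : weighted set0 = 0.
Proof. exact: integral_set0. Qed.

Let weighted_ge0 A : 0 <= weighted A.
Proof. by apply: integral_ge0 => x _; rewrite lee_fin funrpos_ge0. Qed.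

Let weighted_semi_sigma_additive : semi_sigma_additive weighted.
Proof.
apply: semi_sigma_additive_nng_induced => [|x].
- by apply/measurable_EFinP; exact: measurable_funrpos.
- by rewrite lee_fin funrpos_ge0.
Qed.

HB.instance Definition _ := isMeasure.Build _ _ _ weighted
  weighted0 weighted_ge0 weighted_semi_sigma_additive.

End Weighted.

Section Haar.
Context {R : realType} {n : nat}.
Variable mu : {measure set (borelRn R n) -> \bar R}.
Implicit Types (Q : dyadic n) (f g : borelRn R n -> R).

Definition inner f g : R := \int[mu]_x (f x * g x).

Definition haar Q : borelRn R n -> R := fun x =>
  (Num.sqrt (fine (mu (cube Q))))^-1 *
  (\1_(cube Q) x
   - fine (mu (cube Q)) / fine (mu (cube (parent Q))) * \1_(cube (parent Q)) x).

Definition haar_partial_sum (eps : dyadic n -> R) (M : R) f :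
    borelRn R n -> R := fun x =>
  \sum_(Q \in [set Q | [/\ (0 < mu (cube Q))%E,
                           cube Q `<` eball M & M^-1 < side Q]])
    eps Q * inner f (haar Q) * haar Q x.

(* The value of lim is a fixed default where there is no convergence. *)
Definition haar_multiplier (eps : dyadic n -> R) f : borelRn R n -> R :=
  fun x => lim (haar_partial_sum eps M f x @[M --> +oo]).

End Haar.

(* Elements of L^p(nu) are represented by functions, so linearity is required
   up to nu-null sets. *)
Definition compact_operator_on_Lp d (X : measurableType d) (R : realType)
    (nu : {measure set X -> \bar R}) (p : R) (T : (X -> R) -> X -> R) :=
  [/\ forall f, f \in Lfun nu p%:E -> T f \in Lfun nu p%:E,
      forall (a : R) f g, f \in Lfun nu p%:E -> g \in Lfun nu p%:E ->
        {ae nu, forall x, T (fun y => a * f y + g y) x = a * T f x + T g x}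
    & forall u : nat -> X -> R,
        (forall k, u k \in Lfun nu p%:E) ->
        (exists C : R, forall k, (Lnorm nu p%:E (EFin \o u k) <= C%:E)%E) ->
        exists (phi : nat -> nat) (g : X -> R),
          [/\ {homo phi : i j / (i < j)%N}, g \in Lfun nu p%:E
            & Lnorm nu p%:E (EFin \o (T (u (phi k)) \- g)) @[k --> \oo]
                --> 0%E]].

(* Main.v *)
Require Import Defs.
From HB Require Import structures.
From mathcomp Require Import all_boot all_order all_algebra.
From mathcomp Require Import all_classical all_reals all_analysis.
From mathcomp Require Import measurable_realfun ring lra zify.

Set Implicit Arguments.
Unset Strict Implicit.
Unset Printing Implicit Defensive.
Import Order.TTheory GRing.Theory Num.Theory.
Import numFieldNormedType.Exports.

Local Open Scope classical_set_scope.
Local Open Scope ring_scope.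

(** Everything rests on one finite estimate, in which [mu] is an arbitrary
    measure that is finite on cubes. A coefficient [<f, h_Q>] is [sqrt (mu Q)]
    times the difference of the averages of [f] over [Q] and over its parent, so
    that a product [<f, h_Q> <g, h_Q>] is [mu Q] times two martingale differences
    ([inner_haar_mul]); the unbounded ratio of the measures of a cube and its
    parent has disappeared. With [s = w^(1 - p')] the sum of the absolute values
    of these products over any finite family of cubes is at most a constant times
    [int |f|^p w + int |g|^p' s] ([bilinear_haar], [tree_bilinear_bound]). To see
    this, descend the dyadic tree and stop whenever the average of [f] or of [g]
    exceeds four times its value at the previous stop. Between two stops a
    quadratic potential pays for the differences ([diff_sum_le_stopped]), which
    leaves the sum of [mu S <f>_S <g>_S] over the stopping cubes [S]. These are
    sparse ([stopped_mass_le]), so that two applications of a Carleson embedding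
    theorem finish the estimate: the first passes from [mu] to the weight, by the
    [A_p] condition, the second bounds averages with respect to the weight
    ([carleson_embedding], [weighted_carleson]).

    Duality turns the bilinear estimate into a bound for finite multiplier sums
    on [L^p(w)], with a norm proportional to the largest [|eps_Q|] that occurs
    ([energy_haar_sum_le]). Convergence and compactness use this bound as a property
    of the family of coefficients [<f, h_Q>] ([admissible]).

    It gives the convergence of the partial sums almost everywhere. The cubes of
    side at least one contribute an absolutely convergent series: the [h_Q] are
    constant on smaller cubes, and the signs of the multiplier are free
    ([large_cubes_bound]). For the cubes of side less than one, a partial sum
    stopped at the first large oscillation is itself a multiplier sum, which
    yields a weak type inequality, and its constant tends to zero with the side
    because [eps] does ([weak_type], [persistent_oscillation_null]). Fatou's
    lemma extends the norm bound to the limits ([energy_haar_lim_le]).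

    Compactness follows. The three limits of [eps] make the multiplier uniformly
    small outside a finite family of cubes ([small_outside_fam]), so that the
    operator is a norm limit of operators that depend on finitely many
    coefficients ([energy_haar_lim_split]). The coefficients of a bounded
    sequence of functions are bounded cube by cube and have a cluster point by
    Tychonoff's theorem; it is admissible, because admissibility is a condition
    on finite families ([admissible_closure]), and a subsequence of the images
    converges to its image ([haar_lim_cluster], [multiplier_compact]). *)

(** * Homogeneous functions *)

Section Ratio.
Context {R : realType}.
Implicit Types (b c x y z X Y Z C M s : R).

(** For nonnegative [b] and [c] this is a convex function that is homogeneous of
    degree one, hence subadditive; [carleson_embedding] takes its Bellman function
    from it. *)
Definition ratio b c x y z := x `^ (1 + b + c) * y `^ (- b) * z `^ (- c).

(** The perspective [y (x / y)^p] of the [p]-th power. *)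
Definition persp p x y : R := x `^ p * y `^ (1 - p).

Lemma ratio_ge0 b c x y z : 0 <= ratio b c x y z.
Proof. by rewrite !mulr_ge0 ?powR_ge0. Qed.

Lemma persp_ge0 p x y : 0 <= persp p x y.
Proof. by rewrite mulr_ge0 ?powR_ge0. Qed.

Lemma ratio0 b c y z : 0 <= b -> 0 <= c -> ratio b c 0 y z = 0.
Proof. by move=> b0 c0; rewrite /ratio powR0 ?mul0r//; lra. Qed.

(** With [x = X u], [y = Y v], [z = Z t], the quotient of both sides by
    [ratio X Y Z] is [u exp (b ln (u / v) + c ln (u / t))] against
    [(1 + b + c) u - b v - c t], and [exp] and [ln] lie on the known sides of
    their tangents at [0] and [1]. *)
Lemma ratio_tangent b c x y z X Y Z :
  0 <= b -> 0 <= c -> 0 < X -> 0 < Y -> 0 < Z ->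
  0 <= x -> 0 <= y -> 0 <= z -> (x != 0 -> (0 < y) && (0 < z)) ->
  ratio b c X Y Z * ((1 + b + c) * (x / X) - b * (y / Y) - c * (z / Z))
    <= ratio b c x y z.
Proof.
move=> b0 c0 X0 Y0 Z0 x0 y0 z0 hx.
have [xE|xn0] := eqVneq x 0.
  rewrite xE mul0r mulr0 (le_trans _ (ratio_ge0 _ _ _ _ _))//.
  rewrite mulr_ge0_le0 ?ratio_ge0//.
  have : 0 <= b * (y / Y) by rewrite mulr_ge0 ?divr_ge0 ?(ltW Y0).
  have : 0 <= c * (z / Z) by rewrite mulr_ge0 ?divr_ge0 ?(ltW Z0).
  lra.
have /andP[y1 z1] := hx xn0; have x1 : 0 < x by rewrite lt0r xn0.
set u := x / X; set v := y / Y; set t := z / Z.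
have u0 : 0 < u by rewrite divr_gt0.
have v0 : 0 < v by rewrite divr_gt0.
have t0 : 0 < t by rewrite divr_gt0.
have -> : x = X * u by rewrite /u mulrC divfK ?gt_eqF.
have -> : y = Y * v by rewrite /v mulrC divfK ?gt_eqF.
have -> : z = Z * t by rewrite /t mulrC divfK ?gt_eqF.
clearbody u v t.
have -> : ratio b c (X * u) (Y * v) (Z * t) = ratio b c X Y Z * ratio b c u v t.
  rewrite /ratio !powRM ?ltW// (mulrACA (X `^ _)); exact: mulrACA.
rewrite ler_wpM2l ?ratio_ge0//.
have -> : ratio b c u v t = u * expR (b * ln (u / v) + c * ln (u / t)).
  rewrite /ratio /powR !gt_eqF// -{2}[u]lnK ?posrE// -!expRD !ln_div ?posrE//.
  by congr expR; ring.
have E := expR_ge1Dx (b * ln (u / v) + c * ln (u / t)).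
have L r : 0 < r -> 1 - r / u <= ln (u / r).
  move=> r0; have := @le_ln1Dx R (r / u - 1).
  have -> : u / r = (r / u)^-1 by rewrite invf_div.
  rewrite lnV ?posrE ?divr_gt0// [1 + _]addrC subrK => H.
  have : - 1 < r / u - 1 by have := divr_gt0 r0 u0; lra.
  move=> /H; lra.
have Lv := ler_wpM2l b0 (L _ v0); have Lt := ler_wpM2l c0 (L _ t0).
have : u * (1 + (b * (1 - v / u) + c * (1 - t / u))) <=
       u * expR (b * ln (u / v) + c * ln (u / t)).
  by rewrite ler_wpM2l ?(ltW u0)//; lra.
apply: le_trans; rewrite le_eqVlt; apply/orP; left; apply/eqP.
by field; rewrite gt_eqF.
Qed.

Lemma ratio_sum (I : finType) b c (x y z : I -> R) :
  0 <= b -> 0 <= c -> (forall i, 0 <= x i) -> (forall i, 0 <= y i) ->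
  (forall i, 0 <= z i) -> (forall i, x i != 0 -> (0 < y i) && (0 < z i)) ->
  ratio b c (\sum_i x i) (\sum_i y i) (\sum_i z i)
    <= \sum_i ratio b c (x i) (y i) (z i).
Proof.
move=> b0 c0 x0 y0 z0 hx.
set X := \sum_i x i; set Y := \sum_i y i; set Z := \sum_i z i.
have [X0|Xn0] := eqVneq X 0.
  by rewrite X0 ratio0// sumr_ge0// => i _; rewrite ratio_ge0.
have Xp : 0 < X by rewrite lt0r Xn0 sumr_ge0.
have [i xi0] : exists i, x i != 0.
  apply: contrapT => nex; move/eqP: Xn0; apply.
  by apply: big1 => i _; apply/eqP/negPn/negP => ?; apply: nex; exists i.
have /andP[yi zi] := hx i xi0.
have Yp : 0 < Y.
  by rewrite /Y (bigD1 i)//= ltr_pwDl// sumr_ge0.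
have Zp : 0 < Z.
  by rewrite /Z (bigD1 i)//= ltr_pwDl// sumr_ge0.
apply: (@le_trans _ _ (\sum_i ratio b c X Y Z *
   ((1 + b + c) * (x i / X) - b * (y i / Y) - c * (z i / Z)))); last first.
  by apply: ler_sum => j _; apply: ratio_tangent => //; exact: hx.
rewrite -mulr_sumr !sumrB -!mulr_sumr -!mulr_suml -/X -/Y -/Z.
rewrite !divff ?gt_eqF//; lra.
Qed.

Lemma persp_ratio p x y : persp p x y = ratio 0 (p - 1) x y y.
Proof.
rewrite /persp /ratio oppr0 powRr0 mulr1 opprB.
by have -> : 1 + 0 + (p - 1) = p by ring.
Qed.

Lemma persp_tangent p x y X Y : 1 < p -> 0 < X -> 0 < Y -> 0 <= x -> 0 < y ->
  persp p X Y * (p * (x / X) - (p - 1) * (y / Y)) <= persp p x y.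
Proof.
move=> p1 X0 Y0 x0 y0; rewrite !persp_ratio.
have := @ratio_tangent 0 (p - 1) x y y X Y Y (lexx 0) _ X0 Y0 Y0 x0 (ltW y0) (ltW y0).
rewrite y0 mul0r subr0 => /(_ _ (fun=> isT)).
by have -> : 1 + 0 + (p - 1) = p; [ring|apply; rewrite subr_ge0 ltW].
Qed.

Lemma le_persp p x y : 1 < p -> 0 <= x -> 0 < y -> x <= persp p x y + p * y.
Proof.
move=> p1 x0 y0; have := persp_tangent p1 ltr01 ltr01 x0 y0.
rewrite /persp !powR1 !divr1 !mul1r => h.
have := mulr_ge0 (ltW (lt_le_trans ltr01 (ltW p1))) (ltW y0).
have : 0 <= (p - 1) * x by rewrite mulr_ge0// subr_ge0 ltW.
lra.
Qed.

(** The loss of [ratio] when a stopping mass is added to its last argument is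
    a fixed proportion of its value at that mass. *)
Definition gap c C : R :=
  (1 + C) `^ (- c) * (1 - (1 + (1 + C)^-1) `^ (- c)).

Lemma gap_gt0 c C : 0 < c -> 0 <= C -> 0 < gap c C.
Proof.
move=> c0 C0; have C1 : 0 < 1 + C by lra.
rewrite mulr_gt0 ?powR_gt0// subr_gt0 powRN invf_lt1 ?powR_gt0//; last first.
  by have := invr_gt0 (1 + C); rewrite C1; lra.
rewrite [ltLHS](_ : _ = 1 `^ c); last by rewrite powR1.
rewrite gt0_ltr_powR// ?nnegrE//.
  by rewrite addr_ge0// invr_ge0 ltW.
by rewrite ltrDl invr_gt0.
Qed.

Lemma ratio_gap b c C x y M s : 0 < c -> 0 <= C -> 0 <= M -> 0 <= s -> s <= C * M ->
  (M = 0 -> x = 0) -> 0 <= b ->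
  ratio b c x y M * gap c C <= ratio b c x y (M + s) - ratio b c x y (M + M + s).
Proof.
move=> c0 C0 M0 s0 sC xM b0.
have [ME|Mn0] := eqVneq M 0.
  by rewrite xM// !ratio0 ?(ltW c0)// mul0r subrr.
have Mp : 0 < M by rewrite lt0r Mn0.
rewrite /ratio -!mulrBr -mulrA ler_wpM2l ?mulr_ge0 ?powR_ge0//.
have [t [t1 tC tE]] : exists t, [/\ 1 <= t, t <= 1 + C & M + s = M * t].
  exists ((M + s) / M); split; last by rewrite mulrC divfK.
  - by rewrite mulrDl divff// lerDl divr_ge0.
  - by rewrite mulrDl divff// lerD2l ler_pdivrMr.
have -> : M + M + s = M * (t + 1) by rewrite mulrDr mulr1 -tE addrAC.
have tp : 0 < t by lra.
have t1p : 0 < t + 1 by lra.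
rewrite tE !powRM ?(ltW tp) ?(ltW t1p)// -mulrBr ler_wpM2l ?powR_ge0//.
have -> : t + 1 = t * (1 + t^-1) by rewrite mulrDr mulr1 divff ?gt_eqF.
have ti : 0 <= t^-1 by rewrite invr_ge0 ltW.
have Ci : 0 < (1 + C)^-1 by rewrite invr_gt0; lra.
rewrite powRM//; try lra.
rewrite -[X in _ <= X - _]mulr1 -mulrBr /gap.
have anti (r1 r2 : R) : 0 < r1 -> r1 <= r2 -> r2 `^ (- c) <= r1 `^ (- c).
  move=> r10 r12; rewrite !powRN lef_pV2 ?posrE ?powR_gt0//; last by lra.
  by rewrite ge0_ler_powR ?(ltW c0)// ?nnegrE; lra.
apply: ler_pM; rewrite ?powR_ge0//.
- have := gap_gt0 c0 C0; rewrite /gap pmulr_rgt0 ?powR_gt0//; last by lra.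
  exact: ltW.
- exact: anti.
- rewrite lerD2l lerN2; apply: anti; first by lra.
  by rewrite lerD2l lef_pV2 ?posrE//; lra.
Qed.

End Ratio.

(** * Stopping cubes and the bilinear estimate on a tree *)

Section Tree.
Context {R : realType} {V : Type} {I : finType}.
Variable ch : V -> I -> V.
Implicit Types (X Y Z M : V -> R) (v : V) (N : nat).

Definition tree_additive X := forall v, X v = \sum_i X (ch v i).

Lemma tree_additive_le X : tree_additive X -> (forall v, 0 <= X v) ->
  forall v i, X (ch v i) <= X v.
Proof.
by move=> addX X0 v i; rewrite [leRHS]addX (bigD1 i)//= lerDl sumr_ge0.
Qed.

Variables m phi psi : V -> R.
Hypotheses (m_add : tree_additive m) (phi_add : tree_additive phi)
  (psi_add : tree_additive psi).
Hypotheses (m_ge0 : forall v, 0 <= m v) (phi_ge0 : forall v, 0 <= phi v)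
  (psi_ge0 : forall v, 0 <= psi v).
Hypotheses (phi_m : forall v, m v = 0 -> phi v = 0)
  (psi_m : forall v, m v = 0 -> psi v = 0).

Definition avg X v := X v / m v.

Definition stops (l k : R) v := (l < avg phi v) || (k < avg psi v).

(** The sum of [X] over the stopping vertices at most [N] generations below [v].
    The factor four at a restart makes the first stopping vertices below a
    restart carry at most half of its mass. *)
Fixpoint stopped_sum N (l k : R) X v : R :=
  if N is N'.+1 then
    \sum_i (if stops l k (ch v i)
            then X (ch v i) + stopped_sum N' (4 * avg phi (ch v i))
                                (4 * avg psi (ch v i)) X (ch v i)
            else stopped_sum N' l k X (ch v i))
  else 0.

Definition controlled (l k : R) v :=
  [/\ 0 <= l, 0 <= k, phi v <= l * m v & psi v <= k * m v].

Lemma avgK X v : (m v = 0 -> X v = 0) -> m v * avg X v = X v.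
Proof.
move=> Xm; have [mE|mn0] := eqVneq (m v) 0; last by rewrite mulrC divfK.
by rewrite mE mul0r Xm.
Qed.

Lemma avg_ge0 X v : 0 <= X v -> 0 <= avg X v.
Proof. by move=> X0; rewrite divr_ge0. Qed.

Let avg_phi_ge0 v : 0 <= avg phi v. Proof. exact: avg_ge0. Qed.
Let avg_psi_ge0 v : 0 <= avg psi v. Proof. exact: avg_ge0. Qed.
Local Hint Resolve avg_phi_ge0 avg_psi_ge0 : core.

Lemma controlled_restart v : controlled (4 * avg phi v) (4 * avg psi v) v.
Proof.
split; try by apply: mulr_ge0.
all: rewrite -mulrA [avg _ _ * _]mulrC avgK; try exact: phi_m;
  try exact: psi_m.
- by have := phi_ge0 v; lra.
- by have := psi_ge0 v; lra.
Qed.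

Lemma controlled_stay l k v i : controlled l k v -> ~~ stops l k (ch v i) ->
  controlled l k (ch v i).
Proof.
move=> [l0 k0 _ _]; rewrite negb_or -!leNgt => /andP[hl hk]; split => //.
- by rewrite -(avgK (@phi_m _)) mulrC ler_wpM2r.
- by rewrite -(avgK (@psi_m _)) mulrC ler_wpM2r.
Qed.

Lemma controlled_avg l k v : controlled l k v ->
  avg phi v <= l /\ avg psi v <= k.
Proof.
move=> [l0 k0 hl hk]; have [mE|mn0] := eqVneq (m v) 0.
  by rewrite /avg mE invr0 !mulr0.
have mp : 0 < m v by rewrite lt0r mn0 m_ge0.
by rewrite /avg !ler_pdivrMr.
Qed.

Lemma stopped_sum_ge0 N l k X v : (forall v, 0 <= X v) ->
  0 <= stopped_sum N l k X v.
Proof.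
move=> X0; elim: N l k v => [//|N IH] l k v /=; apply: sumr_ge0 => i _.
by case: ifP => _; rewrite ?addr_ge0.
Qed.

Lemma stopped_sumD N l k X Y (a : R) v :
  stopped_sum N l k (fun v => X v + a * Y v) v =
  stopped_sum N l k X v + a * stopped_sum N l k Y v.
Proof.
elim: N l k v => [|N IH] l k v /=; first by rewrite mulr0 addr0.
rewrite mulr_sumr -big_split/=; apply: eq_bigr => i _.
by case: ifP => _; rewrite IH//; ring.
Qed.

Lemma stopped_sum_le N l k X Y v : (forall v, X v <= Y v) ->
  stopped_sum N l k X v <= stopped_sum N l k Y v.
Proof.
move=> XY; elim: N l k v => [//|N IH] l k v /=; apply: ler_sum => i _.
by case: ifP => _; rewrite ?lerD.
Qed.

(** Stopping is rare: on a stopping vertex an average has jumped by a factor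
    four, and the two masses [phi] and [psi] are shared among the vertices of
    each generation of stopping. *)
Lemma stopped_mass_le N l k v : controlled l k v ->
  stopped_sum N l k m v <= 2 * (phi v / l + psi v / k).
Proof.
elim: N l k v => [|N IH] l k v ctrl /=.
  by case: ctrl => *; rewrite mulr_ge0// addr_ge0// divr_ge0.
rewrite [phi v]phi_add [psi v]psi_add !mulr_suml -big_split/= mulr_sumr.
apply: ler_sum => i _; set c := ch v i.
case: ifPn => [st|nst]; last by apply: IH; exact: controlled_stay.
have half X : (m c = 0 -> X c = 0) -> 0 <= X c ->
    X c / (4 * avg X c) <= m c / 4.
  move=> Xm X0; have [XE|Xn0] := eqVneq (X c) 0.
    by rewrite XE mul0r divr_ge0.
  have mn0 : m c != 0 by apply: contra_neq Xn0; exact: Xm.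
  by rewrite /avg le_eqVlt; apply/orP; left; apply/eqP; field; apply/andP.
have := IH _ _ _ (controlled_restart c).
have := half phi (@phi_m _) (phi_ge0 _); have := half psi (@psi_m _) (psi_ge0 _).
have [l0 k0 hl hk] := ctrl.
have phic : 0 <= phi c / l by rewrite divr_ge0.
have psic : 0 <= psi c / k by rewrite divr_ge0.
have jump X r : (m c = 0 -> X c = 0) -> 0 <= X c -> X v <= r * m v ->
    X c <= X v -> 0 <= r -> r < avg X c -> m c <= X c / r.
  move=> Xm X0 Xr Xc; rewrite le_eqVlt => /predU1P[r0|r0] st'.
    have : X c = 0 by apply/eqP; rewrite eq_le X0 (le_trans Xc)// (le_trans Xr)// -r0 mul0r.
    by move=> XE; move: st'; rewrite -r0 /avg XE mul0r ltxx.
  by rewrite ler_pdivlMr// -[leRHS](avgK Xm) ler_wpM2l// ltW.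
have : m c <= phi c / l + psi c / k.
  have cphi := tree_additive_le phi_add phi_ge0 v i.
  have cpsi := tree_additive_le psi_add psi_ge0 v i.
  case/orP: st => st.
  - have := jump phi l (@phi_m _) (phi_ge0 _) hl cphi l0 st; lra.
  - have := jump psi k (@psi_m _) (psi_ge0 _) hk cpsi k0 st; lra.
lra.
Qed.

Lemma stopped_mass_restart_le N v :
  stopped_sum N (4 * avg phi v) (4 * avg psi v) m v <= 1 * m v.
Proof.
apply: le_trans (stopped_mass_le N (controlled_restart v)) _.
have half X : (m v = 0 -> X v = 0) -> 0 <= X v -> X v / (4 * avg X v) <= m v / 4.
  move=> Xm X0; have [XE|Xn0] := eqVneq (X v) 0.
    by rewrite XE mul0r divr_ge0.
  have mn0 : m v != 0 by apply: contra_neq Xn0; exact: Xm.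
  by rewrite /avg le_eqVlt; apply/orP; left; apply/eqP; field; apply/andP.
have := half phi (@phi_m _) (phi_ge0 _); have := half psi (@psi_m _) (psi_ge0 _).
lra.
Qed.

(** The Carleson embedding theorem, by the Bellman function
    [Z - ratio b c X Y (M + stopped mass)]. Its value at the parent is at least
    the sum over the children, as [ratio] is subadditive; and a stopping child
    adds its own [M] to the stopped mass seen by the parent, which frees the
    amount [gap c C * ratio b c X Y M] there ([ratio_gap]). *)
Lemma carleson_embedding b c C X Y M Z :
  0 <= b -> 0 < c -> 0 <= C ->
  tree_additive X -> tree_additive Y -> tree_additive M -> tree_additive Z ->
  (forall v, 0 <= X v) -> (forall v, 0 <= Y v) -> (forall v, 0 <= M v) ->
  (forall v, X v != 0 -> (0 < Y v) && (0 < M v)) ->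
  (forall v, ratio b c (X v) (Y v) (M v) <= Z v) ->
  (forall N v, stopped_sum N (4 * avg phi v) (4 * avg psi v) M v <= C * M v) ->
  forall N l k v,
  stopped_sum N l k (fun u => ratio b c (X u) (Y u) (M u)) v <= (gap c C)^-1 * Z v.
Proof.
move=> b0 c0 C0 addX addY addM addZ X0 Y0 M0 pos leZ packed N l k v.
have g0 := gap_gt0 c0 C0.
suff : stopped_sum N l k (fun u => ratio b c (X u) (Y u) (M u)) v * gap c C <=
    Z v - ratio b c (X v) (Y v) (M v + stopped_sum N l k M v).
  move=> H; rewrite [leRHS]mulrC ler_pdivlMr//; apply: le_trans H _.
  by rewrite gerBl ratio_ge0.
elim: N l k v => [|N IH] l k v.
  by rewrite /= mul0r addr0 subr_ge0.
pose T u := if stops l k u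
  then M u + M u + stopped_sum N (4 * avg phi u) (4 * avg psi u) M u
  else M u + stopped_sum N l k M u.
have TE : M v + stopped_sum N.+1 l k M v = \sum_i T (ch v i).
  rewrite [M v]addM /= -big_split/=; apply: eq_bigr => i _.
  by rewrite /T; case: ifP => _//; rewrite addrA.
have MT u : M u <= T u.
  by rewrite /T; case: ifP => _; rewrite -?addrA lerDl ?addr_ge0 ?stopped_sum_ge0.
apply: (@le_trans _ _ (\sum_i (Z (ch v i) -
    ratio b c (X (ch v i)) (Y (ch v i)) (T (ch v i))))); last first.
  rewrite sumrB -[\sum_i Z _]addZ lerD2l lerN2 TE [X v]addX [Y v]addY.
  apply: ratio_sum => // [|i|i /pos/andP[-> /=]]; first exact: ltW.
    exact: le_trans (MT _).
  by move=> /lt_le_trans; apply.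
rewrite /= mulr_suml; apply: ler_sum => i _; rewrite /T.
case: ifP => _; last exact: IH.
set u := ch v i; rewrite mulrDl.
apply: le_trans (lerD _ (IH _ _ _)) _.
  apply: (@ratio_gap _ b c C (X u) (Y u) (M u)
    (stopped_sum N (4 * avg phi u) (4 * avg psi u) M u)) => //.
  - exact: stopped_sum_ge0.
  - move=> ME; apply/eqP/negPn/negP => /pos /andP[_]; by rewrite ME ltxx.
lra.
Qed.

(** Within one stopping region the martingale differences are paid for by the
    growth of the squares [avg phi ^ 2 / l] and [avg psi ^ 2 / k], which the
    thresholds bound. *)
Definition pot (l k : R) v : R :=
  m v * (3 * k * avg phi v + 3 * l * avg psi v
   - k / l / 2 * avg phi v ^+ 2 - l / k / 2 * avg psi v ^+ 2).

Definition diff X v u : R := `|avg X u - avg X v|.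

Lemma threshold_ratio (l k f : R) : 0 <= l -> 0 <= k -> 0 <= f -> f <= l ->
  k / l * f <= k.
Proof.
move=> l0 k0 f0; have [->|ln0] := eqVneq l 0; first by rewrite invr0 mulr0 mul0r.
have lp : 0 < l by rewrite lt0r ln0.
by move=> fl; rewrite mulrAC ler_pdivrMr// ler_wpM2l.
Qed.

Lemma pot_ge0 l k v : controlled l k v -> 0 <= pot l k v.
Proof.
move=> ctrl; have [l0 k0 _ _] := ctrl; have [fl gk] := controlled_avg ctrl.
apply: mulr_ge0 => //.
have := threshold_ratio l0 k0 (avg_phi_ge0 v) fl.
have := threshold_ratio k0 l0 (avg_psi_ge0 v) gk.
move: (avg_phi_ge0 v) (avg_psi_ge0 v) fl gk.
move: (avg phi v) (avg psi v) (k / l) (l / k) => f g a b f0 g0 fl gk bg af.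
have := ler_wpM2r f0 af; have := ler_wpM2r g0 bg.
have := mulr_ge0 l0 g0; have := mulr_ge0 k0 f0; lra.
Qed.

Lemma pot_step_stay (l k f g F G : R) : 0 <= l -> 0 <= k ->
  0 <= f -> 0 <= F -> 0 <= g -> 0 <= G -> f <= l -> F <= l -> g <= k -> G <= k ->
  `|F - f| * `|G - g| <=
  k / l / 2 * (F - f) ^+ 2 + l / k / 2 * (G - g) ^+ 2.
Proof.
move=> l0 k0 f0 F0 g0 G0 fl Fl gk Gk.
rewrite -(real_normK (num_real (F - f))) -(real_normK (num_real (G - g))).
have [lE|ln0] := eqVneq l 0.
  have -> : F - f = 0 by lra.
  by rewrite normr0 mul0r lE !mul0r addr_ge0// mulr_ge0// ?divr_ge0 ?invr_ge0.
have [kE|kn0] := eqVneq k 0.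
  have -> : G - g = 0 by lra.
  by rewrite normr0 mulr0 kE !mul0r addr_ge0// mulr_ge0// ?divr_ge0 ?invr_ge0.
have lp : 0 < l by rewrite lt0r ln0.
have kp : 0 < k by rewrite lt0r kn0.
move: (`|F - f|) (`|G - g|) => x y.
have : 0 <= k / l / 2 * (x - l / k * y) ^+ 2.
  by rewrite mulr_ge0 ?sqr_ge0// !divr_ge0.
suff -> : k / l / 2 * (x - l / k * y) ^+ 2 =
  k / l / 2 * x ^+ 2 + l / k / 2 * y ^+ 2 - x * y by lra.
by field; apply/andP.
Qed.

(** At a stopping child the linear terms [k * avg phi + l * avg psi] of the old
    potential absorb the jump up to one copy of the product of the averages, and
    the new potential is at most 24 copies of it. *)
Lemma pot_step_stop (l k f g F G : R) : 0 <= l -> 0 <= k ->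
  0 <= f -> 0 <= F -> 0 <= g -> 0 <= G -> f <= l -> g <= k ->
  (l < F) || (k < G) ->
  `|F - f| * `|G - g| <= F * G + 3 * k * F + 3 * l * G
    - k / l * F * f + k / l / 2 * f ^+ 2 - l / k * G * g + l / k / 2 * g ^+ 2.
Proof.
move=> l0 k0 f0 F0 g0 G0 fl gk st.
have af := threshold_ratio l0 k0 f0 fl; have bg := threshold_ratio k0 l0 g0 gk.
have a0 : 0 <= k / l by rewrite divr_ge0.
have b0 : 0 <= l / k by rewrite divr_ge0.
move: (k / l) (l / k) a0 b0 af bg => a b a0 b0 af bg.
have h1 := ler_wpM2r F0 af; have h2 := ler_wpM2r G0 bg.
have h3 : 0 <= a / 2 * f ^+ 2 by rewrite mulr_ge0 ?sqr_ge0 ?divr_ge0.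
have h4 : 0 <= b / 2 * g ^+ 2 by rewrite mulr_ge0 ?sqr_ge0 ?divr_ge0.
have Ff : `|F - f| <= F + l by rewrite ler_norml; lra.
have Gg : `|G - g| <= G + k by rewrite ler_norml; lra.
apply: le_trans (ler_pM (normr_ge0 _) (normr_ge0 _) Ff Gg) _.
have : l * k <= k * F + l * G.
  have kF := mulr_ge0 k0 F0; have lG := mulr_ge0 l0 G0.
  case/orP: st => st.
  - have := ler_wpM2l k0 (ltW st); lra.
  - have := ler_wpM2l l0 (ltW st); lra.
have -> : a * F * f = a * f * F by ring.
have -> : b * G * g = b * g * G by ring.
nra.
Qed.

Lemma pot_restart v :
  pot (4 * avg phi v) (4 * avg psi v) v <= 24 * (m v * (avg phi v * avg psi v)).
Proof.
rewrite /pot [leRHS]mulrCA ler_wpM2l//.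
have f0 := avg_phi_ge0 v; have g0 := avg_psi_ge0 v.
have : 0 <= 4 * avg psi v / (4 * avg phi v) / 2 * avg phi v ^+ 2.
  by rewrite mulr_ge0 ?sqr_ge0// !divr_ge0// mulr_ge0.
have : 0 <= 4 * avg phi v / (4 * avg psi v) / 2 * avg psi v ^+ 2.
  by rewrite mulr_ge0 ?sqr_ge0// !divr_ge0// mulr_ge0.
lra.
Qed.

Fixpoint diff_sum N v : R :=
  if N is N'.+1 then
    \sum_i (m (ch v i) * (diff phi v (ch v i) * diff psi v (ch v i))
            + diff_sum N' (ch v i))
  else 0.

Lemma diff_sum_le_stopped N l k v : controlled l k v ->
  diff_sum N v <= pot l k v +
    25 * stopped_sum N l k (fun u => m u * (avg phi u * avg psi u)) v.
Proof.
elim: N l k v => [|N IH] l k v ctrl.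
  by rewrite /= mulr0 addr0 pot_ge0.
have [l0 k0 _ _] := ctrl; have [fl gk] := controlled_avg ctrl.
set f := avg phi v; set g := avg psi v; set a := k / l; set b := l / k.
pose L u := 3 * k * avg phi u + 3 * l * avg psi u
   - a * avg phi u * f + a / 2 * f ^+ 2 - b * avg psi u * g + b / 2 * g ^+ 2.
have potE : pot l k v = \sum_i m (ch v i) * L (ch v i).
  transitivity (\sum_i ((3 * k - a * f) * phi (ch v i) +
    (3 * l - b * g) * psi (ch v i) + (a / 2 * f ^+ 2 + b / 2 * g ^+ 2) * m (ch v i))).
    rewrite !big_split/= -!mulr_sumr -phi_add -psi_add -m_add.
    rewrite -(avgK (@phi_m v)) -(avgK (@psi_m v)) /pot -/f -/g -/a -/b; lra.
  apply: eq_bigr => i _.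
  rewrite -(avgK (@phi_m (ch v i))) -(avgK (@psi_m (ch v i))) /L; lra.
rewrite potE /= mulr_sumr -big_split/=; apply: ler_sum => i _.
have f0 : 0 <= f by exact: avg_phi_ge0.
have g0 : 0 <= g by exact: avg_psi_ge0.
set c := ch v i; case: ifPn => st.
- have := IH _ _ _ (controlled_restart c); have := pot_restart c.
  have := pot_step_stop l0 k0 f0 (avg_phi_ge0 c) g0 (avg_psi_ge0 c) fl gk st.
  move/(ler_wpM2l (m_ge0 c)); rewrite /diff -/f -/g -/a -/b /L; lra.
- have ctrlc := controlled_stay ctrl st; have [Fl Gk] := controlled_avg ctrlc.
  have := IH _ _ _ ctrlc.
  have := pot_step_stay l0 k0 f0 (avg_phi_ge0 c) g0 (avg_psi_ge0 c) fl Fl gk Gk.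
  move/(ler_wpM2l (m_ge0 c)); rewrite /diff /pot -/f -/g -/a -/b /L; lra.
Qed.

Lemma diff_sum_le N v :
  diff_sum N v <= 24 * (m v * (avg phi v * avg psi v)) +
    25 * stopped_sum N (4 * avg phi v) (4 * avg psi v)
           (fun u => m u * (avg phi u * avg psi u)) v.
Proof.
apply: le_trans (diff_sum_le_stopped N (controlled_restart v)) _.
by rewrite lerD2r pot_restart.
Qed.

End Tree.

Section WeightedTree.
Context {R : realType} {V : Type} {I : finType}.
Variable ch : V -> I -> V.
Variables m phi psi : V -> R.
Hypotheses (m_add : tree_additive ch m) (phi_add : tree_additive ch phi)
  (psi_add : tree_additive ch psi).
Hypotheses (m_ge0 : forall v, 0 <= m v) (phi_ge0 : forall v, 0 <= phi v)
  (psi_ge0 : forall v, 0 <= psi v).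
Hypotheses (phi_m : forall v, m v = 0 -> phi v = 0)
  (psi_m : forall v, m v = 0 -> psi v = 0).

Let sp N l k X v := stopped_sum ch m phi psi N l k X v.

Definition carleson_const (q K : R) : R := (gap (q - 1) ((gap 1 1)^-1 * K))^-1.

Lemma carleson_const_gt0 (q K : R) : 1 < q -> 0 <= K -> 0 < carleson_const q K.
Proof.
move=> q1 K0; rewrite invr_gt0 gap_gt0 ?subr_gt0// mulr_ge0// invr_ge0 ltW//.
by rewrite gap_gt0.
Qed.

(** Carleson embedding used twice: packing of the stopping vertices with respect
    to [m] gives packing with respect to the weight [s], because [s] is
    comparable to the convex function [persp q' m w]; packing with respect to
    [s] then bounds the averages of [x] against [s]. *)
Lemma weighted_carleson (q q' K : R) (w s x a : V -> R) :
  1 < q -> 1 < q' -> 0 <= K ->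
  tree_additive ch w -> tree_additive ch s -> tree_additive ch x ->
  tree_additive ch a ->
  (forall v, 0 <= w v) -> (forall v, 0 <= s v) -> (forall v, 0 <= x v) ->
  (forall v, m v != 0 -> 0 < w v) -> (forall v, m v != 0 -> 0 < s v) ->
  (forall v, x v != 0 -> m v != 0) ->
  (forall v, persp q' (m v) (w v) <= s v) ->
  (forall v, s v <= K * persp q' (m v) (w v)) ->
  (forall v, persp q (x v) (s v) <= a v) ->
  forall N l k v,
  sp N l k (fun u => persp q (x u) (s u)) v <= carleson_const q K * a v.
Proof.
move=> q1 q'1 K0 addw adds addx adda w0 s0 x0 wp sp' xm ms sK xa N l k v.
have perspE u : persp q' (m u) (w u) = ratio (q' - 1) 1 (m u) (w u) (m u).
  rewrite /persp /ratio; have -> : 1 + (q' - 1) + 1 = q' + 1 by ring.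
  have [->|mn0] := eqVneq (m u) 0; first by rewrite !powR0 ?mul0r//; lra.
  rewrite opprB mulrAC; congr (_ * _).
  rewrite -powRD ?addrK//; apply/implyP => _; exact: mn0.
have perspE' u : persp q (x u) (s u) = ratio 0 (q - 1) (x u) (s u) (s u).
  exact: persp_ratio.
rewrite (_ : (fun u => _) = fun u => ratio 0 (q - 1) (x u) (s u) (s u)); last first.
  by apply/funext => u.
apply: carleson_embedding => //; rewrite ?subr_gt0//.
- by rewrite mulr_ge0// invr_ge0 ltW// gap_gt0.
- by move=> u /xm mu; rewrite sp'.
- by move=> u; rewrite -perspE'.
move=> M u; set f := 4 * _; set g := 4 * _.
apply: (@le_trans _ _ (K * sp M f g (fun u => ratio (q' - 1) 1 (m u) (w u) (m u)) u)).
  rewrite -[leRHS]add0r.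
  have := stopped_sumD ch m phi psi M f g (fun=> 0) (fun u => ratio (q' - 1) 1 (m u) (w u) (m u)) K u.
  have := stopped_sumD ch m phi psi M f g (fun=> 0) (fun=> 0) 1 u.
  rewrite (_ : (fun _ => 0 + 1 * 0) = fun=> 0); last by apply/funext => ?; ring.
  move=> sp0 spK; apply: (@le_trans _ _ (stopped_sum ch m phi psi M f g
      (fun v0 => 0 + K * ratio (q' - 1) 1 (m v0) (w v0) (m v0)) u)).
    by apply: stopped_sum_le => t; rewrite add0r -perspE.
  rewrite spK lerD2r; lra.
rewrite mulrAC [leRHS]mulrC ler_wpM2l//.
apply: carleson_embedding => //; rewrite ?subr_ge0 ?(ltW q'1)//.
- by move=> t mt; rewrite wp// lt0r mt m_ge0.
- by move=> t; rewrite -perspE.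
- by move=> M' t; exact: stopped_mass_restart_le.
Qed.

Variables (p p' K : R) (W S A B : V -> R).
Hypotheses (p1 : 1 < p) (p'1 : 1 < p') (pp' : p^-1 + p'^-1 = 1) (K0 : 0 <= K).
Hypotheses (W_add : tree_additive ch W) (S_add : tree_additive ch S)
  (A_add : tree_additive ch A) (B_add : tree_additive ch B).
Hypotheses (W_gt0 : forall v, m v != 0 -> 0 < W v)
  (S_gt0 : forall v, m v != 0 -> 0 < S v)
  (W_ge0 : forall v, 0 <= W v) (S_ge0 : forall v, 0 <= S v).
Hypotheses (mS : forall v, persp p (m v) (S v) <= W v)
  (mW : forall v, persp p' (m v) (W v) <= S v)
  (WK : forall v, W v <= K * persp p (m v) (S v))
  (SK : forall v, S v <= K * persp p' (m v) (W v)).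
Hypotheses (phiA : forall v, persp p (phi v) (S v) <= A v)
  (psiB : forall v, persp p' (psi v) (W v) <= B v).

(** Young's inequality for [phi / S] and [psi / m], multiplied by [S]; in the
    second term the [A_p] condition [SK] replaces [S] by [persp p' m W]. *)
Lemma avg_product_le v : m v * (avg m phi v * avg m psi v) <=
  persp p (phi v) (S v) + K * persp p' (psi v) (W v).
Proof.
have [mE|mn0] := eqVneq (m v) 0.
  by rewrite mE mul0r addr_ge0 ?persp_ge0// mulr_ge0// persp_ge0.
have mp : 0 < m v by rewrite lt0r mn0 m_ge0.
have Sp := S_gt0 mn0; have Wp := W_gt0 mn0.
have p0 : 0 < p := lt_trans ltr01 p1.
have p'0 : 0 < p' := lt_trans ltr01 p'1.
set y := psi v / m v; have y0 : 0 <= y by rewrite divr_ge0.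
set u := phi v / S v; have u0 : 0 <= u by rewrite divr_ge0.
have -> : m v * (avg m phi v * avg m psi v) = S v * (u * y).
  by rewrite /avg /u /y; field; rewrite (gt_eqF mp) (gt_eqF Sp).
have young : u * y <= u `^ p + y `^ p'.
  apply: le_trans (conjugate_powR u0 y0 p0 p'0 pp') _.
  by apply: lerD; rewrite ler_piMr ?powR_ge0// invf_le1// ltW.
apply: le_trans (ler_wpM2l (ltW Sp) young) _; rewrite mulrDr; apply: lerD.
  rewrite /u /persp -[X in X * _ <= _](powRr1 (ltW Sp)).
  rewrite powRM// ?invr_ge0 ?(ltW Sp)// mulrCA -powR_inv1 ?(ltW Sp)//.
  rewrite -[(S v `^ -1) `^ p]powRrM -powRD ?(gt_eqF Sp) ?implybT//.
  by rewrite mulN1r.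
apply: le_trans (ler_wpM2r (powR_ge0 _ _) (SK v)) _.
rewrite -mulrA ler_wpM2l// /persp /y powRM// ?invr_ge0//.
rewrite -[(m v)^-1]powR_inv1// -powRrM mulN1r.
have E : m v `^ p' * m v `^ (- p') = 1.
  by rewrite powRN mulfV// powR_eq0 negb_and mn0.
rewrite [leLHS](_ : _ = psi v `^ p' * W v `^ (1 - p') * (m v `^ p' * m v `^ (- p'))).
  by rewrite E mulr1.
by ring.
Qed.

Definition tree_const : R :=
  (24 + 25 * carleson_const p K) + K * (24 + 25 * carleson_const p' K).

Lemma tree_const_ge0 : 0 <= tree_const.
Proof.
have := carleson_const_gt0 p1 K0; have := carleson_const_gt0 p'1 K0 => h1 h2.
rewrite addr_ge0 ?mulr_ge0//; lra.
Qed.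

(** The stopping argument leaves the products of the averages at the stopping
    vertices; Young's inequality splits them into two weighted Carleson sums. *)
Lemma tree_bilinear_bound N v :
  diff_sum ch m phi psi N v <= tree_const * (A v + B v).
Proof.
apply: le_trans (diff_sum_le m_add phi_add psi_add m_ge0 phi_ge0 psi_ge0 phi_m psi_m N v) _.
set l := 4 * _; set k := 4 * _.
have sA := @weighted_carleson p p' K W S phi A p1 p'1 K0 W_add S_add phi_add
  A_add W_ge0 S_ge0 phi_ge0 W_gt0 S_gt0 (fun v => contra_neq (@phi_m v)) mW SK phiA N l k v.
have sB := @weighted_carleson p' p K S W psi B p'1 p1 K0 S_add W_add psi_add
  B_add S_ge0 W_ge0 psi_ge0 S_gt0 W_gt0 (fun v => contra_neq (@psi_m v)) mS WK psiB N l k v.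
have : sp N l k (fun u => m u * (avg m phi u * avg m psi u)) v <=
    carleson_const p K * A v + K * (carleson_const p' K * B v).
  apply: le_trans (stopped_sum_le ch m phi psi N l k v avg_product_le) _.
  by rewrite stopped_sumD lerD// ler_wpM2l.
have := avg_product_le v.
have A0 : 0 <= A v := le_trans (persp_ge0 _ _ _) (phiA v).
have B0 : 0 <= B v := le_trans (persp_ge0 _ _ _) (psiB v).
have cA := carleson_const_gt0 p1 K0; have cB := carleson_const_gt0 p'1 K0.
have := ler_wpM2l K0 (psiB v); have := phiA v.
have := mulr_ge0 (ltW cA) B0; have := mulr_ge0 (ltW cB) A0.
have := mulr_ge0 K0 (mulr_ge0 (ltW cB) A0); have := mulr_ge0 K0 A0.
rewrite /sp /tree_const; lra.
Qed.

End WeightedTree.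

(** * Dyadic cubes *)

Section DyadicGeometry.
Context {R : realType} {n : nat}.
Implicit Types (Q v : dyadic n) (x : 'rV[R]_n) (k : int) (j : nat).

Lemma side_gt0 Q : 0 < side (R := R) Q.
Proof. by rewrite exprz_gt0. Qed.

Definition locate k x : dyadic n :=
  (k, [ffun i => Num.floor (x 0 i / (2 : R) ^ k)]).

Lemma cubeP Q x : cube Q x <-> locate Q.1 x = Q.
Proof.
case: Q => k q; have k0 : 0 < (2 : R) ^ k by rewrite exprz_gt0.
have E i : ((2 : R) ^ k * (q i)%:~R <= x 0 i < 2 ^ k * (q i + 1)%:~R) =
    (Num.floor (x 0 i / 2 ^ k) == q i).
  by rewrite floor_eq ler_pdivlMr// ltr_pdivrMr// ![_%:~R * _]mulrC.
rewrite /cube /locate /side /=; split => [cx|[<-] i].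
  by congr pair; apply/ffunP => i; rewrite ffunE; apply/eqP; rewrite -E; exact: cx.
by rewrite ffunE -[X in is_true X]/(_ && _); have := floor_itv (x 0 i / 2 ^ k);
  rewrite ler_pdivlMr// ltr_pdivrMr// ![_%:~R * _]mulrC.
Qed.

Lemma cube_locate k x : cube (locate k x) x.
Proof. exact/cubeP. Qed.

Lemma parent_locate k x : parent (locate k x) = locate (k + 1) x.
Proof.
rewrite /parent /locate /=; congr pair; apply/ffunP => i; rewrite !ffunE.
set t := x 0 i / 2 ^ k.
have -> : x 0 i / 2 ^ (k + 1) = t / 2.
  by rewrite expfzDr// expr1z invfM mulrA.
move: t => {}t.
have H a : (a <= (Num.floor t %/ 2)%Z) = (a <= Num.floor (t / 2)).
    by rewrite lez_divRL// !floor_ge_int_tmp intrM ler_pdivlMr.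
by apply/eqP; rewrite eq_le -H lexx H lexx.
Qed.

Lemma cube_sub_parent Q : cube (R := R) Q `<=` cube (parent Q).
Proof. by move=> x /cubeP xQ; apply/cubeP; rewrite -parent_locate xQ. Qed.

Lemma same_level_eq Q Q' x : Q.1 = Q'.1 -> cube Q x -> cube Q' x -> Q = Q'.
Proof. by move=> QQ' /cubeP <- /cubeP <-; rewrite QQ'. Qed.

Definition child v (f : {ffun 'I_n -> bool}) : dyadic n :=
  (v.1 - 1, [ffun i => 2 * v.2 i + (f i : nat)%:Z]).

Definition parity Q : {ffun 'I_n -> bool} := [ffun i => (Q.2 i %% 2)%Z != 0].

Lemma parent_child v f : parent (child v f) = v.
Proof.
case: v => k q; rewrite /parent /child /=; congr pair; first by rewrite subrK.
apply/ffunP => i; rewrite !ffunE mulrC divzMDl// divz_small ?addr0//.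
by case: (f i).
Qed.

Lemma child_parity Q : child (parent Q) (parity Q) = Q.
Proof.
case: Q => k q; rewrite /parent /child /=; congr pair; first by rewrite addrK.
apply/ffunP => i; rewrite !ffunE [in RHS](divz_eq (q i) 2) mulrC; congr (_ + _).
have := modz_ge0 (q i) (isT : (2 : int) != 0); have := ltz_pmod (q i) (isT : (0 : int) < 2).
by case: (_ %% _)%Z => [[|[|]]|].
Qed.

Lemma parity_child v f : parity (child v f) = f.
Proof.
apply/ffunP => i; rewrite !ffunE mulrC modzMDl; by case: (f i).
Qed.

Lemma iter_parent_level j Q : (iter j parent Q).1 = Q.1 + j%:Z.
Proof.
elim: j => [|j IH]; first by rewrite addr0.
by rewrite iterS [LHS]/= IH -addn1 PoszD addrA.
Qed.

Lemma iter_parent_locate j k x : iter j parent (locate k x) = locate (k + j%:Z) x.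
Proof.
elim: j => [|j IH]; first by rewrite addr0.
by rewrite iterS IH parent_locate -addn1 PoszD addrA.
Qed.

Lemma cube_sub_iter_parent j Q : cube (R := R) Q `<=` cube (iter j parent Q).
Proof.
elim: j => [//|j IH]; exact: subset_trans IH (@cube_sub_parent _).
Qed.

Lemma cube_bigsetU_child v :
  cube (R := R) v =
  \big[setU/set0]_(f <- index_enum {ffun 'I_n -> bool}) cube (child v f).
Proof.
rewrite -bigcup_seq; apply/seteqP; split => [x xv|x [f _]]; last first.
  by rewrite -[X in _ -> cube X x](parent_child v f); exact: cube_sub_parent.
pose Q := locate (v.1 - 1) x.
have vQ : v = parent Q by rewrite parent_locate subrK; apply/esym/cubeP.
exists (parity Q); first by rewrite /= mem_index_enum.
by rewrite vQ child_parity; exact: cube_locate.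
Qed.

Lemma open_borel (A : set 'rV[R]_n) : open A -> measurable (A : set (borelRn R n)).
Proof. exact: sub_sigma_algebra. Qed.

Lemma closed_borel (A : set 'rV[R]_n) :
  closed A -> measurable (A : set (borelRn R n)).
Proof.
by move=> cA; rewrite -[A]setCK; apply: measurableC; apply: open_borel;
  rewrite openC.
Qed.

Lemma compact_borel (A : set 'rV[R]_n) :
  compact A -> measurable (A : set (borelRn R n)).
Proof. by move=> cA; apply: closed_borel; apply: compact_closed. Qed.

Lemma cube_measurable Q : measurable (cube Q : set (borelRn R n)).
Proof.
rewrite (_ : cube Q = \big[setI/setT]_(i <- index_enum 'I_n)
  ([set x : 'rV[R]_n | side Q * (Q.2 i)%:~R <= x 0 i] `&`
   [set x | x 0 i < side Q * (Q.2 i + 1)%:~R])).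
  apply: bigsetI_measurable => i _; apply: measurableI.
  - apply: closed_borel.
    apply: (@closed_comp _ _ (fun x : 'rV[R]_n => x 0 i) [set t | side Q * (Q.2 i)%:~R <= t]).
      by move=> x _; exact: coord_continuous.
    exact: closed_ge.
  - apply: open_borel.
    apply: (@open_comp _ _ (fun x : 'rV[R]_n => x 0 i) [set t | t < side Q * (Q.2 i + 1)%:~R]).
      by move=> x _; exact: coord_continuous.
    exact: open_lt.
rewrite -bigcap_seq; apply/seteqP; split => [x xQ i _|x xQ i].
  by have /andP[] := xQ i.
by have [] := xQ i (mem_index_enum i); move=> /= -> ->.
Qed.

Lemma cube_center_in Q : cube Q (cube_center (R := R) Q).
Proof.
move=> i; rewrite mxE; have s0 := side_gt0 Q.
rewrite ler_pM2l// ltr_pM2l// intrD lerDl ltrD2l; lra.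
Qed.

Lemma cube_bounded Q : exists2 K : set 'rV[R]_n, compact K & cube Q `<=` K.
Proof.
pose I i := `[side Q * (Q.2 i)%:~R, side (R := R) Q * (Q.2 i + 1)%:~R]%classic.
exists [set x : 'rV[R]_n | forall i, I i (x 0 i)].
  by apply: (@rV_compact R n I) => i; exact: segment_compact.
by move=> x xQ i; rewrite /I /= in_itv/=; have /andP[-> /ltW] := xQ i.
Qed.

End DyadicGeometry.

(** * Averages over cubes *)

Section Jensen.
Context d (T : measurableType d) (R : realType) (mu : {measure set T -> \bar R}).
Implicit Types (D : set T) (f g s : T -> R).

Lemma le_integrable_EFin D f g : measurable D -> measurable_fun D f ->
  mu.-integrable D (EFin \o g) -> (forall x, D x -> `|f x| <= g x) ->
  mu.-integrable D (EFin \o f).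
Proof.
move=> mD mf ig fg; apply: le_integrable ig => //; first exact/measurable_EFinP.
move=> x Dx; rewrite /= lee_fin; apply: le_trans (fg x Dx) _.
exact: ler_norm.
Qed.

Lemma integrable_linear D f g a b : measurable D ->
  mu.-integrable D (EFin \o f) -> mu.-integrable D (EFin \o g) ->
  mu.-integrable D (EFin \o (fun x => a * f x + b * g x)).
Proof.
move=> mD If Ig; have := integrableD mD (integrableZl mD a If) (integrableZl mD b Ig).
by apply: eq_integrable.
Qed.

Lemma Rintegral_linear D f g a b : measurable D ->
  mu.-integrable D (EFin \o f) -> mu.-integrable D (EFin \o g) ->
  \int[mu]_(x in D) (a * f x + b * g x) =
  a * \int[mu]_(x in D) f x + b * \int[mu]_(x in D) g x.
Proof.
move=> mD If Ig; rewrite RintegralD ?RintegralZl//.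
- exact: (integrableZl mD a If).
- exact: (integrableZl mD b Ig).
Qed.

(** Jensen's inequality for the convex homogeneous function [persp p]: the
    tangent at the pair of the integrals is integrated. *)
Lemma persp_Rintegral D p f s : measurable D -> 1 < p ->
  mu.-integrable D (EFin \o f) -> mu.-integrable D (EFin \o s) ->
  mu.-integrable D (EFin \o (fun x => persp p (f x) (s x))) ->
  (forall x, 0 <= f x) -> (forall x, 0 < s x) ->
  persp p (\int[mu]_(x in D) f x) (\int[mu]_(x in D) s x) <=
  \int[mu]_(x in D) persp p (f x) (s x).
Proof.
move=> mD p1 If Is Ip f0 s0; set X := \int[mu]_(x in D) f x.
set Y := \int[mu]_(x in D) s x.
have X0 : 0 <= X by apply: Rintegral_ge0.
have Y0 : 0 <= Y by apply: Rintegral_ge0 => x _; exact: ltW.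
have P0 : 0 <= \int[mu]_(x in D) persp p (f x) (s x).
  by apply: Rintegral_ge0 => x _; exact: persp_ge0.
have [XE|Xn] := eqVneq X 0; first by rewrite XE /persp powR0 ?mul0r//; lra.
have [YE|Yn] := eqVneq Y 0; first by rewrite YE /persp powR0 ?mulr0//; lra.
have Xp : 0 < X by rewrite lt0r Xn.
have Yp : 0 < Y by rewrite lt0r Yn.
set c := persp p X Y.
apply: (@le_trans _ _ (\int[mu]_(x in D)
    (c * p / X * f x + - (c * (p - 1) / Y) * s x))).
  rewrite Rintegral_linear// -/X -/Y le_eqVlt; apply/orP; left; apply/eqP.
  by field; rewrite Xn Yn.
apply: le_Rintegral => //; first exact: integrable_linear.
move=> x _; apply: le_trans (persp_tangent p1 Xp Yp (f0 x) (s0 x)).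
rewrite -/c le_eqVlt; apply/orP; left; apply/eqP.
by field; rewrite Xn Yn.
Qed.

Lemma Rintegral_gt0 D s : measurable D -> mu.-integrable D (EFin \o s) ->
  (forall x, 0 < s x) -> mu D != 0%E -> 0 < \int[mu]_(x in D) s x.
Proof.
move=> mD Is s0 muD; rewrite lt0r Rintegral_ge0 ?andbT; last by move=> x _; exact: ltW.
apply: contra_neq muD => I0.
have ms := measurable_int mu Is.
have := (ae_eq_integral_abs mu mD ms).1.
have -> : (\int[mu]_(x in D) `|(EFin \o s) x| = 0)%E.
  rewrite (eq_integral (EFin \o s)); last by move=> x _; rewrite /= ger0_norm// ltW.
  by rewrite -[LHS]fineK ?integrable_fin_num//; congr EFin.
move=> /(_ erefl) [N [mN N0 DN]]; apply: (subset_measure0 mD mN) => // x Dx.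
apply: DN => /(_ Dx) /= [sx]; by have := s0 x; rewrite sx ltxx.
Qed.

Lemma Rintegral_null D f : measurable D -> mu.-integrable D (EFin \o f) ->
  mu D = 0%E -> \int[mu]_(x in D) f x = 0.
Proof.
move=> mD If D0; rewrite /Rintegral null_set_integral//.
exact: (measurable_int mu If).
Qed.

Lemma integrable_EFin_norm D f : measurable D -> mu.-integrable D (EFin \o f) ->
  mu.-integrable D (EFin \o (fun x => `|f x|)).
Proof. by move=> mD If; have := integrable_abse If; apply: eq_integrable. Qed.

End Jensen.

Section Averages.
Context {R : realType} {n : nat}.
Variable mu : {measure set (borelRn R n) -> \bar R}.
Hypothesis mu_cube : forall Q : dyadic n, (mu (cube Q) < +oo)%E.
Implicit Types (Q v : dyadic n) (f g : borelRn R n -> R).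

Definition integrable_on_cubes f :=
  forall Q, mu.-integrable (cube Q) (EFin \o f).

Definition mass f Q : R := \int[mu]_(x in cube Q) f x.

Definition vol Q : R := fine (mu (cube Q)).

Lemma vol_ge0 Q : 0 <= vol Q. Proof. exact: fine_ge0. Qed.

Lemma volE Q : mu (cube Q) = (vol Q)%:E.
Proof. by rewrite fineK// ge0_fin_numE. Qed.

Lemma vol_mass Q : vol Q = mass (fun=> 1) Q.
Proof. by rewrite /mass Rintegral_cst ?mul1r//; exact: cube_measurable. Qed.

Lemma integrable_on_cubes_cst c : integrable_on_cubes (fun=> c).
Proof.
move=> Q; apply/integrableP; split; first exact: measurable_cst.
rewrite (eq_integral (cst `|c|%:E))// integral_cst; last exact: cube_measurable.
by rewrite lte_mul_pinfty.
Qed.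

Lemma mass_ge0 f Q : (forall x, 0 <= f x) -> 0 <= mass f Q.
Proof. by move=> f0; apply: Rintegral_ge0. Qed.

Lemma mass_additive f : integrable_on_cubes f -> tree_additive (@child n) (mass f).
Proof.
move=> If v; have mf := measurable_int mu (If v).
rewrite /mass {1}/Rintegral {1}cube_bigsetU_child integral_bigsetU_EFin.
- rewrite -sum_fine// => g _; apply: integrable_fin_num; [exact: cube_measurable|exact: If].
- by move=> g; exact: cube_measurable.
- exact: index_enum_uniq.
- apply/trivIsetP => g h _ _ gh; apply/seteqP; split => // x [xg xh].
  move/eqP: gh; apply; rewrite -(parity_child v g) -(parity_child v h).
  by congr parity; exact: same_level_eq xg xh.
- by rewrite -cube_bigsetU_child.
Qed.

Lemma mass_null f Q : integrable_on_cubes f -> vol Q = 0 -> mass f Q = 0.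
Proof.
move=> If Q0; apply: Rintegral_null => //; first exact: cube_measurable.
by rewrite volE Q0.
Qed.

Lemma massD f g a b Q : integrable_on_cubes f -> integrable_on_cubes g ->
  mass (fun x => a * f x + b * g x) Q = a * mass f Q + b * mass g Q.
Proof. by move=> If Ig; apply: Rintegral_linear => //; exact: cube_measurable. Qed.

Lemma integrable_on_cubesD f g a b : integrable_on_cubes f ->
  integrable_on_cubes g -> integrable_on_cubes (fun x => a * f x + b * g x).
Proof. by move=> If Ig Q; apply: integrable_linear => //; exact: cube_measurable. Qed.

Lemma haarE Q x : haar mu Q x = (Num.sqrt (vol Q))^-1 *
  ((\1_(cube Q) : _ -> R) x - vol Q / vol (parent Q) * \1_(cube (parent Q)) x).
Proof. by []. Qed.

Lemma integrable_mul_haar f Q : integrable_on_cubes f ->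
  mu.-integrable setT (EFin \o (fun x => f x * haar mu Q x)).
Proof.
move=> If; have I1 v : mu.-integrable setT (EFin \o (fun x => f x * \1_(cube v) x)).
  have := (integrable_mkcond _ (cube_measurable v)).1 (If v).
  by rewrite restrict_EFin; apply: eq_integrable => // x _; rewrite patch_indic.
have := integrable_linear (Num.sqrt (vol Q))^-1
  (- ((Num.sqrt (vol Q))^-1 * (vol Q / vol (parent Q)))) measurableT (I1 Q) (I1 (parent Q)).
apply: eq_integrable => // x _ /=; congr EFin; rewrite haarE; ring.
Qed.

Lemma inner_haar f Q : integrable_on_cubes f ->
  inner mu f (haar mu Q) =
  Num.sqrt (vol Q) * (avg vol (mass f) Q - avg vol (mass f) (parent Q)).
Proof.
move=> If; have I1 v : mu.-integrable setT (EFin \o (fun x => f x * \1_(cube v) x)).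
  have := (integrable_mkcond _ (cube_measurable v)).1 (If v).
  by rewrite restrict_EFin; apply: eq_integrable => // x _; rewrite patch_indic.
have massE v : mass f v = \int[mu]_x (f x * \1_(cube v) x).
  by rewrite /mass Rintegral_mkcond patch_indic.
rewrite /inner (_ : (fun x => _) = fun x => (Num.sqrt (vol Q))^-1 * (f x * \1_(cube Q) x)
   + - ((Num.sqrt (vol Q))^-1 * (vol Q / vol (parent Q))) * (f x * \1_(cube (parent Q)) x)).
  rewrite Rintegral_linear// -!massE /avg.
  have [Q0|Qn0] := eqVneq (vol Q) 0.
    by rewrite Q0 sqrtr0 invr0 !mul0r oppr0 mul0r addr0.
  have s0 : Num.sqrt (vol Q) != 0 by rewrite sqrtr_eq0 -ltNge lt0r Qn0 vol_ge0.
  have E : (Num.sqrt (vol Q))^-1 * vol Q = Num.sqrt (vol Q).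
    by rewrite -{2}(sqr_sqrtr (vol_ge0 Q)) expr2 mulKf.
  have E' : (Num.sqrt (vol Q))^-1 = Num.sqrt (vol Q) * (vol Q)^-1.
    by apply: (mulIf Qn0); rewrite E divfK.
  by rewrite mulrA E {1}E'; ring.
by apply/funext => x; rewrite haarE; ring.
Qed.

(** The normalisation of [h_Q] cancels in the product of two coefficients, and no
    ratio between the measures of a cube and its parent is left. *)
Lemma inner_haar_mul f g Q : integrable_on_cubes f -> integrable_on_cubes g ->
  `|inner mu f (haar mu Q) * inner mu g (haar mu Q)| =
  vol Q * (diff vol (mass f) (parent Q) Q * diff vol (mass g) (parent Q) Q).
Proof.
move=> If Ig; rewrite !inner_haar// mulrACA -expr2 sqr_sqrtr ?vol_ge0//.
by rewrite !normrM ger0_norm ?vol_ge0.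
Qed.

Lemma inner_haarD f g a b Q : integrable_on_cubes f -> integrable_on_cubes g ->
  inner mu (fun x => a * f x + b * g x) (haar mu Q) =
  a * inner mu f (haar mu Q) + b * inner mu g (haar mu Q).
Proof.
move=> If Ig; rewrite !inner_haar//; last exact: integrable_on_cubesD.
by rewrite /avg !massD//; ring.
Qed.

End Averages.

(** * The weighted estimate for finite families of cubes *)

Section Families.
Context {R : realType} {n : nat}.
Implicit Types (Q v c : dyadic n) (F r : seq (dyadic n)).
Variables m phi psi : dyadic n -> R.
Hypothesis m_ge0 : forall Q, 0 <= m Q.

Let t Q : R := m Q * (diff m phi (parent Q) Q * diff m psi (parent Q) Q).

Let t_ge0 Q : 0 <= t Q.
Proof. by apply: mulr_ge0 => //; apply: mulr_ge0; exact: normr_ge0. Qed.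

Definition below N v Q := [exists j : 'I_N, iter j.+1 parent Q == v].

Lemma sum_uniq_le F c : uniq F -> \sum_(Q <- F | Q == c) t Q <= t c.
Proof.
elim: F => [|a F IH] /=; first by rewrite big_nil.
move=> /andP[aF uF]; rewrite big_cons; case: ifPn => [/eqP <-|_]; last exact: IH.
rewrite big1_seq ?addr0// => Q /andP[/eqP -> aF']; by rewrite aF' in aF.
Qed.

Lemma le_sum_seq (I : eqType) (r : seq I) (G : I -> R) (i : I) (x : R) :
  i \in r -> (forall j, 0 <= G j) -> x <= G i -> x <= \sum_(j <- r) G j.
Proof.
move=> ir G0 xG; rewrite (big_rem i ir)/=; apply: le_trans xG _.
by rewrite lerDl sumr_ge0.
Qed.

Lemma sum_below_le N v F : uniq F ->
  \sum_(Q <- F | below N v Q) t Q <= diff_sum (@child n) m phi psi N v.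
Proof.
move=> uF; elim: N v => [|N IH] v.
  by rewrite big_pred0// => Q; apply/existsP => -[[]].
apply: (@le_trans _ _ (\sum_(Q <- F) \sum_(f : {ffun 'I_n -> bool})
  ((if Q == child v f then t Q else 0) +
   (if below N (child v f) Q then t Q else 0)))).
  rewrite big_mkcond/=; apply: ler_sum => Q _.
  have G0 f : 0 <= (if Q == child v f then t Q else 0) +
      (if below N (child v f) Q then t Q else 0).
    by rewrite addr_ge0//; case: ifP.
  case: ifP => [/existsP[j /eqP jv]|_]; last exact: sumr_ge0.
  case: j jv => [[|j] /= jN] jv.
    apply: (@le_sum_seq _ _ _ (parity Q)) => //; first exact: mem_index_enum.
    by rewrite -jv child_parity eqxx lerDl; case: ifP.
  apply: (@le_sum_seq _ _ _ (parity (parent (iter j parent Q)))) => //.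
    exact: mem_index_enum.
  have -> : below N (child v (parity (parent (iter j parent Q)))) Q.
    by apply/existsP; exists (Ordinal (jN : (j < N)%N)); rewrite -jv child_parity.
  by rewrite lerDr; case: ifP.
rewrite exchange_big/=; apply: ler_sum => f _; rewrite big_split/=.
apply: lerD; rewrite -big_mkcond; last exact: IH.
by apply: le_trans (sum_uniq_le _ uF) _; rewrite /t parent_child.
Qed.

(** Cubes in different orthants have no common ancestor. Ancestors in a common
    generation are disjoint, however, so that the bounds on their trees add up. *)
Lemma sum_family_le F : uniq F -> exists L N r,
  [/\ uniq r, forall v, v \in r -> v.1 = L &
   \sum_(Q <- F) t Q <= \sum_(v <- r) diff_sum (@child n) m phi psi N v].
Proof.
move=> uF; pose b := (\sum_(Q <- F) `|Q.1|)%N.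
have Qb Q : Q \in F -> (`|Q.1| <= b)%N.
  by move=> QF; rewrite /b (big_rem Q QF)/= leq_addr.
pose L : int := b.+1%:Z; pose root Q := iter `|L - Q.1|%N parent Q.
exists L, b.*2.+1, (undup [seq root Q | Q <- F]); split.
- exact: undup_uniq.
- move=> v; rewrite mem_undup => /mapP[Q /Qb Qb' ->].
  by rewrite iter_parent_level /L; lia.
apply: (@le_trans _ _ (\sum_(Q <- F) \sum_(v <- undup [seq root Q | Q <- F])
    (if below b.*2.+1 v Q then t Q else 0))).
  rewrite big_seq [leRHS]big_seq; apply: ler_sum => Q QF.
  apply: (@le_sum_seq _ _ _ (root Q)).
  - by rewrite mem_undup map_f.
  - by move=> v; case: ifP.
  rewrite ifT//; apply/existsP; have := Qb Q QF => Qb'.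
  have jN : (`|L - Q.1|.-1 < b.*2.+1)%N by rewrite /L; lia.
  exists (Ordinal jN); apply/eqP; rewrite /root.
  have jE : `|L - Q.1|%N = `|L - Q.1|.-1.+1 by rewrite /L; lia.
  by rewrite [in RHS]jE.
rewrite exchange_big/=; apply: ler_sum => v _.
by rewrite -big_mkcond; exact: sum_below_le.
Qed.

End Families.

Section Energy.
Context d (T : measurableType d) (R : realType) (mu : {measure set T -> \bar R}).
Variables (p : R) (w : T -> R).
Hypotheses (p0 : 0 < p) (w_gt0 : forall x, 0 < w x)
  (w_meas : measurable_fun setT w).
Implicit Types f g : T -> R.

(** The [p]-th power of the norm of [L^p(w)]. It is a real number, so that it is
    always accompanied by membership in the space, [finite_energy]. *)
Definition energy f : R := \int[mu]_x (`|f x| `^ p * w x).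

Definition finite_energy f := measurable_fun setT f /\
  mu.-integrable setT (EFin \o (fun x => `|f x| `^ p * w x)).

Lemma energy_ge0 f : 0 <= energy f.
Proof. by apply: Rintegral_ge0 => x _; rewrite mulr_ge0 ?powR_ge0// ltW. Qed.

Lemma measurable_density f : measurable_fun setT f ->
  measurable_fun setT (fun x => `|f x| `^ p * w x).
Proof.
move=> mf; apply: measurable_funM => //.
apply: (@measurableT_comp _ _ _ _ _ _ (@powR R ^~ p) _ (fun x => `|f x|)).
  exact: measurable_powR.
exact: measurableT_comp.
Qed.

Lemma density_ge0 f x : 0 <= `|f x| `^ p * w x.
Proof. by rewrite mulr_ge0 ?powR_ge0// ltW. Qed.

Lemma powR_normD (a b : R) : `|a + b| `^ p <= 2 `^ p * (`|a| `^ p + `|b| `^ p).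
Proof.
wlog ab : a b / `|a| <= `|b| => [H|].
  by case/orP: (le_total `|a| `|b|) => /H//; rewrite addrC [X in _ * X]addrC.
apply: (@le_trans _ _ ((2 * `|b|) `^ p)).
  rewrite ge0_ler_powR ?nnegrE ?mulr_ge0 ?(ltW p0)//.
  by apply: le_trans (ler_normD _ _) _; lra.
rewrite powRM// ler_wpM2l ?powR_ge0// lerDr powR_ge0//.
Qed.

Lemma le_finite_energy f g : measurable_fun setT f -> finite_energy g ->
  (forall x, `|f x| <= `|g x|) -> finite_energy f /\ energy f <= energy g.
Proof.
move=> mf [mg Ig] fg.
have H x : `|f x| `^ p * w x <= `|g x| `^ p * w x.
  by rewrite ler_wpM2r ?(ltW (w_gt0 x))// ge0_ler_powR ?nnegrE// ltW.
have If : finite_energy f.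
  split=> //; apply: (le_integrable_EFin _ _ Ig) => //.
    exact: measurable_density.
  by move=> x _; rewrite ger0_norm ?density_ge0//; exact: H.
by split=> //; apply: le_Rintegral => //; exact: If.2.
Qed.

Lemma finite_energyZ a f : finite_energy f ->
  finite_energy (fun x => a * f x) /\
  energy (fun x => a * f x) = `|a| `^ p * energy f.
Proof.
move=> [mf If].
have E x : `|a * f x| `^ p * w x = `|a| `^ p * (`|f x| `^ p * w x).
  by rewrite normrM powRM// mulrA.
split; last first.
  rewrite /energy -RintegralZl//; congr Rintegral; exact/funext.
split; first exact: measurable_funM.
have := integrableZl measurableT (`|a| `^ p) If.
by apply: eq_integrable => // x _; rewrite /= E.
Qed.

Lemma finite_energyD f g : finite_energy f -> finite_energy g ->
  finite_energy (fun x => f x + g x) /\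
  energy (fun x => f x + g x) <= 2 `^ p * (energy f + energy g).
Proof.
move=> [mf If] [mg Ig].
have H x : `|f x + g x| `^ p * w x <=
    2 `^ p * (`|f x| `^ p * w x) + 2 `^ p * (`|g x| `^ p * w x).
  rewrite -mulrDr -mulrDl mulrA ler_wpM2r ?(ltW (w_gt0 x))//.
  exact: powR_normD.
have I2 := integrable_linear (2 `^ p) (2 `^ p) measurableT If Ig.
have Ifg : finite_energy (fun x => f x + g x).
  split; first exact: measurable_funD.
  apply: (le_integrable_EFin _ _ I2) => //.
    by apply: measurable_density; exact: measurable_funD.
  move=> x _; rewrite ger0_norm; first exact: H.
  exact: (density_ge0 (fun x => f x + g x)).
split=> //; apply: (@le_trans _ _ (\int[mu]_x
   (2 `^ p * (`|f x| `^ p * w x) + 2 `^ p * (`|g x| `^ p * w x)))).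
  by apply: le_Rintegral => //; exact: Ifg.2.
by rewrite Rintegral_linear// mulrDr.
Qed.

Lemma finite_energy0 : finite_energy (fun=> 0).
Proof.
split; first exact: measurable_cst.
have := @integrable0 _ _ _ mu setT.
by apply: eq_integrable => // x _; rewrite /= normr0 powR0 ?mul0r// gt_eqF.
Qed.

Lemma energy_eq0 : energy (fun=> 0) = 0.
Proof.
rewrite /energy /Rintegral integral0_eq// => x _.
by rewrite normr0 powR0 ?mul0r// gt_eqF.
Qed.

Lemma finite_energy_sum (I : eqType) (r : seq I) (a : I -> R) (h : I -> T -> R) :
  (forall i, i \in r -> finite_energy (h i)) ->
  finite_energy (fun x => \sum_(i <- r) a i * h i x).
Proof.
elim: r => [|i r IH] H.
  rewrite (_ : (fun x => _) = fun=> 0); first exact: finite_energy0.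
  by apply/funext => x; rewrite big_nil.
rewrite (_ : (fun x => _) = fun x => a i * h i x + \sum_(j <- r) a j * h j x).
  apply: (finite_energyD _ _).1.
    by apply: (finite_energyZ _ _).1; apply: H; rewrite mem_head.
  by apply: IH => j jr; apply: H; rewrite inE jr orbT.
by apply/funext => x; rewrite big_cons.
Qed.

End Energy.

Section DualWeights.
Context {R : realType} {n : nat}.
Variable mu : {measure set (borelRn R n) -> \bar R}.
Hypothesis mu_cube : forall Q : dyadic n, (mu (cube Q) < +oo)%E.
Implicit Types (f g : borelRn R n -> R) (Q v : dyadic n) (F r : seq (dyadic n)).

(** The dyadic [A_p] condition for a weight [w] and its dual weight
    [s = w `^ (1 - p')], in a form that is invariant under exchanging [(p, w)]
    with [(p', s)]. *)
Record dual_weights (p p' K : R) (w s : borelRn R n -> R) : Prop := DualWeights {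
  dw_p : 1 < p;
  dw_p' : 1 < p';
  dw_conj : p^-1 + p'^-1 = 1;
  dw_K : 0 <= K;
  dw_w : forall x, 0 < w x;
  dw_s : forall x, 0 < s x;
  dw_mw : measurable_fun setT w;
  dw_ms : measurable_fun setT s;
  dw_Iw : integrable_on_cubes mu w;
  dw_Is : integrable_on_cubes mu s;
  dw_ws : forall x, w x = s x `^ (1 - p);
  dw_sw : forall x, s x = w x `^ (1 - p');
  dw_W : forall Q, mass mu w Q <= K * persp p (vol mu Q) (mass mu s Q);
  dw_S : forall Q, mass mu s Q <= K * persp p' (vol mu Q) (mass mu w Q) }.

Lemma dual_weights_sym p p' K w s :
  dual_weights p p' K w s -> dual_weights p' p K s w.
Proof. by case=> *; split=> //; rewrite addrC. Qed.

Section OneSided.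
Variables (p p' K : R) (w s : borelRn R n -> R).
Hypothesis dw : dual_weights p p' K w s.
Let p1 := dw_p dw.
Let w0 := dw_w dw.
Let s0 := dw_s dw.

Lemma persp_density f x : persp p `|f x| (s x) = `|f x| `^ p * w x.
Proof. by rewrite /persp -(dw_ws dw). Qed.

Lemma finite_energy_integrable_on_cubes f :
  finite_energy mu p w f -> integrable_on_cubes mu f.
Proof.
move=> [mf If] Q.
have IfQ : mu.-integrable (cube Q) (EFin \o (fun x => `|f x| `^ p * w x)).
  apply: (integrableS _ _ _ If) => //; exact: cube_measurable.
have I2 := integrable_linear 1 p (cube_measurable Q) IfQ (dw_Is dw Q).
apply: (le_integrable_EFin _ _ I2) => //; first exact: cube_measurable.
  exact: measurable_funTS.
move=> x _; rewrite mul1r -persp_density.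
exact: le_persp.
Qed.

Lemma mass_energy_le f Q : finite_energy mu p w f -> (forall x, 0 <= f x) ->
  persp p (mass mu f Q) (mass mu s Q) <= mass mu (fun x => `|f x| `^ p * w x) Q.
Proof.
move=> Ef f0; have mQ := @cube_measurable R n Q.
have E x : persp p (f x) (s x) = `|f x| `^ p * w x.
  by rewrite -persp_density ger0_norm.
rewrite /mass (_ : (fun x => `|f x| `^ p * w x) = (fun x => persp p (f x) (s x))).
  apply: persp_Rintegral => //.
  - exact: finite_energy_integrable_on_cubes.
  - exact: dw_Is dw Q.
  - have := integrableS measurableT mQ (@subsetT _ _) Ef.2.
    by apply: eq_integrable => // x _; rewrite /= E.
by apply/funext.
Qed.

Lemma vol_energy_le Q : persp p (vol mu Q) (mass mu s Q) <= mass mu w Q.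
Proof.
have mQ := @cube_measurable R n Q.
rewrite vol_mass (_ : w = (fun x => persp p 1 (s x))).
  apply: persp_Rintegral => //.
  - exact: integrable_on_cubes_cst.
  - exact: dw_Is dw Q.
  - have := dw_Iw dw Q.
    by apply: eq_integrable => // x _; rewrite /= /persp powR1 mul1r (dw_ws dw).
by apply/funext => x; rewrite /persp powR1 mul1r (dw_ws dw).
Qed.

Lemma mass_s_gt0 Q : vol mu Q != 0 -> 0 < mass mu s Q.
Proof.
move=> Q0; apply: Rintegral_gt0 => //; first exact: cube_measurable.
  exact: dw_Is dw Q.
by apply: contra_neq Q0; rewrite /vol => ->.
Qed.

Lemma mass_density_additive f : finite_energy mu p w f ->
  tree_additive (@child n) (mass mu (fun x => `|f x| `^ p * w x)).
Proof.
move=> [_ If]; apply: mass_additive => // Q.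
by apply: (integrableS _ _ _ If) => //; exact: cube_measurable.
Qed.

Lemma sum_mass_le (r : seq (dyadic n)) L f : uniq r ->
  (forall v, v \in r -> v.1 = L) -> finite_energy mu p w f ->
  \sum_(v <- r) mass mu (fun x => `|f x| `^ p * w x) v <= energy mu p w f.
Proof.
move=> ur rL [mf If]; set g := fun x : borelRn R n => `|f x| `^ p * w x.
have mg : measurable_fun setT (EFin \o g) := measurable_int mu If.
have Ig v : mu.-integrable (cube v) (EFin \o g).
  by apply: (integrableS _ _ _ If) => //; exact: cube_measurable.
rewrite -lee_fin -sumEFin /energy /Rintegral fineK ?integrable_fin_num//.
rewrite (eq_bigr (fun v => (\int[mu]_(x in cube v) (g x)%:E)%E)); last first.
  move=> v _; rewrite /mass /Rintegral fineK//.
  by apply: integrable_fin_num => //; exact: cube_measurable.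
rewrite -integral_bigsetU_EFin//.
- apply: ge0_subset_integral => //.
    by apply: bigsetU_measurable => v _; exact: cube_measurable.
  by move=> x _; rewrite lee_fin density_ge0.
- by move=> v; exact: cube_measurable.
- apply/trivIsetP => a b /= ra rb ab; apply/seteqP; split => // x [xa xb].
  move/eqP: ab; apply; apply: same_level_eq xa xb; by rewrite !rL.
- exact: measurable_funTS.
Qed.

End OneSided.

Variables (p p' K : R) (w s : borelRn R n -> R).
Hypothesis dw : dual_weights p p' K w s.
Let p1 := dw_p dw.
Let p'1 := dw_p' dw.
Let dw' := dual_weights_sym dw.

Let p_gt0 : 0 < p. Proof. exact: lt_trans ltr01 p1. Qed.
Let p'_gt0 : 0 < p'. Proof. exact: lt_trans ltr01 p'1. Qed.

Lemma bilinear_haar_ge0 f g (F : seq (dyadic n)) : uniq F ->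
  (forall x, 0 <= f x) -> (forall x, 0 <= g x) ->
  finite_energy mu p w f -> finite_energy mu p' s g ->
  \sum_(Q <- F) `|inner mu f (haar mu Q) * inner mu g (haar mu Q)| <=
  tree_const p p' K * (energy mu p w f + energy mu p' s g).
Proof.
move=> uF f0 g0 Ef Eg.
have If := finite_energy_integrable_on_cubes dw Ef.
have Ig := finite_energy_integrable_on_cubes dw' Eg.
rewrite (eq_bigr (fun Q => vol mu Q * (diff (vol mu) (mass mu f) (parent Q) Q *
   diff (vol mu) (mass mu g) (parent Q) Q))); last by move=> Q _; exact: inner_haar_mul.
have [L [N [r [ur rL H]]]] := sum_family_le (mass mu f) (mass mu g) (@vol_ge0 _ _ mu) uF.
apply: le_trans H _.
apply: (@le_trans _ _ (\sum_(v <- r) tree_const p p' K *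
   (mass mu (fun x => `|f x| `^ p * w x) v + mass mu (fun x => `|g x| `^ p' * s x) v))).
  apply: ler_sum => v _.
  apply: (@tree_bilinear_bound _ _ _ (@child n) (vol mu) (mass mu f) (mass mu g)
    _ _ _ _ _ _ _ _ p p' K (mass mu w) (mass mu s)
    (mass mu (fun x => `|f x| `^ p * w x)) (mass mu (fun x => `|g x| `^ p' * s x))) => //.
  - rewrite (_ : vol mu = mass mu (fun=> 1)); last by apply/funext => Q; rewrite vol_mass.
    apply: mass_additive; exact: integrable_on_cubes_cst.
  - exact: mass_additive.
  - exact: mass_additive.
  - exact: vol_ge0.
  - by move=> Q; exact: mass_ge0.
  - by move=> Q; exact: mass_ge0.
  - by move=> Q; exact: mass_null.
  - by move=> Q; exact: mass_null.
  - exact: dw_conj dw.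
  - exact: dw_K dw.
  - by apply: mass_additive; exact: dw_Iw dw.
  - by apply: mass_additive; exact: dw_Is dw.
  - exact: mass_density_additive.
  - exact: mass_density_additive.
  - exact: (mass_s_gt0 dw').
  - exact: (mass_s_gt0 dw).
  - by move=> Q; apply: mass_ge0 => x; apply: ltW; exact: dw_w dw x.
  - by move=> Q; apply: mass_ge0 => x; apply: ltW; exact: dw_s dw x.
  - exact: (vol_energy_le dw).
  - exact: (vol_energy_le dw').
  - exact: dw_W dw.
  - exact: dw_S dw.
  - by move=> Q; exact: (mass_energy_le dw).
  - by move=> Q; exact: (mass_energy_le dw').
rewrite -mulr_sumr big_split/= ler_wpM2l//.
  by apply: tree_const_ge0 => //; exact: dw_K dw.
apply: lerD; [exact: (sum_mass_le dw ur rL)|exact: (sum_mass_le dw' ur rL)].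
Qed.

End DualWeights.

Section Duality.
Context {R : realType} {n : nat}.
Variable mu : {measure set (borelRn R n) -> \bar R}.
Hypothesis mu_cube : forall Q : dyadic n, (mu (cube Q) < +oo)%E.
Implicit Types (f g : borelRn R n -> R) (Q v : dyadic n) (F r : seq (dyadic n)).

Definition haar_sum F (a : dyadic n -> R) : borelRn R n -> R :=
  fun x => \sum_(Q <- F) a Q * haar mu Q x.

Lemma finite_energy_haar (p : R) (w : borelRn R n -> R) Q : 0 < p -> (forall x, 0 < w x) ->
  measurable_fun setT w -> integrable_on_cubes mu w ->
  finite_energy mu p w (haar mu Q).
Proof.
move=> p0 w0 mw Iw.
have E1 v : finite_energy mu p w (\1_(cube v) : borelRn R n -> R).
  have m1 : measurable_fun setT (\1_(cube v) : borelRn R n -> R).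
    by apply: measurable_indic; exact: cube_measurable.
  split=> //; have := (integrable_mkcond _ (cube_measurable v)).1 (Iw v).
  rewrite restrict_EFin; apply: eq_integrable => // x _.
  rewrite patch_indic /= indicE; case: (x \in _); first by rewrite mulr1 normr1 powR1 mul1r.
  by rewrite mulr0 normr0 powR0 ?mul0r// gt_eqF.
set k := (Num.sqrt (vol mu Q))^-1.
rewrite (_ : haar mu Q = fun x => k * (\1_(cube Q) : _ -> R) x +
    - (k * (vol mu Q / vol mu (parent Q))) * (\1_(cube (parent Q)) : _ -> R) x).
  apply: (finite_energyD p0 w0 mw _ _).1; exact: (finite_energyZ _ (E1 _)).1.
by apply/funext => x; rewrite haarE /k; ring.
Qed.

Lemma integral_haar_sum F (a : dyadic n -> R) g : integrable_on_cubes mu g ->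
  mu.-integrable setT (EFin \o (fun x => haar_sum F a x * g x)) /\
  \int[mu]_x (haar_sum F a x * g x) = \sum_(Q <- F) a Q * inner mu g (haar mu Q).
Proof.
move=> Ig; elim: F => [|Q F [IH1 IH2]].
  rewrite (_ : (fun x => _) = fun=> 0); last first.
    by apply/funext => x; rewrite /haar_sum big_nil mul0r.
  rewrite big_nil; split; last by rewrite /Rintegral integral0.
  exact: integrable0.
rewrite (_ : (fun x => _) = fun x => a Q * (g x * haar mu Q x) + 1 * (haar_sum F a x * g x)).
  have IQ := integrable_mul_haar Q Ig.
  split; first exact: integrable_linear.
  by rewrite Rintegral_linear// IH2 big_cons mul1r.
by apply/funext => x; rewrite /haar_sum big_cons; ring.
Qed.

Lemma inner_haarZ (a : R) f Q : integrable_on_cubes mu f ->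
  inner mu (fun x => a * f x) (haar mu Q) = a * inner mu f (haar mu Q).
Proof.
move=> If; rewrite (_ : (fun x => _) = fun x => a * f x + 0 * f x).
  by rewrite inner_haarD// mul0r addr0.
by apply/funext => x; rewrite mul0r addr0.
Qed.

Variables (p p' K : R) (w s : borelRn R n -> R).
Hypothesis dw : dual_weights mu p p' K w s.
Let dw' := dual_weights_sym dw.
Let p_gt0 : 0 < p. Proof. exact: lt_trans ltr01 (dw_p dw). Qed.
Let p'_gt0 : 0 < p'. Proof. exact: lt_trans ltr01 (dw_p' dw). Qed.

Lemma conj_expo : (p - 1) * p' = p.
Proof.
have pn0 : p != 0 by rewrite gt_eqF.
have p'n0 : p' != 0 by rewrite gt_eqF.
have : (p^-1 + p'^-1) * (p * p') = p * p' by rewrite (dw_conj dw) mul1r.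
have -> : (p^-1 + p'^-1) * (p * p') = p' + p by field; rewrite pn0 p'n0.
lra.
Qed.

Lemma part_finite_energy (q : R) (u : borelRn R n -> R) f (c : R) : 0 < q -> (forall x, 0 < u x) ->
  measurable_fun setT u -> `|c| = 1 -> finite_energy mu q u f ->
  [/\ finite_energy mu q u (fun x => (`|f x| + c * f x) / 2),
    energy mu q u (fun x => (`|f x| + c * f x) / 2) <= energy mu q u f &
    forall x, 0 <= (`|f x| + c * f x) / 2].
Proof.
move=> q0 u0 mu' c1 Ef; have [mf _] := Ef.
have N x : `|c * f x| = `|f x| by rewrite normrM c1 mul1r.
have P x : 0 <= (`|f x| + c * f x) / 2.
  rewrite divr_ge0//; have := N x; have := ler_norm (- (c * f x)).
  by rewrite normrN => h <-; lra.
have mp : measurable_fun setT (fun x => (`|f x| + c * f x) / 2).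
  apply: measurable_funM => //; apply: measurable_funD; first exact: measurableT_comp.
  exact: measurable_funM.
have [|? ?] := le_finite_energy q0 u0 mu' mp Ef; last by split.
by move=> x; rewrite ger0_norm//; have := ler_norm (c * f x); rewrite N; lra.
Qed.

(** The positive and negative parts of [f] and [g] give four sums, each bounded by
    [bilinear_haar_ge0]. *)
Lemma bilinear_haar f g F : uniq F ->
  finite_energy mu p w f -> finite_energy mu p' s g ->
  \sum_(Q <- F) `|inner mu f (haar mu Q) * inner mu g (haar mu Q)| <=
  4 * tree_const p p' K * (energy mu p w f + energy mu p' s g).
Proof.
move=> uF Ef Eg.
pose pt c (h : borelRn R n -> R) x := (`|h x| + c * h x) / 2.
have n1 : `|1| = 1 :> R by rewrite normr1.
have nN1 : `|-1| = 1 :> R by rewrite normrN normr1.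
have PF c (c1 : `|c| = 1) : [/\ finite_energy mu p w (pt c f),
   energy mu p w (pt c f) <= energy mu p w f & forall x, 0 <= pt c f x].
  by apply: part_finite_energy => //; [exact: dw_w dw|exact: dw_mw dw].
have PG c (c1 : `|c| = 1) : [/\ finite_energy mu p' s (pt c g),
   energy mu p' s (pt c g) <= energy mu p' s g & forall x, 0 <= pt c g x].
  by apply: part_finite_energy => //; [exact: dw_s dw|exact: dw_ms dw].
have split q q' u t (h : borelRn R n -> R) Q (dw0 : dual_weights mu q q' K u t) :
    (forall c, `|c| = 1 -> [/\ finite_energy mu q u (pt c h),
       energy mu q u (pt c h) <= energy mu q u h & forall x, 0 <= pt c h x]) ->
    inner mu h (haar mu Q) =
    inner mu (pt 1 h) (haar mu Q) - inner mu (pt (-1) h) (haar mu Q).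
  move=> H; have [H1 _ _] := H _ n1; have [H2 _ _] := H _ nN1.
  have I1 := finite_energy_integrable_on_cubes dw0 H1.
  have I2 := finite_energy_integrable_on_cubes dw0 H2.
  rewrite -[X in X - _]mul1r -[X in _ - X]mul1r -mulNr -inner_haarD//.
  by congr inner; apply/funext => x; rewrite /pt; field.
have B c e : `|c| = 1 -> `|e| = 1 ->
    \sum_(Q <- F) `|inner mu (pt c f) (haar mu Q) * inner mu (pt e g) (haar mu Q)| <=
    tree_const p p' K * (energy mu p w f + energy mu p' s g).
  move=> c1 e1; have [F1 F2 F3] := PF c c1; have [G1 G2 G3] := PG e e1.
  apply: le_trans (bilinear_haar_ge0 mu_cube dw uF F3 G3 F1 G1) _.
  rewrite ler_wpM2l ?lerD// tree_const_ge0 ?(dw_p dw) ?(dw_p' dw)//.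
  exact: dw_K dw.
apply: (@le_trans _ _ (
  \sum_(Q <- F) `|inner mu (pt 1 f) (haar mu Q) * inner mu (pt 1 g) (haar mu Q)| +
  \sum_(Q <- F) `|inner mu (pt 1 f) (haar mu Q) * inner mu (pt (-1) g) (haar mu Q)| +
  \sum_(Q <- F) `|inner mu (pt (-1) f) (haar mu Q) * inner mu (pt 1 g) (haar mu Q)| +
  \sum_(Q <- F) `|inner mu (pt (-1) f) (haar mu Q) * inner mu (pt (-1) g) (haar mu Q)|)).
  rewrite -!big_split/=; apply: ler_sum => Q _.
  rewrite (split _ _ _ _ _ Q dw PF) (split _ _ _ _ _ Q dw' PG).
  move: (inner _ _ _) (inner _ _ _) (inner _ _ _) (inner _ _ _) => d c b a.
  have -> : (a - b) * (c - d) = a * c + - (a * d) + - (b * c) + b * d by ring.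
  rewrite -(normrN (a * d)) -(normrN (b * c)).
  do 3 (apply: le_trans (ler_normD _ _) _; rewrite lerD2r).
  by [].
have := B _ _ n1 n1; have := B _ _ n1 nN1; have := B _ _ nN1 n1; have := B _ _ nN1 nN1.
lra.
Qed.

(** The extremal function for the duality between the spaces with weights
    [(p, w)] and [(p', s)]. *)
Definition dual_fun (G : borelRn R n -> R) x : R := G x * `|G x| `^ (p - 2) * w x.

Lemma dual_funE G x : G x * dual_fun G x = `|G x| `^ p * w x.
Proof.
rewrite /dual_fun; have [->|Gn0] := eqVneq (G x) 0.
  by rewrite mul0r normr0 powR0 ?mul0r// gt_eqF.
rewrite !mulrA; congr (_ * _); rewrite -expr2 -real_normK ?num_real//.
rewrite -powR_mulrn// -powRD ?normr_eq0 ?Gn0 ?implybT//.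
by congr (_ `^ _); ring.
Qed.

Lemma dual_fun_energy G x : `|dual_fun G x| `^ p' * s x = `|G x| `^ p * w x.
Proof.
rewrite /dual_fun; have [->|Gn0] := eqVneq (G x) 0.
  by rewrite !mul0r normr0 !powR0 ?mul0r// gt_eqF.
have wx := dw_w dw x.
rewrite (dw_sw dw) !normrM (ger0_norm (ltW wx)) (ger0_norm (powR_ge0 _ _)).
have -> : `|G x| * `|G x| `^ (p - 2) = `|G x| `^ (p - 1).
  rewrite -{1}[`|G x|]powRr1// -powRD ?normr_eq0 ?Gn0 ?implybT//.
  by congr (_ `^ _); ring.
rewrite powRM ?powR_ge0 ?(ltW wx)// -powRrM conj_expo -mulrA; congr (_ * _).
rewrite -powRD ?(gt_eqF wx) ?implybT//.
by rewrite addrC subrK powRr1// ltW.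
Qed.

Lemma finite_energy_dual_fun G : finite_energy mu p w G ->
  finite_energy mu p' s (dual_fun G) /\
  energy mu p' s (dual_fun G) = energy mu p w G.
Proof.
move=> [mG IG].
have E : (fun x => `|dual_fun G x| `^ p' * s x) = (fun x => `|G x| `^ p * w x).
  by apply/funext => x; exact: dual_fun_energy.
split; last by rewrite /energy E.
split; last by rewrite E.
rewrite /dual_fun; apply: measurable_funM; last exact: dw_mw dw.
apply: measurable_funM => //.
apply: (@measurableT_comp _ _ _ _ _ _ (@powR R ^~ (p - 2)) _ (fun x => `|G x|)).
  exact: measurable_powR.
exact: measurableT_comp.
Qed.

Definition norm_const : R := 2 * (4 * tree_const p p' K + 1).

Lemma norm_const_gt0 : 0 < norm_const.
Proof.
have := tree_const_ge0 (dw_p dw) (dw_p' dw) (dw_K dw).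
rewrite /norm_const; lra.
Qed.

(** The bilinear bound is tested against the extremal function of the sum
    itself; replacing [f], [g] by [t f], [g / t] turns the sum of the energies
    into a product. *)
Lemma energy_haar_sum_le f F (e : dyadic n -> R) (d : R) : uniq F ->
  0 <= d -> (forall Q, Q \in F -> `|e Q| <= d) -> finite_energy mu p w f ->
  energy mu p w (haar_sum F (fun Q => e Q * inner mu f (haar mu Q))) <=
  (d * norm_const) `^ p * energy mu p w f.
Proof.
move=> uF d0 ed Ef.
set a := fun Q => _; set G := haar_sum F a; set E := energy mu p w G.
have EG : finite_energy mu p w G.
  apply: finite_energy_sum => //; [exact: dw_w dw|exact: dw_mw dw|].
  by move=> Q _; apply: finite_energy_haar => //;
    [exact: dw_w dw|exact: dw_mw dw|exact: dw_Iw dw].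
have [Eg EgE] := finite_energy_dual_fun EG.
have Ig := finite_energy_integrable_on_cubes dw' Eg.
have If := finite_energy_integrable_on_cubes dw Ef.
set c := 4 * tree_const p p' K + 1.
have c0 : 0 < c by have := norm_const_gt0; rewrite /norm_const -/c; lra.
have A0 : 0 <= energy mu p w f by apply: energy_ge0; exact: dw_w dw.
have E0 : 0 <= E by apply: energy_ge0; exact: dw_w dw.
have scaled t : 0 < t -> E <= d * c * (t `^ p * energy mu p w f + t^-1 `^ p' * E).
  move=> t0.
  rewrite {1}(_ : E = \sum_(Q <- F) a Q * inner mu (dual_fun G) (haar mu Q)); last first.
    rewrite -(integral_haar_sum F a Ig).2 /E /energy.
    by congr Rintegral; apply/funext => x; rewrite dual_funE.
  have [Etf EtfE] := finite_energyZ t Ef.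
  have [Etg EtgE] := finite_energyZ t^-1 Eg.
  apply: (@le_trans _ _ (d * \sum_(Q <- F)
      `|inner mu (fun x => t * f x) (haar mu Q) *
        inner mu (fun x => t^-1 * dual_fun G x) (haar mu Q)|)).
    rewrite mulr_sumr big_seq [leRHS]big_seq; apply: ler_sum => Q QF.
    rewrite !inner_haarZ// mulrACA divff ?gt_eqF// mul1r /a -mulrA.
    by apply: le_trans (ler_norm _) _; rewrite normrM ler_wpM2r// ed.
  rewrite -mulrA ler_wpM2l//; apply: le_trans (bilinear_haar uF Etf Etg) _.
  rewrite EtfE EtgE EgE -/E !ger0_norm ?invr_ge0 ?(ltW t0)//.
 rewrite ler_wpM2r//; last by rewrite /c lerDl.
  by apply: addr_ge0; apply: mulr_ge0 => //; exact: powR_ge0.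
move: d0; rewrite le_eqVlt => /predU1P[d0|d0].
  have := scaled 1 ltr01; rewrite -d0 !mul0r powR0 ?mul0r//; by rewrite gt_eqF.
set y := d * norm_const; have y0 : 0 < y by rewrite mulr_gt0// norm_const_gt0.
have yE : d * c = y / 2 by rewrite /y /norm_const -/c; field.
(* With this [t] the energy of the sum has the factor 1 / 2 on the right-hand
   side, where it can be absorbed. *)
have := scaled (y `^ p'^-1) (powR_gt0 _ y0).
rewrite yE -[(y `^ p'^-1)^-1]powR_inv1 ?powR_ge0// -!powRrM.
have -> : p'^-1 * (-1 * p') = -1 by field; rewrite gt_eqF.
have -> : p'^-1 * p = p - 1 by rewrite -{1}conj_expo mulrC mulfK ?gt_eqF.
rewrite powR_inv1 ?(ltW y0)// -(mulr_powRB1 (ltW y0) p_gt0).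
have -> : y / 2 * (y `^ (p - 1) * energy mu p w f + y^-1 * E) =
  (y * y `^ (p - 1) * energy mu p w f) / 2 + E / 2 by field; rewrite gt_eqF.
lra.
Qed.

End Duality.

(** * The cubes of the partial sums *)

Section PartialSums.
Context {R : realType} {n : nat}.
Hypothesis n_gt0 : (0 < n)%N.
Variable mu : {measure set (borelRn R n) -> \bar R}.
Hypothesis mu_cube : forall Q : dyadic n, (mu (cube Q) < +oo)%E.
Implicit Types (f g : borelRn R n -> R) (Q v : dyadic n) (F r : seq (dyadic n)).
Implicit Types (M : R) (x : 'rV[R]_n).

Definition fam M : set (dyadic n) :=
  [set Q | [/\ (0 < mu (cube Q))%E, cube Q `<` eball M & M^-1 < side Q]].

Lemma coord_le_enorm x i : `|x 0 i| <= enorm x.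
Proof.
rewrite -sqrtr_sqr ler_wsqrtr// (bigD1 i)//= lerDl.
by apply: sumr_ge0 => j _; exact: sqr_ge0.
Qed.

Lemma enorm_le_coord x b : (forall i, `|x 0 i| <= b) -> enorm x <= n%:R * b.
Proof.
move=> xb; have b0 : 0 <= b by apply: le_trans (xb (Ordinal n_gt0)).
rewrite -[leRHS]ger0_norm ?mulr_ge0// -sqrtr_sqr ler_wsqrtr//.
apply: (@le_trans _ _ (\sum_(i < n) b ^+ 2)).
  by apply: ler_sum => i _; rewrite -real_normK ?num_real// lerXn2r ?nnegrE.
rewrite sumr_const card_ord -[leLHS]mulr_natl exprMn ler_wpM2r ?sqr_ge0//.
by rewrite expr2 ler_peMl// ler1n.
Qed.

Lemma fam_gt0 M Q : fam M Q -> 0 < M.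
Proof.
move=> [_ [/(_ _ (cube_center_in Q)) QM _] _]; have : 0 <= enorm (cube_center (R := R) Q).
  exact: sqrtr_ge0.
by move=> /le_lt_trans /(_ QM); rewrite pmulr_lgt0// invr_gt0.
Qed.

Lemma fam_mono M M' : M <= M' -> fam M `<=` fam M'.
Proof.
move=> MM' Q FQ; have M0 := fam_gt0 FQ; case: FQ => m1 m2 m3; split=> //.
- have EM : eball M `<=` eball (n := n) M'.
    by move=> x; rewrite /eball/= => /lt_le_trans; apply; rewrite ler_pM2r// invr_gt0.
  case: m2 => QM nQM; split; first exact: subset_trans QM EM.
  by move=> h; apply: nQM; exact: subset_trans EM h.
- apply: le_lt_trans m3; rewrite lef_pV2 ?posrE//; exact: lt_le_trans MM'.
Qed.

Lemma exp2_gt (k : nat) : k%:R < (2 : R) ^ k.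
Proof. by rewrite -exprnP -natrX ltr_nat ltn_expl. Qed.

Lemma fam_bound M Q : fam M Q ->
  `|Q.1|%:R <= 2 * `|M| + 2 * M ^+ 2 /\ forall i, `|Q.2 i|%:R <= 2 * `|M| + 2 * M ^+ 2.
Proof.
move=> FQ; have M0 := fam_gt0 FQ; case: FQ => _ [QM _] sM.
rewrite (gtr0_norm M0); have s0 := side_gt0 (R := R) Q.
pose a : 'rV[R]_n := \row_i (side Q * (Q.2 i)%:~R).
have aQ : cube Q a.
  move=> i; rewrite mxE lexx /= ltr_pM2l// ltr_int; lia.
have aM i : `|side Q * (Q.2 i)%:~R| < M / 2.
  have := coord_le_enorm a i; rewrite mxE => /le_lt_trans; apply; exact: QM.
have cM i : `|side Q * ((Q.2 i)%:~R + 2^-1)| < M / 2.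
  have := coord_le_enorm (cube_center Q) i; rewrite mxE => /le_lt_trans; apply.
  exact: QM (cube_center_in Q).
have M2 : 0 <= M ^+ 2 by exact: sqr_ge0.
have sM2 : side Q < 2 * M.
  have := aM (Ordinal n_gt0); have := cM (Ordinal n_gt0).
  rewrite mulrDr !ltr_norml; lra.
have isM : (side Q)^-1 < M by rewrite -[M]invrK ltf_pV2 ?posrE ?invr_gt0.
split.
  have : `|Q.1|%:R < 2 * M; last lra.
  have := exp2_gt `|Q.1|%N; case kE : (Q.1) => [k|k].
    by move=> /lt_trans; apply; move: sM2; rewrite /side kE.
  move=> /lt_trans; apply; move: isM; rewrite /side kE NegzE -invr_expz invrK /= => h.
  by apply: (lt_trans h); lra.
move=> i; have : `|(Q.2 i)%:~R| <= M ^+ 2; last first.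
  move=> h; rewrite natr_absz -intr_norm in h *; lra.
have := aM i; rewrite normrM (gtr0_norm s0) => h.
have : `|(Q.2 i)%:~R| <= (side Q)^-1 * (M / 2).
  by rewrite -(ler_pM2l s0) mulVKf ?gt_eqF// ltW.
move/le_trans; apply; rewrite expr2; apply: ler_pM; rewrite ?invr_ge0 ?divr_ge0 ?(ltW s0) ?(ltW M0) ?(ltW isM)//.
lra.
Qed.

Lemma finite_fam M : finite_set (fam M).
Proof.
pose b := Num.truncn (2 * `|M| + 2 * M ^+ 2).
pose g (u : 'I_(b.*2.+1) * {ffun 'I_n -> 'I_(b.*2.+1)}) : dyadic n :=
  ((u.1 : nat)%:Z - b%:Z, [ffun i => (u.2 i : nat)%:Z - b%:Z]).
apply: (@sub_finite_set _ _ (range g)); last exact/finite_image/finite_finset.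
move=> Q FQ; have [Q1 Q2] := fam_bound FQ.
have B (z : int) : `|z|%:R <= 2 * `|M| + 2 * M ^+ 2 -> (`|z| <= b)%N.
  by move=> zb; rewrite /b truncn_ge_nat// (le_trans _ zb).
have bz (z : int) : (`|z| <= b)%N -> (`|(z + b%:Z)%R| < b.*2.+1)%N by lia.
have bz' (z : int) : (`|z| <= b)%N -> (`|(z + b%:Z)%R|%N : int) - b%:Z = z by lia.
exists (Ordinal (bz _ (B _ Q1)), [ffun i => Ordinal (bz _ (B _ (Q2 i)))]) => //.
case: Q FQ Q1 Q2 => k q FQ Q1 Q2; rewrite /g /=; congr pair; first exact: bz' (B _ Q1).
by apply/ffunP => i; rewrite !ffunE; exact: bz' (B _ (Q2 i)).
Qed.

Definition fam_seq M : seq (dyadic n) := finmap.enum_fset (fset_set (fam M)).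

Lemma mem_fam_seq M Q : (Q \in fam_seq M) <-> fam M Q.
Proof. by rewrite /fam_seq in_fset_set ?inE//; exact: finite_fam. Qed.

Lemma fam_seq_uniq M : uniq (fam_seq M).
Proof. exact: finmap.fset_uniq. Qed.

Lemma haar_partial_sumE eps M f x : haar_partial_sum mu eps M f x =
  haar_sum mu (fam_seq M) (fun Q => eps Q * inner mu f (haar mu Q)) x.
Proof.
rewrite /haar_partial_sum fsbig_finite//; exact: finite_fam.
Qed.

Lemma cube_proper_eball v B M : (forall x, cube v x -> enorm x <= B) ->
  2 * B + 1 < M -> cube v `<` eball M.
Proof.
move=> vB BM; split; first by move=> x /vB xB; rewrite /eball /=; lra.
have B0 : 0 <= B.
  by apply: le_trans (vB _ (cube_center_in v)); exact: sqrtr_ge0.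
pose y : 'rV[R]_n := delta_mx 0 (Ordinal n_gt0).
have yE : enorm ((B + 2^-1) *: y) = B + 2^-1.
  rewrite /enorm (bigD1 (Ordinal n_gt0))//= big1 ?addr0.
    by rewrite !mxE !eqxx mulr1 sqrtr_sqr ger0_norm//; lra.
  by move=> i /negPf iN; rewrite !mxE iN andbF mulr0 expr0n.
move=> /(_ ((B + 2^-1) *: y)); rewrite /eball /= yE => H.
have /vB : cube v ((B + 2^-1) *: y) by apply: H; lra.
rewrite yE; lra.
Qed.

Lemma cube_sub_eball v : exists M0, forall M, M0 < M -> cube v `<` eball M.
Proof.
pose b := \sum_i (`|side (R := R) v * (v.2 i)%:~R| + `|side v * (v.2 i + 1)%:~R|).
exists (2 * (n%:R * b) + 1) => M bM; apply: cube_proper_eball bM => x xv.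
apply: enorm_le_coord => i.
have : `|x 0 i| <= `|side v * (v.2 i)%:~R| + `|side v * (v.2 i + 1)%:~R|.
  have /andP[] := xv i; move: (side v * _) (side v * _) => c d dx xc.
  have := ler_norm c; have := ler_norm (- d); rewrite normrN.
  have := normr_ge0 c; have := normr_ge0 d; rewrite ler_norml; lra.
move/le_trans; apply; rewrite /b (bigD1 i)//= lerDl sumr_ge0//.
Qed.

(** Away from the three regimes in which [eps] vanishes there are only cubes
    that belong to all late families. *)
Lemma small_outside_fam (eps : dyadic n -> R) e : 0 < e ->
  vanishing_at_large_side (R := R) eps -> vanishing_at_small_side (R := R) eps ->
  vanishing_at_far_center eps ->
  exists M0, forall M Q, M0 <= M -> (0 < mu (cube Q))%E -> ~ fam M Q -> `|eps Q| < e.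
Proof.
move=> e0 /(_ e e0)[L1 H1] /(_ e e0)[d d0 H2] /(_ e e0)[L2 H3].
pose b := `|L1| + `|L2|.
exists (2 * (n%:R * b) + 1 + d^-1 + 1) => M Q bM mQ nF.
have [|sL] := ltP L1 (side Q); first exact: H1.
have [|sd] := ltP (side Q) d; first exact: H2.
have [|cL] := ltP L2 (enorm (cube_center (R := R) Q)); first exact: H3.
exfalso; apply: nF.
have di : 0 < d^-1 by rewrite invr_gt0.
have nb : 0 <= n%:R * b by rewrite mulr_ge0// addr_ge0.
split=> //.
- apply: (@cube_proper_eball _ (n%:R * b)) => [x xQ|]; last by lra.
  apply: enorm_le_coord => i.
  have := coord_le_enorm (cube_center Q) i; rewrite mxE mulrDr => ci.
  have /andP[] := xQ i; rewrite intrD mulrDr mulr1 => x1 x2.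
  have := ler_norm L1; have := ler_norm L2; have s0 := side_gt0 (R := R) Q.
  move: ci; rewrite /b !ler_norml; lra.
- apply: lt_le_trans sd; rewrite -[ltRHS]invrK ltf_pV2 ?posrE//; lra.
Qed.

Lemma sum_seq_supp (I : eqType) (r1 r2 : seq I) (t : I -> R) : uniq r1 -> uniq r2 ->
  (forall i, t i != 0 -> (i \in r1) = (i \in r2)) ->
  \sum_(i <- r1) t i = \sum_(i <- r2) t i.
Proof.
move=> u1 u2 H.
have E (r : seq I) : \sum_(i <- r) t i = \sum_(i <- [seq j <- r | t j != 0]) t i.
  rewrite big_filter [RHS]big_mkcond; apply: eq_bigr => i _.
  by case: eqP.
rewrite E [RHS]E; apply: perm_big; apply: uniq_perm; rewrite ?filter_uniq//.
by move=> i; rewrite !mem_filter; case: eqP => //= /eqP /H.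
Qed.

Lemma haar_supp Q x : haar mu Q x != 0 -> cube (parent Q) x.
Proof.
move=> h; apply: contrapT => nx; move/eqP: h; apply.
have nQ : ~ cube Q x by move/cube_sub_parent.
by rewrite haarE !indicE (memNset nQ) (memNset nx) mulr0 subrr mulr0.
Qed.

Lemma haar_vol Q x : haar mu Q x != 0 -> (0 < mu (cube Q))%E.
Proof.
move=> h; rewrite lt0e measure_ge0 andbT; apply: contra_neq h => m0.
by rewrite haarE /vol m0 sqrtr0 invr0 mul0r.
Qed.

Lemma haar_const Q (k : int) x y : k <= Q.1 -> locate k x = locate k y ->
  haar mu Q x = haar mu Q y.
Proof.
move=> kQ xy.
have E (v : dyadic n) : k <= v.1 -> (x \in cube v) = (y \in cube v).
  move=> kv; have vE z : locate v.1 z = iter `|v.1 - k|%N parent (locate k z).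
    by rewrite iter_parent_locate; congr locate; lia.
  have L : locate v.1 x = locate v.1 y by rewrite !vE xy.
  apply/idP/idP; rewrite !inE => /cubeP h; apply/cubeP; by rewrite ?L // -L.
have kP : k <= (parent Q).1 by apply: le_trans kQ _; rewrite /= lerDl.
by rewrite !haarE !indicE !E.
Qed.

End PartialSums.

(** * Almost everywhere convergence *)

Section Convergence.
Context {R : realType} {n : nat}.
Hypothesis n_gt0 : (0 < n)%N.
Variable mu : {measure set (borelRn R n) -> \bar R}.
Hypothesis mu_cube : forall Q : dyadic n, (mu (cube Q) < +oo)%E.
Variables (p p' K : R) (w s : borelRn R n -> R).
Hypothesis dw : dual_weights mu p p' K w s.
Implicit Types (f g G : borelRn R n -> R) (Q v : dyadic n) (F r : seq (dyadic n)).
Implicit Types (M U d : R) (x y : 'rV[R]_n) (a c e : dyadic n -> R).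

Let p_gt0 : 0 < p. Proof. exact: lt_trans ltr01 (dw_p dw). Qed.

(** The only property of the coefficients of a function that the limits
    use: unlike the function itself, a family of coefficients with this property
    passes to limits coordinatewise. *)
Definition admissible c U := 0 <= U /\ forall F e d, uniq F -> 0 <= d ->
  (forall Q, Q \in F -> `|e Q| <= d) ->
  energy mu p w (haar_sum mu F (fun Q => e Q * c Q)) <= (d * U) `^ p.

Lemma finite_energy_haar_sum F a : finite_energy mu p w (haar_sum mu F a).
Proof.
apply: finite_energy_sum => //; [exact: dw_w dw|exact: dw_mw dw|].
by move=> Q _; apply: finite_energy_haar => //;
  [exact: dw_w dw|exact: dw_mw dw|exact: dw_Iw dw].
Qed.

Lemma admissible_inner f : finite_energy mu p w f ->
  admissible (fun Q => inner mu f (haar mu Q))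
             (norm_const p p' K * energy mu p w f `^ p^-1).
Proof.
move=> Ef; have f0 : 0 <= energy mu p w f by apply: energy_ge0; exact: dw_w dw.
have c0 := ltW (norm_const_gt0 dw).
split; first by rewrite mulr_ge0 ?powR_ge0.
move=> F e d uF d0 ed; apply: le_trans (energy_haar_sum_le mu_cube dw uF d0 ed Ef) _.
rewrite mulrA [leRHS]powRM ?(mulr_ge0 d0 c0) ?powR_ge0//.
by rewrite -powRrM mulVf ?gt_eqF// powRr1.
Qed.

Lemma powR_cancel_le (a b : R) : 0 <= a -> 0 <= b -> a `^ p <= b `^ p -> a <= b.
Proof.
move=> a0 b0; rewrite leNgt => /negP ab; rewrite leNgt; apply/negP => ba; apply: ab.
by apply: gt0_ltr_powR; rewrite ?nnegrE.
Qed.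

Definition dual_size v : R := mass mu s v `^ (1 - p^-1).

(** Hölder's inequality against the dual weight. *)
Lemma mass_norm_le G U v : 0 <= U -> finite_energy mu p w G ->
  energy mu p w G <= U `^ p -> mass mu (fun x => `|G x|) v <= U * dual_size v.
Proof.
move=> U0 EG GU; have [mG _] := EG.
have IG := finite_energy_integrable_on_cubes dw EG.
have InG : integrable_on_cubes mu (fun x => `|G x|).
  by move=> Q; apply: integrable_EFin_norm => //; exact: cube_measurable.
have [v0|vn0] := eqVneq (vol mu v) 0.
  by rewrite (mass_null mu_cube InG v0) mulr_ge0 ?powR_ge0.
have S0 := mass_s_gt0 dw vn0.
have EnG : finite_energy mu p w (fun x => `|G x|) /\
    energy mu p w (fun x => `|G x|) <= energy mu p w G.
  apply: le_finite_energy => //; [exact: dw_w dw|exact: dw_mw dw| |].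
    exact: measurableT_comp.
  by move=> x; rewrite normr_id.
have mG0 : 0 <= mass mu (fun x => `|G x|) v by exact: mass_ge0.
have H : persp p (mass mu (fun x => `|G x|) v) (mass mu s v) <= U `^ p.
  have h1 := mass_energy_le dw v EnG.1 (fun x => normr_ge0 (G x)).
  have vE u : u \in [:: v] -> u.1 = v.1 by rewrite inE => /eqP ->.
  have := @sum_mass_le _ _ _ _ _ _ _ _ dw [:: v] v.1 _ isT vE EnG.1.
  rewrite big_seq1 => h2.
  exact: le_trans h1 (le_trans h2 (le_trans EnG.2 GU)).
apply: powR_cancel_le => //; first by rewrite mulr_ge0 ?powR_ge0.
rewrite powRM ?powR_ge0// /dual_size -powRrM mulrBl mul1r mulVf ?gt_eqF//.
rewrite -ler_pdivrMr ?powR_gt0// -powRN opprB; exact: H.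
Qed.

(** For cubes [Q] that are not smaller than a fixed cube, the functions [h_Q]
    are constant on it; choosing the signs of the multiplier at a point of it
    turns the norm estimate into an absolute bound. *)
Lemma large_cubes_bound c U (k : int) x : admissible c U ->
  0 < vol mu (locate k x) -> exists B, forall F, uniq F ->
  (forall Q, Q \in F -> k <= Q.1) -> \sum_(Q <- F) `|c Q * haar mu Q x| <= B.
Proof.
move=> [U0 adm]; set v := locate k x => v0.
exists (U * dual_size v / vol mu v) => F uF kF.
pose e Q := Num.sg (c Q * haar mu Q x).
have e1 Q : Q \in F -> `|e Q| <= 1.
  by move=> _; rewrite /e normr_sg; case: (_ == _).
have := adm F e 1 uF ler01 e1; rewrite mul1r; set G := haar_sum _ _ _ => EG.
have := mass_norm_le v U0 (finite_energy_haar_sum _ _) EG.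
set B := \sum_(Q <- F) _; have B0 : 0 <= B by apply: sumr_ge0.
have GE y : cube v y -> `|G y| = B.
  move=> /cubeP vy; have -> : G y = B.
    rewrite /G /haar_sum /B big_seq [RHS]big_seq; apply: eq_bigr => Q QF.
    by rewrite (haar_const n_gt0 mu (kF Q QF) (vy : locate k y = locate k x)) -mulrA /e -normrEsg.
  by rewrite ger0_norm.
rewrite ler_pdivlMr// /mass (@eq_Rintegral _ _ _ _ _ (fun=> B)).
  by rewrite Rintegral_cst//; exact: cube_measurable.
by move=> y; rewrite inE; exact: GE.
Qed.

Lemma sum_seq_sub (I : eqType) (r1 r2 : seq I) (t : I -> R) :
  uniq r1 -> {subset r1 <= r2} -> (forall i, 0 <= t i) ->
  \sum_(i <- r1) t i <= \sum_(i <- r2) t i.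
Proof.
move=> + + t0; elim: r1 r2 => [|i r1 IH] r2; first by rewrite big_nil sumr_ge0.
move=> /= /andP[ir1 u1] sub; rewrite big_cons.
have ir2 : i \in r2 by apply: sub; rewrite mem_head.
rewrite (big_rem i ir2)/= lerD2l; apply: IH => // j jr1.
have := sub j; rewrite inE jr1 orbT => /(_ isT) jr2.
have ji : j != i by apply: contraNneq ir1 => <-.
by have := perm_mem (perm_to_rem ir2) j; rewrite jr2 inE (negPf ji) /= => <-.
Qed.

Definition large M := [seq Q <- fam_seq mu M | 0 <= Q.1].
Definition small M := [seq Q <- fam_seq mu M | Q.1 < 0].

Lemma large_sum_cvg c e U d x : admissible c U -> (forall Q, `|e Q| <= d) ->
  0 < vol mu (locate 0 x) ->
  cvg (\sum_(Q <- large M) e Q * c Q * haar mu Q x @[M --> +oo]).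
Proof.
move=> adm ed x0; have [B BH] := large_cubes_bound adm x0.
have d0 : 0 <= d by apply: le_trans (ed (0, [ffun=> 0])).
(* The sums of the positive and of the negative parts of the terms are monotone
   in the real parameter [M]. *)
pose t (b : R) Q := Num.max (b * (e Q * c Q * haar mu Q x)) 0.
have t0 b Q : 0 <= t b Q by rewrite /t le_max lexx orbT.
have tE Q : e Q * c Q * haar mu Q x = t 1 Q - t (-1) Q.
  rewrite /t mul1r mulN1r; move: (e Q * _ * _) => z.
  by case: (leP z 0) => z0; case: (leP (- z) 0); lra.
have tB b Q : `|b| = 1 -> t b Q <= d * `|c Q * haar mu Q x|.
  move=> b1; rewrite ge_max mulr_ge0 ?andbT//.
  apply: le_trans (ler_norm _) _; rewrite normrM b1 mul1r -mulrA normrM.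
  by rewrite ler_wpM2r// ed.
have ul M : uniq (large M) by rewrite filter_uniq// fam_seq_uniq.
have C b : `|b| = 1 -> cvg (\sum_(Q <- large M) t b Q @[M --> +oo]).
  move=> b1; apply/cvg_ex; eexists; apply: nondecreasing_cvgr.
    move=> M M' MM'; apply: sum_seq_sub => // Q; rewrite !mem_filter => /andP[-> /=].
    by move=> /(mem_fam_seq n_gt0 mu) h; apply/(mem_fam_seq n_gt0 mu);
       exact: fam_mono MM' _ h.
  exists (d * B) => _ [M _ <-].
  apply: (@le_trans _ _ (d * \sum_(Q <- large M) `|c Q * haar mu Q x|)).
    by rewrite mulr_sumr; apply: ler_sum => Q _; exact: tB.
  rewrite ler_wpM2l// BH// => Q; by rewrite mem_filter => /andP[].
rewrite (_ : (fun M => _) = (fun M => \sum_(Q <- large M) t 1 Q) \-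
    (fun M => \sum_(Q <- large M) t (-1) Q)); last first.
  by apply/funext => M /=; rewrite -sumrB; apply: eq_bigr => Q _.
apply: is_cvgB; apply: C; rewrite ?normrN normr1//.
Qed.

End Convergence.

Lemma negative_level (z : int) : z < 0 -> z = - (`|(z + 1)%R|%N.+1)%:Z.
Proof. lia. Qed.

Lemma lt_opp_nat (z : int) (k : nat) : z < - k%:Z -> z < 0.
Proof. lia. Qed.

Lemma lt_opp_le (z : int) (k : nat) : z < - k%:Z -> z <= - k.+1%:Z.
Proof. lia. Qed.

Section SmallCubes.
Context {R : realType} {n : nat}.
Hypothesis n_gt0 : (0 < n)%N.
Variable mu : {measure set (borelRn R n) -> \bar R}.
Implicit Types (Q v : dyadic n) (M : R) (x y : 'rV[R]_n) (a : dyadic n -> R).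

Definition step a (k : nat) x : R := \sum_(f : {ffun 'I_n -> bool})
  a (child (locate (- k%:Z) x) f) * haar mu (child (locate (- k%:Z) x) f) x.

(** The part of the expansion at [x] that comes from the [N] coarsest
    generations of cubes of side less than one. *)
Definition psum a (N : nat) x : R := \sum_(0 <= k < N) step a k x.

(** Only the cubes whose parent contains [x] contribute at [x], so that for large
    [M] the partial sums at [x] are cut off by generation. *)
Lemma small_sum a x M N : cube (locate 0 x) `<` eball M ->
  (forall k : nat, (M^-1 < (2 : R) ^ (- k.+1%:Z)) = (k < N)%N) ->
  \sum_(Q <- small mu M) a Q * haar mu Q x = psum a N x.
Proof.
move=> vM HN; pose t Q := a Q * haar mu Q x.
pose l := [seq child (locate (- k%:Z) x) f | k <- iota 0 N,
  f <- index_enum {ffun 'I_n -> bool}].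
transitivity (\sum_(Q <- l) t Q); last first.
  rewrite /l big_allpairs_dep /psum /index_iota subn0 /=.
  by apply: eq_bigr.
have ul : uniq l.
  apply: allpairs_uniq; rewrite ?iota_uniq ?index_enum_uniq//.
  move=> [k f] [k' f'] _ _ /= E.
  have kk' : k = k' by have := congr1 fst E; rewrite /=; lia.
  by congr pair => //; have := congr1 (@parity n) E; rewrite !parity_child.
suff H (Q : dyadic n) : t Q != 0 -> (Q \in small mu M) = (Q \in l).
  by apply: sum_seq_supp => //; rewrite filter_uniq// fam_seq_uniq.
move=> tQ; have hQ : haar mu Q x != 0 by apply: contra_neq tQ => h; rewrite /t h mulr0.
have xP := haar_supp hQ; have PE : parent Q = locate (Q.1 + 1) x by apply/esym/(cubeP (parent Q)).
apply/idP/idP.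
  rewrite mem_filter => /andP[Q0 /(mem_fam_seq n_gt0 mu)[_ _ sQ]].
  pose k := `|(Q.1 + 1)%R|%N; have kE : Q.1 = - k.+1%:Z by exact: negative_level.
  apply/allpairsP; exists (k, parity Q); split => /=.
  - by rewrite mem_iota /= add0n -HN; move: sQ; rewrite /side kE.
  - exact: mem_index_enum.
  - by rewrite -[LHS]child_parity PE; congr (child (locate _ x) _); rewrite /k; lia.
move=> /allpairsP[[k f] /= [kN _ QE]].
have Q1 : Q.1 = - k.+1%:Z by rewrite QE /=; lia.
rewrite mem_filter Q1 /=; apply/(mem_fam_seq n_gt0 mu); split.
- exact: haar_vol hQ.
- have sub : cube (R := R) Q `<=` cube (locate 0 x).
    apply: subset_trans (@cube_sub_parent _ _ Q) _; rewrite PE.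
    apply: subset_trans (@cube_sub_iter_parent R n k _) _.
    by rewrite iter_parent_locate Q1 (_ : _ + _ = 0)//; lia.
  case: vM => vM nvM; split; first exact: subset_trans sub vM.
  by move=> h; apply: nvM; exact: subset_trans h sub.
- by rewrite /side Q1 HN; move: kN; rewrite mem_iota.
Qed.

Lemma exists_depth M : 0 < M -> exists N,
  forall k : nat, (M^-1 < (2 : R) ^ (- k.+1%:Z)) = (k < N)%N.
Proof.
move=> M0.
have E (k : nat) : (M^-1 < (2 : R) ^ (- k.+1%:Z)) = (2 ^+ k.+1 < M).
  by rewrite -invr_expz ltf_pV2 ?posrE ?exprz_gt0.
have ex : exists k, ~~ ((2 : R) ^+ k.+1 < M).
  exists (Num.truncn M); rewrite -leNgt; apply: le_trans (ltW (exp2_gt _)).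
  by apply: ltW; apply: truncnS_gt.
case: (ex_minnP ex) => N nN minN; exists N => k; rewrite E.
apply/idP/idP => [kM|kN]; last first.
  by apply: contraLR kN; rewrite -leqNgt => /minN.
rewrite ltnNge; apply: contra nN => Nk; apply: le_lt_trans kM.
by rewrite ler_weXn2l// ler1n.
Qed.

Lemma locate_coarse (k i : nat) x y : (i <= k)%N ->
  locate (- k%:Z) x = locate (- k%:Z) y -> locate (- i%:Z) x = locate (- i%:Z) y.
Proof.
move=> ik xy; have E z : locate (- i%:Z) z = iter (k - i) parent (locate (- k%:Z) z).
  by rewrite iter_parent_locate; congr locate; lia.
by rewrite !E xy.
Qed.

Lemma psum_const a (j k : nat) x y : (j <= k)%N ->
  locate (- k%:Z) x = locate (- k%:Z) y -> psum a j x = psum a j y.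
Proof.
move=> jk xy; apply: eq_big_nat => i /andP[_ ij].
have ik : (i < k)%N by exact: leq_trans jk.
rewrite /step (locate_coarse (ltnW ik) xy); apply: eq_bigr => f _; congr (_ * _).
by apply: (haar_const n_gt0 mu _ xy); rewrite /=; lia.
Qed.

Lemma measurable_locate (h : dyadic n -> R) (k : int) :
  measurable_fun setT (fun x : borelRn R n => h (locate k x)).
Proof.
move=> _ B mB; rewrite setTI.
rewrite (_ : _ @^-1` B = \bigcup_(q : {ffun 'I_n -> int})
   (if pselect (B (h (k, q))) then cube (k, q) else set0)).
  apply: countable_bigcupT_measurable; first exact: countableP.
  by move=> q; case: pselect => ? /=; [exact: cube_measurable|exact: measurable0].
apply/seteqP; split => [x Bx|x [q _]].
  exists (locate k x).2 => //; case: pselect => [Bx2|nB] /=; first exact: cube_locate.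
  by exfalso; apply: nB; exact: Bx.
by case: pselect => // Bq /cubeP /= xq; rewrite /= xq.
Qed.

Lemma measurable_psum a j : measurable_fun setT (psum a j : borelRn R n -> R).
Proof.
rewrite (_ : psum a j = fun x => psum a j (cube_center (locate (- j%:Z) x))).
  exact: (measurable_locate (fun Q => psum a j (cube_center Q))).
apply/funext => x; apply: psum_const (leqnn _) _.
by apply/esym/(cubeP (locate _ x))/cube_center_in.
Qed.

End SmallCubes.

Section WeakType.
Context {R : realType} {n : nat}.
Hypothesis n_gt0 : (0 < n)%N.
Variable mu : {measure set (borelRn R n) -> \bar R}.
Hypothesis mu_cube : forall Q : dyadic n, (mu (cube Q) < +oo)%E.
Variables (p p' K : R) (w s : borelRn R n -> R).
Hypothesis dw : dual_weights mu p p' K w s.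
Implicit Types (Q v : dyadic n) (x y : 'rV[R]_n).
Variables (c e : dyadic n -> R) (U : R).
Hypothesis adm : admissible mu p w c U.

Let a Q := e Q * c Q.
Notation ps := (psum mu a).

Definition oscillation (l : R) v (k N : nat) : set (borelRn R n) :=
  [set x | cube v x /\ exists j, (k <= j <= N)%N /\ l < `|ps j x - ps k x|].

Lemma oscillation_measurable l v k N : measurable (oscillation l v k N).
Proof.
have -> : oscillation l v k N = cube v `&` \bigcup_(j in [set j | (k <= j <= N)%N])
    ((fun x : borelRn R n => `|ps j x - ps k x|) @^-1` `]l, +oo[%classic).
  apply/seteqP; split => [x [xv [j [jk jl]]]|x [xv [j jk]]].
    by split=> //; exists j => //=; rewrite in_itv/= andbT.
  by rewrite /= in_itv/= andbT => jl; split=> //; exists j.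
apply: measurableI; first exact: cube_measurable.
apply: bigcup_measurable => j _; rewrite -[X in measurable X]setTI.
have m1 : measurable_fun setT (fun x : borelRn R n => `|ps j x - ps k x|).
  apply: measurableT_comp => //; apply: measurable_funB; exact: measurable_psum.
exact: m1.
Qed.

Definition calm (l : R) k (j : nat) x :=
  [forall i : 'I_j.+1, (k <= i)%N ==> (`|ps i x - ps k x| <= l)].

(** A weak type inequality. The multiplier is set to zero on the cubes that lie
    below the first generation at which the partial sum has moved by more than
    [l]; the resulting sum is the partial sum at that generation, and it obeys the
    same norm estimate. *)
Lemma weak_type l v k N d : v.1 = 0 -> 0 <= d -> 0 < l ->
  (forall Q, Q.1 < - k%:Z -> `|e Q| <= d) ->
  l * fine (mu (oscillation l v k N)) <= d * U * dual_size mu p s v.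
Proof.
move=> v1 d0 l0 ed.
(* Whether the partial sum has moved is constant on the parent of [Q]; it is read
   off at the center. *)
pose on Q := [&& Q.1 < - k%:Z, - N%:Z <= Q.1 &
  calm l k `|(Q.1 + 1)%R|%N (cube_center (parent Q))].
pose e' Q := if on Q then e Q else 0.
have e'd Q : `|e' Q| <= d.
  by rewrite /e'; case: ifPn => [/and3P[/ed]//|_]; rewrite normr0.
have [M0 HM0] := @cube_sub_eball R n n_gt0 v.
pose M := Num.max (Num.max (M0 + 1) 1) (2 ^+ N.+1 + 1).
have M1 : 1 <= M by rewrite /M !le_max lexx orbT.
have vM : cube v `<` eball M by apply: HM0; rewrite /M !lt_max; apply/orP; left; apply/orP; left; lra.
have Mp : 0 < M by lra.
have [L HL] := exists_depth Mp.
have NL : (N <= L)%N.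
  apply: ltnW; rewrite -HL -invr_expz ltf_pV2 ?posrE ?exprz_gt0//.
  by rewrite /M !lt_max -exprnP ltrDl ltr01 orbT.
pose G := haar_sum mu (fam_seq mu M) (fun Q => e' Q * c Q).
have GE x : cube v x -> G x = \sum_(0 <= i < L)
    (if [&& (k <= i)%N, (i < N)%N & calm l k i x] then step mu a i x else 0).
  move=> xv; have vE : v = locate 0 x by rewrite -v1; apply/esym/cubeP.
  have -> : G x = \sum_(Q <- small mu M) e' Q * c Q * haar mu Q x.
    rewrite /G /haar_sum /small big_filter [RHS]big_mkcond; apply: eq_bigr => Q _.
    case: ifPn => // Q0; rewrite /e' /on ifF ?mul0r//; apply/negP => /and3P[q1 _ _].
    by case/negP: Q0; exact: lt_opp_nat q1.
  rewrite (@small_sum R n n_gt0 mu (fun Q => e' Q * c Q) _ _ _ _ HL) -?vE// /psum.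
  apply: eq_big_nat => i _.
  have E f : e' (child (locate (- i%:Z) x) f) =
      if [&& (k <= i)%N, (i < N)%N & calm l k i x] then e (child (locate (- i%:Z) x) f) else 0.
    rewrite /e'; congr (if _ then _ else _); rewrite /on parent_child /=.
    have -> : (- i%:Z - 1 < - k%:Z) = (k <= i)%N by lia.
    have -> : (- N%:Z <= - i%:Z - 1) = (i < N)%N by lia.
    have -> : `|(- i%:Z - 1 + 1)%R|%N = i by lia.
    congr [&& _, _ & _]; apply: eq_forallb => j; case: (leqP k j) => //= kj.
    have lE : locate (- i%:Z) (cube_center (R := R) (locate (- i%:Z) x)) = locate (- i%:Z) x.
      by apply/(cubeP (locate _ x))/cube_center_in.
    have ji : (j <= i)%N by rewrite -ltnS.
    by rewrite (psum_const n_gt0 mu a ji lE) (psum_const n_gt0 mu a (leq_trans kj ji) lE).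
  rewrite /step; case: ifPn => h.
    by apply: eq_bigr => f _; rewrite E h.
  by apply: big1 => f _; rewrite E (negPf h) !mul0r.
have [U0 admU] := adm.
have EG : energy mu p w G <= (d * U) `^ p.
  by apply: admU => //; exact: fam_seq_uniq.
have FG := finite_energy_haar_sum dw (fam_seq mu M) (fun Q => e' Q * c Q).
have := mass_norm_le mu_cube dw v (mulr_ge0 d0 U0) FG EG; apply: le_trans.
have IG : mu.-integrable (cube v) (EFin \o (fun x => `|G x|)).
  apply: integrable_EFin_norm; first exact: cube_measurable.
  by have := finite_energy_integrable_on_cubes dw FG => /(_ v).
have mE := oscillation_measurable l v k N.
have Ev : oscillation l v k N `<=` cube v by move=> x [].
have IE : mu.-integrable (oscillation l v k N) (EFin \o (fun x => `|G x|)).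
  by apply: integrableS IG => //; exact: cube_measurable.
apply: (@le_trans _ _ (\int[mu]_(x in oscillation l v k N) `|G x|)); last first.
  apply: fine_le; rewrite ?integrable_fin_num//; first exact: cube_measurable.
  apply: ge0_subset_integral => //; first exact: cube_measurable.
  exact: (measurable_int mu IG).
rewrite -Rintegral_cst//; apply: le_Rintegral => //.
  apply: (integrableS (cube_measurable v)) => //; exact: integrable_on_cubes_cst.
move=> x [xv [j0 [/andP[kj0 j0N] jl]]]; apply: ltW; rewrite GE//.
have exj : exists j, (k <= j)%N && (l < `|ps j x - ps k x|) by exists j0; rewrite kj0.
case: (ex_minnP exj) => t /andP[kt tl] tmin.
have tN : (t <= N)%N by apply: leq_trans j0N; apply: tmin; rewrite kj0.
have calmE i : (k <= i)%N -> calm l k i x = (i < t)%N.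
  move=> ki; apply/idP/idP => [/forallP H|it].
    rewrite ltnNge; apply/negP => ti; have := H (inord t).
    rewrite inordK ?ltnS// kt /=; by rewrite leNgt tl.
  apply/forallP => j; apply/implyP => kj; rewrite leNgt; apply/negP => jl'.
  have := tmin j; rewrite kj jl' => /(_ isT) tj.
  have ji : (j <= i)%N by rewrite -ltnS.
  by move: tj; rewrite leqNgt (leq_ltn_trans ji it).
rewrite (_ : \sum_(0 <= i < L) _ = ps t x - ps k x)//.
have tL := leq_trans tN NL.
rewrite (big_cat_nat _ (n := k))//=; last exact: leq_trans kt tL.
rewrite big_nat_cond big1 ?add0r; last first.
  by move=> i /andP[/andP[_ ik] _]; rewrite leqNgt ik.
rewrite (big_cat_nat _ (n := t))//= [X in _ + X]big_nat_cond [X in _ + X]big1 ?addr0; last first.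
  move=> i /andP[/andP[ti _] _]; case: ifPn => // /and3P[ki _].
  by rewrite calmE// ltnNge ti.
have -> : ps t x = ps k x + \sum_(k <= i < t) step mu a i x.
  by rewrite /psum -big_cat_nat.
rewrite addrAC subrr add0r.
apply: eq_big_nat => i /andP[ki it].
by rewrite ki (leq_trans it tN) calmE// it.
Qed.

End WeakType.

Section AlmostEverywhere.
Context {R : realType} {n : nat}.
Hypothesis n_gt0 : (0 < n)%N.
Variable mu : {measure set (borelRn R n) -> \bar R}.
Hypothesis mu_cube : forall Q : dyadic n, (mu (cube Q) < +oo)%E.
Variables (p p' K : R) (w s : borelRn R n -> R).
Hypothesis dw : dual_weights mu p p' K w s.
Implicit Types (Q v : dyadic n) (x y : 'rV[R]_n).
Variables (c e : dyadic n -> R) (U : R).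
Hypothesis adm : admissible mu p w c U.
Hypothesis e_small : forall d : R, 0 < d ->
  exists k : nat, forall Q, Q.1 < - k%:Z -> `|e Q| <= d.

Let a Q := e Q * c Q.

Lemma oscillation_mono l v k :
  {homo oscillation mu c e l v k : i j / (i <= j)%N >-> (i <= j)%O}.
Proof.
move=> N N' NN'; apply/subsetPset => x [xv [j [/andP[kj jN] jl]]]; split=> //; exists j; split=> //.
by rewrite kj (leq_trans jN NN').
Qed.

(** The bound of the weak type inequality is proportional to the size of the
    multiplier on the cubes of side less than [2^-k], which tends to zero. *)
Lemma persistent_oscillation_null l v : v.1 = 0 -> 0 < l ->
  mu (\bigcap_k \bigcup_N oscillation mu c e l v k N) = 0%E.
Proof.
move=> v1 l0.
have mO k : measurable (\bigcup_N oscillation mu c e l v k N).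
  by apply: bigcupT_measurable => N; exact: oscillation_measurable.
have mB : measurable (\bigcap_k \bigcup_N oscillation mu c e l v k N).
  exact: bigcapT_measurable.
have U0 : 0 <= U by case: adm.
pose C := U * dual_size mu p s v / l.
have C0 : 0 <= C by rewrite divr_ge0 ?(ltW l0)// mulr_ge0// powR_ge0.
apply/eqP; rewrite eq_le measure_ge0 andbT; apply/lee_addgt0Pr => r r0.
rewrite add0e; have [k Hk] := e_small (divr_gt0 r0 (ltr_pwDl ltr01 C0)).
have O_le N : (mu (oscillation mu c e l v k N) <= r%:E)%E.
  have mE := oscillation_measurable n_gt0 mu c e l v k N.
  have fin : (mu (oscillation mu c e l v k N) < +oo)%E.
    apply: le_lt_trans (mu_cube v); apply: le_measure; rewrite ?inE//.
      exact: cube_measurable.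
    by move=> x [].
  rewrite -[leLHS]fineK ?ge0_fin_numE// lee_fin.
  have r1 : 0 <= r / (1 + C) by rewrite divr_ge0 ?(ltW r0)// addr_ge0.
  have := weak_type n_gt0 mu_cube dw adm N v1 r1 l0 Hk.
  rewrite mulrC -ler_pdivlMr// => h; apply: (le_trans h).
  rewrite (_ : _ / l = r * (C / (1 + C))); last by rewrite /C; ring.
  by rewrite ger_pMr// ler_pdivrMr ?mul1r ?lerDr// ltr_pwDl.
apply: (@le_trans _ _ (mu (\bigcup_N oscillation mu c e l v k N))).
  by apply: le_measure; rewrite ?inE//; exact: bigcap_inf.
have cv := nondecreasing_cvg_mu (mu := mu) (oscillation_measurable n_gt0 mu c e l v k)
  (mO k) (@oscillation_mono l v k).
by apply: (cvge_to_le cv); near=> N; exact: O_le.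
Unshelve. all: by end_near.
Qed.

Lemma psum_cvg_negligible v : v.1 = 0 ->
  mu.-negligible [set x | cube v x /\ ~ cvgn (fun N => psum mu a N x)].
Proof.
move=> v1; apply: (negligibleS _ (negligible_bigcup (F := fun m =>
   \bigcap_k \bigcup_N oscillation mu c e m.+1%:R^-1 v k N) _)); last first.
  move=> m; apply/negligibleP; last by apply: persistent_oscillation_null.
  apply: bigcapT_measurable => k; apply: bigcupT_measurable => N.
  exact: oscillation_measurable.
move=> x [xv ncv]; apply: contrapT => nb; apply: ncv; apply: cauchy_cvg.
apply: cauchy_exP => d d0.
pose m := Num.truncn d^-1.
have md : m.+1%:R^-1 < d.
  by rewrite -[ltRHS]invrK ltf_pV2 ?posrE ?invr_gt0//; exact: truncnS_gt.
have [k Hk] : exists k, forall N, (k <= N)%N -> `|psum mu a N x - psum mu a k x| <= m.+1%:R^-1.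
  apply: contrapT => nk; apply: nb; exists m => // k _; apply: contrapT => nk'.
  apply: nk; exists k => N kN; rewrite leNgt; apply/negP => h; apply: nk'.
  by exists N => //; split=> //; exists N; rewrite kN leqnn.
exists (psum mu a k x); exists k => // N /= kN.
by rewrite -ball_normE /ball_/= distrC; apply: le_lt_trans (Hk N kN) md.
Qed.

Definition good x := 0 < vol mu (locate 0 x) /\ cvgn (fun N => psum mu a N x).

Lemma ae_good : {ae mu, forall x, good x}.
Proof.
pose B (q : {ffun 'I_n -> int}) : set (borelRn R n) := [set x | cube (0, q) x /\ ~ good x].
have nB q : mu.-negligible (B q).
  have [v0|vn0] := eqVneq (vol mu (0, q)) 0.
    have c0 : mu.-negligible (cube (0, q)).
      by apply/negligibleP; [exact: cube_measurable|have := volE mu_cube (0, q); rewrite v0].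
    by apply: negligibleS c0 => x [].
  apply: negligibleS (psum_cvg_negligible (v := (0, q)) erefl).
  move=> x [xq ng]; split=> // cv; apply: ng; split=> //.
  by move/cubeP: xq => /= ->; rewrite lt0r vn0 vol_ge0.
pose F m := if @choice.unpickle {ffun 'I_n -> int} m is Some q then B q else set0.
apply: (negligibleS _ (negligible_bigcup (F := F) _)); last first.
  by move=> m; rewrite /F; case: choice.unpickle => [q|]; [exact: nB|exact: negligible_set0].
move=> x ng; exists (choice.pickle (locate 0 x).2) => //.
rewrite /F choice.pickleK; split=> //; exact: cube_locate.
Qed.

Lemma partial_sum_cvg d x : (forall Q, `|e Q| <= d) -> good x ->
  cvg (haar_sum mu (fam_seq mu M) a x @[M --> +oo]).
Proof.
move=> ed [x0 /cvg_ex[t cvt]].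
have lc := large_sum_cvg n_gt0 mu_cube dw adm ed x0.
rewrite (_ : (fun M => _) = (fun M => \sum_(Q <- large mu M) a Q * haar mu Q x) \+
   (fun M => \sum_(Q <- small mu M) a Q * haar mu Q x)); last first.
  apply/funext => M /=; rewrite /large /small !big_filter /haar_sum.
  rewrite (bigID (fun Q : dyadic n => 0 <= Q.1))/=; congr (_ + _).
  by apply: eq_bigl => Q; rewrite -ltNge.
apply: is_cvgD => //; apply/cvg_ex; exists t; apply/cvgrPdist_lt => r r0.
have [N0 _ HN0] : \forall N \near \oo, `|t - psum mu a N x| < r.
  by move/cvgrPdist_lt: cvt; apply.
have [M0 HM0] := @cube_sub_eball R n n_gt0 (locate 0 x).
near=> M.
have M1 : 0 < M by near: M; exact: nbhs_pinfty_gt.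
have vM : cube (locate 0 x) `<` eball M.
  by apply: HM0; near: M; apply: nbhs_pinfty_gt; rewrite num_real.
have [L HL] := exists_depth M1.
rewrite (@small_sum R n n_gt0 mu a x M L vM HL); apply: HN0 => /=.
apply: ltnW; rewrite -HL -invr_expz ltf_pV2 ?posrE ?exprz_gt0//.
Unshelve. all: by end_near.
Qed.

End AlmostEverywhere.

Section EnergyLimit.
Context d (T : measurableType d) (R : realType) (mu : {measure set T -> \bar R}).
Variables (p : R) (w : T -> R).
Hypotheses (p0 : 0 < p) (w_gt0 : forall x, 0 < w x)
  (w_meas : measurable_fun setT w).
Implicit Types f g : T -> R.

Lemma cvg_powR (u : nat -> R) (l : R) : (forall k, 0 <= u k) ->
  u k @[k --> \oo] --> l -> (u k) `^ p @[k --> \oo] --> l `^ p.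
Proof.
move=> u0 ul; have l0 : 0 <= l.
  by rewrite -(cvg_lim _ ul)//; apply: limr_ge; [apply/cvg_ex; exists l|near=> k; exact: u0].
move: l0; rewrite le_eqVlt => /predU1P[l0|l0].
  move: ul; rewrite -l0 powR0 ?gt_eqF// => ul.
  apply/cvgrPdist_lt => e e0; have e'0 : 0 < e `^ p^-1 by rewrite powR_gt0.
  move/cvgrPdist_lt: ul => /(_ _ e'0); apply: filterS => k.
  rewrite !sub0r !normrN (ger0_norm (u0 k)) (ger0_norm (powR_ge0 _ _)) => uk.
  have -> : e = (e `^ p^-1) `^ p by rewrite -powRrM mulVf ?gt_eqF// powRr1// ltW.
  by apply: gt0_ltr_powR; rewrite ?nnegrE ?u0 ?powR_ge0.
have [dl _] := is_derive1_powR p l0.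
have cl : {for l, continuous (@powR R ^~ p)}.
  by apply: differentiable_continuous; apply/derivable1_diffP.
exact: (cvg_comp _ _ ul cl).
Unshelve. all: by end_near.
Qed.

Lemma limn_einf_le (u : nat -> \bar R) (b : \bar R) : (forall k, u k <= b)%E ->
  (limn_einf u <= b)%E.
Proof.
move=> ub; rewrite limn_einf_lim; apply: lime_le; first exact: is_cvg_einfs.
near=> k; apply: le_trans (ub k).
by apply: ereal_inf_lbound; exists k => /=.
Unshelve. all: by end_near.
Qed.

(** Fatou's lemma, applied after multiplication by the indicator of the
    complement of the exceptional null set. *)
Lemma energy_lim (h : nat -> T -> R) g B : measurable_fun setT g ->
  (forall k, finite_energy mu p w (h k)) -> (forall k, energy mu p w (h k) <= B) ->
  {ae mu, forall x, h k x @[k --> \oo] --> g x} ->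
  finite_energy mu p w g /\ energy mu p w g <= B.
Proof.
move=> mg Eh hB [N [mN N0 Ng]].
pose i : T -> R := \1_(~` N).
have mi : measurable_fun setT i by apply: measurable_indic; exact: measurableC.
pose g' x := g x * i x; pose h' k x := h k x * i x.
have mg' : measurable_fun setT g' by exact: measurable_funM.
have i1 x : `|i x| <= 1 by rewrite /i indicE; case: (_ \in _); rewrite ?normr1 ?normr0.
have Eh' k : finite_energy mu p w (h' k) /\ energy mu p w (h' k) <= energy mu p w (h k).
  apply: le_finite_energy => //; first by apply: measurable_funM => //; exact: (Eh k).1.
  by move=> x; rewrite normrM ler_piMr.
have cv x : h' k x @[k --> \oo] --> g' x.
  rewrite /h' /g' /i indicE; have [xN|xN] := boolP (x \in ~` N); last first.
    by rewrite mulr0; under eq_fun do rewrite mulr0; exact: cvg_cst.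
  rewrite mulr1; under eq_fun do rewrite mulr1.
  apply: contrapT => nc; move: xN; rewrite inE; apply; exact: Ng.
pose D f x := (`|f x| `^ p * w x)%:E.
have mD f : measurable_fun setT f -> measurable_fun setT (D f).
  by move=> mf; apply/measurable_EFinP; exact: measurable_density.
have D0 f x : (0 <= D f x)%E by rewrite lee_fin density_ge0.
have B0 : 0 <= B := le_trans (energy_ge0 _ _ w_gt0 _) (hB 0%N).
have gB : (\int[mu]_x D g' x <= B%:E)%E.
  have -> : (\int[mu]_x D g' x = \int[mu]_x limn_einf (fun k => D (h' k) x))%E.
    apply: eq_integral => x _; apply/esym.
    apply: (cvg_limn_einf_sup _).1; apply: cvg_EFin; first by near=> k.
    apply: (@cvgM _ _ _ _ (fun k => `|h' k x| `^ p) (fun=> w x)); last exact: cvg_cst.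
    by apply: cvg_powR => //; exact: cvg_norm.
  apply: le_trans (fatou _ measurableT _ _) _ => //.
    by move=> k; apply: mD; exact: (Eh' k).1.1.
  apply: limn_einf_le => k; have [[mh Ih] hh] := Eh' k.
  rewrite -[leLHS]fineK; first by rewrite lee_fin; exact: le_trans hh (hB k).
  exact: integrable_fin_num Ih.
have E : (\int[mu]_x D g x = \int[mu]_x D g' x)%E.
  apply: ge0_ae_eq_integral => //; [exact: mD|exact: mD|].
  exists N; split => // x; rewrite /= => nx; apply: contrapT => xN; apply: nx => _.
  by rewrite /D /g' /i indicE mem_set// mulr1.
have Ig : mu.-integrable setT (D g).
  apply/integrableP; split; first exact: mD.
  rewrite (eq_integral (D g)); last by move=> x _; rewrite gee0_abs.
  by rewrite E; apply: le_lt_trans gB _; rewrite ltry.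
split; first by split.
have : (\int[mu]_x D g x <= B%:E)%E by rewrite E.
rewrite -[leLHS]fineK; first by rewrite lee_fin.
exact: integrable_fin_num Ig.
Unshelve. all: by end_near.
Qed.

End EnergyLimit.

(** * The limit operator *)

Section LimitOperator.
Context {R : realType} {n : nat}.
Hypothesis n_gt0 : (0 < n)%N.
Variable mu : {measure set (borelRn R n) -> \bar R}.
Hypothesis mu_cube : forall Q : dyadic n, (mu (cube Q) < +oo)%E.
Implicit Types (Q v : dyadic n) (x y : borelRn R n) (a c e : dyadic n -> R).

Definition haar_lim a : borelRn R n -> R :=
  fun x => lim (haar_sum mu (fam_seq mu M) a x @[M --> +oo]).

Lemma measurable_haar_sum r a : measurable_fun setT (haar_sum mu r a).
Proof.
elim: r => [|Q r IH].
  rewrite (_ : haar_sum mu [::] a = fun=> 0); first exact: measurable_cst.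
  by apply/funext => x; rewrite /haar_sum big_nil.
rewrite (_ : haar_sum mu _ a = fun x => a Q * haar mu Q x + haar_sum mu r a x); last first.
  by apply/funext => x; rewrite /haar_sum big_cons.
apply: measurable_funD => //; apply: measurable_funM => //.
apply: measurable_funM => //; apply: measurable_funB.
  by apply: measurable_indic; exact: cube_measurable.
by apply: measurable_funM => //; apply: measurable_indic; exact: cube_measurable.
Qed.

Definition close_after a (j m : nat) : set (borelRn R n) :=
  [set x | forall M M' : R, j%:R < M -> j%:R < M' ->
    `|haar_sum mu (fam_seq mu M) a x - haar_sum mu (fam_seq mu M') a x| <= m.+1%:R^-1].

(** Only countably many finite families of cubes exist, so that the condition
    over the pairs of radii is a countable one. *)
Lemma measurable_close_after a j m : measurable (close_after a j m).
Proof.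
pose K := (int * {ffun 'I_n -> int})%type.
pose S (r : seq K) := haar_sum mu (r : seq (dyadic n)) a.
pose occurs (r : seq K) := exists2 M : R, j%:R < M & fam_seq mu M = r.
pose far (u : seq K * seq K) : set (borelRn R n) :=
  if pselect (occurs u.1 /\ occurs u.2) then
    (fun x => `|S u.1 x - S u.2 x|) @^-1` `]m.+1%:R^-1, +oo[%classic
  else set0.
rewrite (_ : close_after a j m = ~` \bigcup_u far u).
  apply: measurableC; apply: countable_bigcupT_measurable; first exact: countableP.
  move=> u; rewrite /far; case: pselect => ? /=; last exact: measurable0.
  rewrite -[X in measurable X]setTI.
  have m1 : measurable_fun setT (fun x => `|S u.1 x - S u.2 x|).
    by apply: measurableT_comp => //; apply: measurable_funB; exact: measurable_haar_sum.
  exact: m1.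
apply/seteqP; split => [x cx [[r r'] _]|x nf M M' jM jM'].
  rewrite /far; case: pselect => //= -[[M jM <-] [M' jM' <-]].
  by rewrite /= in_itv/= andbT ltNge => /negP; apply; exact: cx.
rewrite leNgt; apply/negP => h; apply: nf; exists (fam_seq mu M, fam_seq mu M') => //.
rewrite /far; case: pselect => /= [_|nc].
  by rewrite /= in_itv/= andbT.
by exfalso; apply: nc; split; [exists M|exists M'].
Qed.

Definition converges a : set (borelRn R n) :=
  [set x | cvg (haar_sum mu (fam_seq mu M) a x @[M --> +oo])].

Lemma convergesE a : converges a = \bigcap_m \bigcup_j close_after a j m.
Proof.
apply/seteqP; split => [x /cvg_ex[l cl] m _|x H].
  have m0 : (0 : R) < m.+1%:R^-1 / 2 by rewrite divr_gt0// invr_gt0.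
  move/cvgrPdist_lt : cl => /(_ _ m0) [M0 [_ HM0]].
  have M0j : M0 < (Num.truncn M0).+1%:R by exact: truncnS_gt.
  exists (Num.truncn M0).+1 => // M M' jM jM'.
  have := HM0 _ (lt_trans M0j jM); have := HM0 _ (lt_trans M0j jM') => /=.
  move: (haar_sum _ _ _ _) (haar_sum _ _ _ _) => u v.
  rewrite !ltr_norml ler_norml; move: (m.+1%:R^-1) => z.
  move=> /andP[? ?] /andP[? ?]; apply/andP; split; lra.
apply: cauchy_cvg; apply: cauchy_exP => r r0.
pose m := Num.truncn r^-1.
have md : m.+1%:R^-1 < r.
  by rewrite -[ltRHS]invrK ltf_pV2 ?posrE ?invr_gt0//; exact: truncnS_gt.
have [j _ Hj] := H m I.
exists (haar_sum mu (fam_seq mu (j%:R + 1)) a x); exists j%:R; split; first exact: num_real.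
move=> M jM; rewrite -ball_normE /ball_/=; apply: le_lt_trans md.
by apply: Hj => //; rewrite ltrDl.
Qed.

Lemma measurable_converges a : measurable (converges a).
Proof.
rewrite convergesE; apply: bigcapT_measurable => m; apply: bigcupT_measurable => j.
exact: measurable_close_after.
Qed.

Lemma cvg_nat_haar_lim a x : converges a x ->
  haar_sum mu (fam_seq mu k%:R) a x @[k --> \oo] --> haar_lim a x.
Proof.
move=> cx; exact: (cvg_comp (fun k : nat => k%:R)
  (fun M : R => haar_sum mu (fam_seq mu M) a x) (@cvgr_idn R) cx).
Qed.

Lemma measurable_haar_lim a : measurable_fun setT (haar_lim a).
Proof.
pose C := converges a; have mC := measurable_converges a.
(* Where the partial sums diverge, [haar_lim] has the default value of [lim]. *)
pose g k x := haar_sum mu (fam_seq mu k%:R) a x * \1_C x + (point : R) * \1_(~` C) x.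
apply: (@measurable_fun_cvg _ _ _ _ g) => [k|x _].
  apply: measurable_funD; apply: measurable_funM => //.
  - exact: measurable_haar_sum.
  - by apply: measurable_indic; exact: measurableC.
rewrite /g !indicE; have [xC|xC] := boolP (x \in C).
  have -> : (x \in ~` C) = false by apply/negP; rewrite !inE in xC *; apply.
  under eq_fun do rewrite mulr1 mulr0 addr0.
  by apply: cvg_nat_haar_lim; rewrite inE in xC.
have -> : (x \in ~` C) by rewrite inE; move: xC; rewrite notin_setE.
under eq_fun do rewrite mulr0 mulr1 add0r.
rewrite (_ : haar_lim a x = point); first exact: cvg_cst.
rewrite /haar_lim /lim /lim_in getPN// => l cl; move: xC; rewrite notin_setE; apply.
by apply/cvg_ex; exists l.
Qed.

Lemma haar_lim_linear (t : R) a a' x : converges a x -> converges a' x ->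
  haar_lim (fun Q => t * a Q + a' Q) x = t * haar_lim a x + haar_lim a' x.
Proof.
move=> ca ca'; apply: cvg_lim => //.
rewrite (_ : (fun M => _) = (fun M => t * haar_sum mu (fam_seq mu M) a x +
    haar_sum mu (fam_seq mu M) a' x)).
  by apply: cvgD => //; apply: cvgM => //; exact: cvg_cst.
apply/funext => M; rewrite /haar_sum mulr_sumr -big_split/=; apply: eq_bigr => Q _; ring.
Qed.

Variables (p p' K : R) (w s : borelRn R n -> R).
Hypothesis dw : dual_weights mu p p' K w s.

Lemma converges_ae c e U d : admissible mu p w c U -> (forall Q, `|e Q| <= d) ->
  (forall d : R, 0 < d -> exists k : nat, forall Q, Q.1 < - k%:Z -> `|e Q| <= d) ->
  {ae mu, forall x, converges (fun Q => e Q * c Q) x}.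
Proof.
move=> adm ed e_small; apply: (negligibleS _ (ae_good n_gt0 mu_cube dw adm e_small)) => x; apply: contra_not.
by move=> gx; exact: (partial_sum_cvg n_gt0 mu_cube dw adm ed gx).
Qed.

Lemma energy_haar_lim_le c e U d : admissible mu p w c U -> 0 <= d ->
  (forall Q, `|e Q| <= d) ->
  (forall d : R, 0 < d -> exists k : nat, forall Q, Q.1 < - k%:Z -> `|e Q| <= d) ->
  finite_energy mu p w (haar_lim (fun Q => e Q * c Q)) /\
  energy mu p w (haar_lim (fun Q => e Q * c Q)) <= (d * U) `^ p.
Proof.
move=> adm d0 ed e_small.
apply: (@energy_lim _ _ _ mu p w _ _ _
  (fun k => haar_sum mu (fam_seq mu k%:R) (fun Q => e Q * c Q))).
- exact: lt_trans ltr01 (dw_p dw).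
- exact: dw_w dw.
- exact: dw_mw dw.
- exact: measurable_haar_lim.
- by move=> k; exact: (finite_energy_haar_sum dw).
- by move=> k; apply: adm.2 => //; exact: fam_seq_uniq.
- apply: (negligibleS _ (converges_ae adm ed e_small)) => x; apply: contra_not.
  exact: cvg_nat_haar_lim.
Qed.

End LimitOperator.

(** * Compactness *)

Lemma sum_powR_le {R : realType} (p a b : R) : 1 <= p -> 0 <= a -> 0 <= b ->
  2 `^ p * (a `^ p + b `^ p) <= (4 * (a + b)) `^ p.
Proof.
move=> p1 a0 b0; have p0 : 0 <= p by apply: le_trans p1.
have ab0 : 0 <= a + b by rewrite addr_ge0.
have h1 : a `^ p <= (a + b) `^ p by rewrite ge0_ler_powR ?nnegrE// lerDl.
have h2 : b `^ p <= (a + b) `^ p by rewrite ge0_ler_powR ?nnegrE// lerDr.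
have h3 : 2 <= 2 `^ p :> R by rewrite le1r_powR//; lra.
have -> : 4 * (a + b) = 2 * (2 * (a + b)) by ring.
rewrite powRM ?mulr_ge0// ler_wpM2l ?powR_ge0//.
apply: (@le_trans _ _ (2 * (a + b) `^ p)); first by rewrite mulr2n mulrDl mul1r lerD.
by rewrite powRM// ler_wpM2r ?powR_ge0.
Qed.

Section Compactness.
Context {R : realType} {n : nat}.
Hypothesis n_gt0 : (0 < n)%N.
Variable mu : {measure set (borelRn R n) -> \bar R}.
Hypothesis mu_cube : forall Q : dyadic n, (mu (cube Q) < +oo)%E.
Variables (p p' K : R) (w s : borelRn R n -> R).
Hypothesis dw : dual_weights mu p p' K w s.
Implicit Types (Q v : dyadic n) (F : seq (dyadic n)) (a b c e : dyadic n -> R) (U : R).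

Let p1 := dw_p dw.
Let p_gt0 : 0 < p. Proof. exact: lt_trans ltr01 p1. Qed.
Let w0 := dw_w dw.
Let mw := dw_mw dw.
Let fin_sum F a : finite_energy mu p w (haar_sum mu F a).
Proof. exact: (finite_energy_haar_sum dw). Qed.

Lemma energy_haar_sumD F a b : energy mu p w (haar_sum mu F (fun Q => a Q + b Q)) <=
  2 `^ p * (energy mu p w (haar_sum mu F a) + energy mu p w (haar_sum mu F b)).
Proof.
have [_] := finite_energyD p_gt0 w0 mw (fin_sum F a) (fin_sum F b).
apply: le_trans; rewrite le_eqVlt; apply/orP; left; apply/eqP; congr energy.
apply/funext => x; rewrite /haar_sum -big_split/=; apply: eq_bigr => Q _.
by rewrite mulrDl.
Qed.

Lemma admissible_sub c c' U U' : admissible mu p w c U -> admissible mu p w c' U' ->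
  admissible mu p w (fun Q => c Q - c' Q) (4 * (U + U')).
Proof.
move=> [U0 H] [U'0 H']; split; first by rewrite mulr_ge0// addr_ge0.
move=> F e d uF d0 ed.
rewrite (_ : (fun Q => _) = (fun Q => e Q * c Q + - e Q * c' Q)); last first.
  by apply/funext => Q; ring.
apply: le_trans (energy_haar_sumD _ _ _) _.
have h1 := H F e d uF d0 ed.
have h2 : energy mu p w (haar_sum mu F (fun Q => - e Q * c' Q)) <= (d * U') `^ p.
  by apply: (H' F (fun Q => - e Q)) => // Q QF; rewrite normrN ed.
apply: le_trans (ler_wpM2l (powR_ge0 _ _) (lerD h1 h2)) _.
have -> : d * (4 * (U + U')) = 4 * (d * U + d * U') by ring.
apply: sum_powR_le; [exact: ltW|exact: mulr_ge0|exact: mulr_ge0].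
Qed.

Lemma haar_sum_small F : exists C, 0 <= C /\ forall a r, 0 <= r ->
  (forall Q, Q \in F -> `|a Q| <= r) ->
  energy mu p w (haar_sum mu F a) <= r `^ p * C.
Proof.
elim: F => [|Q F [C [C0 IH]]].
  exists 0; split=> // a r r0 _; rewrite mulr0 (_ : haar_sum mu [::] a = fun=> 0).
    by rewrite energy_eq0.
  by apply/funext => x; rewrite /haar_sum big_nil.
have EQ : finite_energy mu p w (haar mu Q).
  by apply: finite_energy_haar => //; exact: dw_Iw dw.
have eQ0 : 0 <= energy mu p w (haar mu Q) by exact: energy_ge0.
exists (2 `^ p * (energy mu p w (haar mu Q) + C)); split.
  by rewrite mulr_ge0 ?powR_ge0// addr_ge0.
move=> a r r0 ar; have [EaQ EaQE] := finite_energyZ (a Q) EQ.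
rewrite (_ : haar_sum mu (Q :: F) a = fun x => a Q * haar mu Q x + haar_sum mu F a x).
  apply: le_trans (finite_energyD p_gt0 w0 mw EaQ (fin_sum F a)).2 _.
  rewrite [leRHS]mulrCA ler_wpM2l ?powR_ge0// EaQE mulrDr lerD//.
    rewrite ler_wpM2r// ge0_ler_powR ?(ltW p_gt0)// ?nnegrE// ar// mem_head//.
  by apply: IH => // Q' QF; rewrite ar// inE QF orbT.
by apply/funext => x; rewrite /haar_sum big_cons.
Qed.

Lemma haar_sum_small_le F r : 0 < r -> exists2 h, 0 < h &
  forall a, (forall Q, Q \in F -> `|a Q| <= h) -> energy mu p w (haar_sum mu F a) <= r.
Proof.
move=> r0; have [C [C0 H]] := haar_sum_small F.
have q0 : 0 < r / (1 + C) by rewrite divr_gt0// ltr_pwDl.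
exists ((r / (1 + C)) `^ p^-1); first by rewrite powR_gt0.
move=> a ah; apply: le_trans (H a _ (powR_ge0 _ _) ah) _.
rewrite -powRrM mulVf ?gt_eqF// powRr1 ?(ltW q0)//.
rewrite mulrAC -mulrA ger_pMr// ler_pdivrMr ?mul1r ?lerDr//.
by rewrite ltr_pwDl.
Qed.

(** On a finite family the multiplier sums depend continuously on the
    coefficients. The factor 2 is the price of the inequality
    [energy_haar_sumD], in which it appears to the power [p]. *)
Lemma admissible_closure c U : 0 <= U ->
  (forall F h, 0 < h -> exists2 c', admissible mu p w c' U &
     forall Q, Q \in F -> `|c' Q - c Q| <= h) ->
  admissible mu p w c (2 * U).
Proof.
move=> U0 H; split; first by rewrite mulr_ge0.
move=> F e d uF d0 ed; rewrite mulrCA powRM ?mulr_ge0//.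
apply/ler_addgt0Pr => r r0.
have t0 : 0 < (2 : R) `^ p by rewrite powR_gt0.
have [h h0 Hh] := haar_sum_small_le F (divr_gt0 r0 t0).
have d1 : 0 < d + 1 by rewrite ltr_wpDl.
have [c' [_ adm] c'c] := H F (h / (d + 1)) (divr_gt0 h0 d1).
rewrite (_ : (fun Q => e Q * c Q) = (fun Q => e Q * c' Q + e Q * (c Q - c' Q))); last first.
  by apply/funext => Q; ring.
apply: le_trans (energy_haar_sumD _ _ _) _.
rewrite -[X in _ <= _ + X](mulfVK (lt0r_neq0 t0)) [X in _ <= _ + X]mulrC -mulrDr.
rewrite ler_wpM2l ?(ltW t0)// lerD//; first exact: adm.
apply: Hh => Q QF; rewrite normrM distrC; have := ler_pM (normr_ge0 _) (normr_ge0 _) (ed Q QF) (c'c Q QF).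
move/le_trans; apply; rewrite mulrCA ger_pMr// ler_pdivrMr// mul1r; lra.
Qed.

(** Tychonoff's theorem replaces a diagonal extraction. *)
Lemma cluster_coefs (c : nat -> dyadic n -> R) (B : dyadic n -> R) :
  (forall k Q, `|c k Q| <= B Q) ->
  exists l : dyadic n -> R, forall F h (m : nat), 0 < h ->
    exists2 k, (m <= k)%N & forall Q, Q \in F -> `|c k Q - l Q| <= h.
Proof.
move=> cB.
have cpt := @tychonoff (dyadic n) (fun=> R) (fun Q => `[- B Q, B Q]%classic)
  (fun Q => @segment_compact R _ _).
have FP : ProperFilter (c k @[k --> \oo] : set_system (prod_topology (fun _ : dyadic n => R))).
  exact: fmap_proper_filter.
have [|l [_ cl]] := cpt (c k @[k --> \oo]) FP.
  by exists 0%N => // k _ Q; rewrite /= in_itv/= -ler_norml; exact: cB.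
exists l => F h m h0.
have nF : nbhs (l : prod_topology (fun _ : dyadic n => R)) [set f : dyadic n -> R |
    forall Q, Q \in F -> `|f Q - l Q| <= h].
  have FL : Filter (nbhs (l : prod_topology (fun _ : dyadic n => R))).
    exact: nbhs_filter.
  elim: F => [|Q F IH]; first by apply: filterS filterT => f _ Q.
  have nQ : nbhs (l : prod_topology (fun _ : dyadic n => R)) [set f : dyadic n -> R | `|f Q - l Q| <= h].
    have := @proj_continuous (dyadic n) (fun=> R) Q l [set t : R | `|t - l Q| <= h].
    apply; apply/nbhs_ballP; exists h => //= t.
    by rewrite -ball_normE /ball_/= distrC => /ltW.
  apply: filterS (filterI nQ IH) => f [fQ fF] Q'; rewrite inE => /orP[/eqP ->//|].
  exact: fF.
have mF : (c k @[k --> \oo]) [set f | exists2 k, (m <= k)%N & f = c k].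
  by exists m => // k /= mk; exists k.
have [f [[k mk ->] H]] := cl _ _ mF nF.
by exists k.
Unshelve. all: by end_near.
Qed.

Variable eps : dyadic n -> R.
Hypothesis eps_bounded : exists C : R, forall Q, `|eps Q| <= C.
Hypotheses (eps_large : vanishing_at_large_side (R := R) eps)
  (eps_small : vanishing_at_small_side (R := R) eps)
  (eps_far : vanishing_at_far_center eps).

Lemma small_level (d : R) : 0 < d ->
  exists k : nat, forall Q, Q.1 < - k%:Z -> `|eps Q| <= d.
Proof.
move=> d0; have [t t0 H] := eps_small d0.
exists (Num.truncn t^-1) => Q Qk; apply/ltW/H; rewrite /side.
set k := Num.truncn _ in Qk.
have tk : (k.+1%:R : R)^-1 < t.
  by rewrite -[ltRHS]invrK ltf_pV2 ?posrE ?invr_gt0//; exact: truncnS_gt.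
apply: le_lt_trans tk; apply: (@le_trans _ _ ((2 : R) ^ (- k.+1%:Z))).
  by rewrite ler_eXz2l ?ltr1n//; exact: lt_opp_le.
rewrite -invr_expz lef_pV2 ?posrE ?exprz_gt0//; exact: ltW (exp2_gt _).
Qed.

(** What a partial sum leaves out is the limit operator of another multiplier, of
    size at most [r], and obeys the bound of [energy_haar_lim_le]. *)
Lemma energy_haar_lim_split c U M r : 0 <= r -> admissible mu p w c U ->
  (forall Q, (0 < mu (cube Q))%E -> ~ fam mu M Q -> `|eps Q| <= r) ->
  energy mu p w (haar_lim mu (fun Q => eps Q * c Q)) <=
  2 `^ p * (energy mu p w (haar_sum mu (fam_seq mu M) (fun Q => eps Q * c Q)) + (r * U) `^ p).
Proof.
move=> r0 adm Hr.
pose e Q := if (Q \in fam_seq mu M) || ~~ (0 < mu (cube Q))%E then 0 else eps Q.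
have er Q : `|e Q| <= r.
  rewrite /e; case: ifPn; first by rewrite normr0.
  rewrite negb_or negbK => /andP[QM mQ]; apply: Hr => // /(mem_fam_seq n_gt0 mu).
  by rewrite (negPf QM).
have e_small (d : R) : 0 < d -> exists k : nat, forall Q, Q.1 < - k%:Z -> `|e Q| <= d.
  move=> d0; have [k Hk] := small_level d0; exists k => Q /Hk; rewrite /e.
  by case: ifP => // _ _; rewrite normr0 ltW.
have [E1 E2] := energy_haar_lim_le n_gt0 mu_cube dw adm r0 er e_small.
have [F1 F2] := finite_energyD p_gt0 w0 mw (fin_sum (fam_seq mu M) (fun Q => eps Q * c Q)) E1.
have cae := converges_ae n_gt0 mu_cube dw adm er e_small.
apply: (@energy_lim _ _ _ mu p w p_gt0 w0 mw (fun=> fun x =>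
    haar_sum mu (fam_seq mu M) (fun Q => eps Q * c Q) x +
    haar_lim mu (fun Q => e Q * c Q) x) _ _ _ _ _ _).2 => //.
- exact: measurable_haar_lim.
- by move=> _; apply: le_trans F2 _; rewrite ler_wpM2l ?powR_ge0// lerD2l.
apply: (negligibleS _ cae) => x; apply: contra_not => cx.
suff E : haar_lim mu (fun Q => eps Q * c Q) x =
    haar_sum mu (fam_seq mu M) (fun Q => eps Q * c Q) x + haar_lim mu (fun Q => e Q * c Q) x.
  by rewrite /= E; exact: cvg_cst.
apply: cvg_lim => //.
apply: (@cvg_trans _ ((haar_sum mu (fam_seq mu M) (fun Q => eps Q * c Q) x +
    haar_sum mu (fam_seq mu M') (fun Q => e Q * c Q) x) @[M' --> +oo])); last first.
  by apply: cvgD; [exact: cvg_cst|exact: cx].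
apply: near_eq_cvg; near=> M'.
have MM' : M <= M' by near: M'; apply: nbhs_pinfty_ge; rewrite num_real.
have -> : haar_sum mu (fam_seq mu M) (fun Q => eps Q * c Q) x =
    \sum_(Q <- fam_seq mu M') (if Q \in fam_seq mu M then eps Q * c Q * haar mu Q x else 0).
  rewrite /haar_sum -big_mkcond -big_filter; apply: perm_big; apply: uniq_perm.
  - exact: fam_seq_uniq.
  - by rewrite filter_uniq// fam_seq_uniq.
  move=> Q; rewrite mem_filter; apply/idP/andP => [QM|[]//]; split=> //.
  by apply/(mem_fam_seq n_gt0 mu); apply: fam_mono MM' _ _; apply/(mem_fam_seq n_gt0 mu).
rewrite /haar_sum -big_split/= big_seq [RHS]big_seq; apply: eq_bigr => Q QM'.
have [mQ _ _] := (mem_fam_seq n_gt0 mu M' Q).1 QM'.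
by rewrite /e mQ orbF; case: ifP => _; rewrite ?mul0r ?addr0 ?add0r.
Unshelve. all: by end_near.
Qed.

(** Up to a small error the image of [c k - l] is controlled by its coefficients
    on finitely many cubes, and at a cluster point these are small infinitely
    often. *)
Lemma haar_lim_cluster (c : nat -> dyadic n -> R) (B : dyadic n -> R) U :
  (forall k, admissible mu p w (c k) U) -> (forall k Q, `|c k Q| <= B Q) ->
  exists2 l, admissible mu p w l (2 * U) & forall r (m : nat), 0 < r -> exists2 k, (m <= k)%N &
    energy mu p w (haar_lim mu (fun Q => eps Q * (c k Q - l Q))) <= r.
Proof.
move=> adm cB; have [l Hl] := cluster_coefs cB.
have U0 : 0 <= U by case: (adm 0%N).
have adml : admissible mu p w l (2 * U).
  apply: admissible_closure => // F h h0; have [k _ Hk] := Hl F h 0%N h0.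
  by exists (c k).
exists l => // r m r0.
pose U' := 4 * (U + 2 * U); have U'0 : 0 <= U' by rewrite mulr_ge0// addr_ge0// mulr_ge0.
have t0 : 0 < (2 : R) `^ p by rewrite powR_gt0.
pose r' := r / 2 `^ p / 2; have r'0 : 0 < r' by rewrite !divr_gt0.
(* The remainder has multiplier at most [d], and the differences [c k - l] are
   admissible with constant [U']. *)
pose d := r' `^ p^-1 / (U' + 1).
have d0 : 0 < d by rewrite divr_gt0 ?powR_gt0// ltr_wpDl.
have dU : (d * U') `^ p <= r'.
  have -> : r' = (r' `^ p^-1) `^ p by rewrite -powRrM mulVf ?gt_eqF// powRr1// ltW.
  apply: ge0_ler_powR; rewrite ?nnegrE.
  - exact: ltW.
  - by apply: mulr_ge0 => //; exact: ltW.
  - exact: powR_ge0.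
  rewrite /d mulrAC ler_pdivrMr; last by rewrite ltr_wpDl.
  by rewrite ler_wpM2l ?powR_ge0// lerDl.
have [M HM] := small_outside_fam n_gt0 mu d0 eps_large eps_small eps_far.
have [h h0 Hh] := haar_sum_small_le (fam_seq mu M) r'0.
have [C HC] := eps_bounded.
have C1 : 0 < `|C| + 1 by rewrite ltr_wpDl.
have [k mk Hk] := Hl (fam_seq mu M) (h / (`|C| + 1)) m (divr_gt0 h0 C1).
exists k => //.
have := energy_haar_lim_split (ltW d0) (admissible_sub (adm k) adml)
  (fun Q mQ nQ => ltW (HM M Q (lexx M) mQ nQ)).
move/le_trans; apply.
have -> : r = 2 `^ p * (r' + r') by rewrite /r'; field; rewrite gt_eqF.
rewrite ler_wpM2l ?(ltW t0)// lerD//.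
apply: Hh => Q QM; rewrite normrM.
have := ler_pM (normr_ge0 _) (normr_ge0 _) (HC Q) (Hk Q QM); move/le_trans; apply.
rewrite mulrCA ger_pMr// ler_pdivrMr// mul1r; have := ler_norm C; lra.
Qed.

End Compactness.

(** * The weighted space *)

Section WeightedMeasure.
Context {R : realType} {n : nat}.
Variable mu : {measure set (borelRn R n) -> \bar R}.
Variable w : {mfun borelRn R n >-> R}.
Implicit Types f : borelRn R n -> R.

Import HBNNSimple.

Let w_pos_meas : measurable_fun setT (fun x => (w^\+ x)%:E).
Proof. by apply/measurable_EFinP; exact: measurable_funrpos. Qed.

Lemma integral_weighted f : measurable_fun setT f -> (forall x, 0 <= f x) ->
  (\int[weighted mu w]_x (f x)%:E = \int[mu]_x (f x * w^\+ x)%:E)%E.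
Proof.
move=> mf f0; have mEf : measurable_fun setT (EFin \o f) by exact/measurable_EFinP.
pose h := nnsfun_approx measurableT mEf.
have hf x : (h k x)%:E @[k --> \oo] --> (f x)%:E.
  by apply: (cvg_nnsfun_approx measurableT mEf) => //= y _; rewrite lee_fin.
have h_mono x : {homo (fun k => h k x) : k l / (k <= l)%N >-> k <= l}.
  by move=> k l kl; exact/lefP/nd_nnsfun_approx.
have mh k : measurable_fun setT (fun x => (h k x * w^\+ x)%:E).
  apply/measurable_EFinP; apply: measurable_funM => //; exact: measurable_funrpos.
have -> : (\int[weighted mu w]_x (f x)%:E = limn (fun k => \int[weighted mu w]_x (h k x)%:E))%E.
  rewrite -monotone_convergence//.
  - by apply: eq_integral => x _; apply/esym/cvg_lim => //.
  - by move=> k; apply/measurable_EFinP.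
  - by move=> k x _; rewrite lee_fin.
  - by move=> x _ k l kl; rewrite lee_fin h_mono.
have -> : (\int[mu]_x (f x * w^\+ x)%:E = limn (fun k => \int[mu]_x (h k x * w^\+ x)%:E))%E.
  rewrite -monotone_convergence//.
  - apply: eq_integral => x _; apply/esym/cvg_lim => //.
    under eq_fun do rewrite EFinM; rewrite EFinM.
    by apply: cvgeZr.
  - by move=> k x _; rewrite lee_fin mulr_ge0// funrpos_ge0.
  - by move=> x _ k l kl; rewrite lee_fin ler_wpM2r ?funrpos_ge0// h_mono.
congr (limn _); apply/funext => k; set g := h k.
rewrite integralT_nnsfun sintegralE.
transitivity (\int[mu]_x \sum_(y \in range g)
   (y * \1_(g @^-1` [set y]) x * w^\+ x)%:E)%E; last first.
  apply: eq_integral => x _; rewrite fsumEFin//; congr EFin.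
  by rewrite -mulr_fsuml -fimfunE.
have g0 y x : 0 <= y * \1_(g @^-1` [set y]) x * w^\+ x.
  by rewrite mulr_ge0 ?funrpos_ge0// -lee_fin nnfun_muleindic_ge0.
have mg y : measurable_fun setT (fun x => (y * \1_(g @^-1` [set y]) x * w^\+ x)%:E).
  apply/measurable_EFinP; apply: measurable_funM; last exact: measurable_funrpos.
  by apply: measurable_funM.
rewrite ge0_integral_fsum//; last by move=> y x _; rewrite lee_fin g0.
apply: eq_fsbigr => y; rewrite inE => -[t _ <-].
under eq_integral do rewrite -mulrA EFinM.
rewrite ge0_integralZl//.
- congr (_ * _)%E; rewrite -[LHS]/(\int[mu]_(x in g @^-1` [set g t]) (w^\+ x)%:E)%E.
  rewrite [LHS]integral_mkcond; apply: eq_integral => x _.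
  by rewrite epatch_indic /= EFinM muleC.
- apply/measurable_EFinP; apply: measurable_funM => //; exact: measurable_funrpos.
- by move=> x _; rewrite lee_fin mulr_ge0// funrpos_ge0.
- by rewrite lee_fin.
Qed.

Variables (p : R) (w1 : borelRn R n -> R).
Hypotheses (p0 : 0 < p) (w1_gt0 : forall x, 0 < w1 x) (w1_meas : measurable_fun setT w1).
Hypothesis w1E : {ae mu, forall x, w^\+ x = w1 x}.

Lemma Lnorm_weighted f : measurable_fun setT f ->
  Lnorm (weighted mu w) p%:E (EFin \o f) =
  ((\int[mu]_x (`|f x| `^ p * w1 x)%:E) `^ p^-1)%E.
Proof.
move=> mf; rewrite unlock; congr (_ `^ _)%E.
rewrite (eq_integral (fun x => (`|f x| `^ p)%:E))//.
rewrite integral_weighted//; last first.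
  apply: (@measurableT_comp _ _ _ _ _ _ (@powR R ^~ p) _ (fun x => `|f x|)).
    exact: measurable_powR.
  exact: measurableT_comp.
apply: ge0_ae_eq_integral => //.
- apply/measurable_EFinP; apply: measurable_density => //; exact: measurable_funrpos.
- by apply/measurable_EFinP; exact: measurable_density.
- by move=> x _; rewrite lee_fin mulr_ge0 ?powR_ge0// funrpos_ge0.
- by move=> x _; rewrite lee_fin mulr_ge0 ?powR_ge0// ltW.
- by apply: (negligibleS _ w1E) => x /=; apply: contra_not => /= -> .
Qed.

Lemma Lfun_finite_energy f :
  f \in Lfun (weighted mu w) p%:E <-> finite_energy mu p w1 f.
Proof.
have I0 : (0 <= \int[mu]_x (`|f x| `^ p * w1 x)%:E)%E.
  by apply: integral_ge0 => x _; rewrite lee_fin mulr_ge0 ?powR_ge0// ltW.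
split => [|[mf If]].
  rewrite inE => /andP[]; rewrite !inE /= => mf; rewrite /finite_norm Lnorm_weighted// => fin.
  split=> //; apply/integrableP; split.
    by apply/measurable_EFinP; exact: measurable_density.
  rewrite (eq_integral (fun x => (`|f x| `^ p * w1 x)%:E)); last first.
    by move=> x _ /=; rewrite ger0_norm// mulr_ge0 ?powR_ge0// ltW.
  by apply: lty_poweRy fin; rewrite invr_neq0// gt_eqF.
rewrite inE; apply/andP; split; rewrite inE//= /finite_norm Lnorm_weighted//.
by rewrite -[X in (X `^ _)%E]fineK ?integrable_fin_num// poweR_EFin ltry.
Qed.

Lemma Lnorm_energy f : finite_energy mu p w1 f ->
  Lnorm (weighted mu w) p%:E (EFin \o f) = (energy mu p w1 f `^ p^-1)%:E.
Proof.
move=> [mf If]; rewrite Lnorm_weighted//.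
by rewrite -[X in (X `^ _)%E]fineK ?integrable_fin_num// poweR_EFin.
Qed.

Lemma weighted_negligible (A : set (borelRn R n)) :
  mu.-negligible A -> (weighted mu w).-negligible A.
Proof.
move=> [N [mN N0 AN]]; exists N; split=> //.
by rewrite /weighted null_set_integral//; exact: measurable_funTS.
Qed.

End WeightedMeasure.

Section ApDual.
Context {R : realType} {n : nat}.
Variable mu : {measure set (borelRn R n) -> \bar R}.
Hypothesis mu_radon : radon mu.
Implicit Types (Q : dyadic n).

Lemma radon_cube Q : (mu (cube Q) < +oo)%E.
Proof.
have [H _ _] := mu_radon; have [A cA QA] := @cube_bounded R n Q.
apply: le_lt_trans (H A cA); apply: le_measure; rewrite ?inE//.
- exact: cube_measurable.
- exact: compact_borel.
Qed.

Variables (p p' : R).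
Hypotheses (p1 : 1 < p) (pp' : p^-1 + p'^-1 = 1).

Lemma conj_gt1 : 1 < p'.
Proof.
have p0 : 0 < p := lt_trans ltr01 p1.
have ip : p^-1 < 1 by rewrite invf_lt1.
have ip0 : 0 < p^-1 by rewrite invr_gt0.
have iE : p'^-1 = 1 - p^-1 by rewrite -pp' addrC addKr.
have i'0 : 0 < p'^-1 by rewrite iE subr_gt0.
have i'1 : p'^-1 < 1 by rewrite iE gtrBl.
by rewrite -[p']invrK -[ltLHS]invr1 ltf_pV2 ?posrE.
Qed.

Lemma conj_mul : (p - 1) * (p' - 1) = 1.
Proof.
have p0 : p != 0 by rewrite gt_eqF// (lt_trans ltr01 p1).
have p'0 : p' != 0 by rewrite gt_eqF// (lt_trans ltr01 conj_gt1).
have : (p^-1 + p'^-1) * (p * p') = p * p' by rewrite pp' mul1r.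
have -> : (p^-1 + p'^-1) * (p * p') = p' + p by field; rewrite p0 p'0.
lra.
Qed.

Variable w : {mfun borelRn R n >-> R}.
Hypothesis w_Ap : Ap_weight mu p p' w.

(** A weight is positive almost everywhere; changing it on a null set makes it
    positive everywhere. *)
Definition positive_version (x : borelRn R n) : R := if 0 < w x then w x else 1.

Definition dual_weight (x : borelRn R n) : R := positive_version x `^ (1 - p').

Lemma positive_version_gt0 x : 0 < positive_version x.
Proof. by rewrite /positive_version; case: ifP. Qed.

Lemma dual_weight_gt0 x : 0 < dual_weight x.
Proof. by rewrite powR_gt0// positive_version_gt0. Qed.

Lemma measurable_positive_version : measurable_fun setT positive_version.
Proof.
apply: measurable_fun_ifT => //; exact: measurable_fun_ltr.
Qed.

Lemma measurable_dual_weight : measurable_fun setT dual_weight.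
Proof.
apply: (@measurableT_comp _ _ _ _ _ _ (@powR R ^~ (1 - p')) _ positive_version).
  exact: measurable_powR.
exact: measurable_positive_version.
Qed.

Lemma positive_version_ae : {ae mu, forall x, w x = positive_version x}.
Proof.
have [wp _ _] := w_Ap; apply: (negligibleS _ wp) => x; apply: contra_not => /= wx.
by rewrite /positive_version wx.
Qed.

Lemma funrpos_ae : {ae mu, forall x, w^\+ x = positive_version x}.
Proof.
have [wp _ _] := w_Ap; apply: (negligibleS _ wp) => x; apply: contra_not => /= wx.
by rewrite /positive_version wx /funrpos; apply/max_idPl; exact: ltW.
Qed.

Lemma integrable_positive_version : integrable_on_cubes mu positive_version.
Proof.
move=> Q; have mQ := @cube_measurable R n Q; have [_ [mw lw] _] := w_Ap.
have m1 := measurable_positive_version.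
apply/integrableP; split; first by apply/measurable_EFinP; exact: measurable_funTS.
have [A cA QA] := @cube_bounded R n Q.
apply: le_lt_trans (lw A cA).
have mnw : measurable_fun setT (fun x => (`|w x|)%:E).
  by apply/measurable_EFinP; exact: measurableT_comp.
apply: (@le_trans _ _ (\int[mu]_(x in cube Q) `|w x|%:E)%E).
  rewrite le_eqVlt; apply/orP; left; apply/eqP.
  apply: ge0_ae_eq_integral => //.
  - apply/measurable_EFinP; apply: measurable_funTS; exact: measurableT_comp.
  - exact: measurable_funTS.
  - by apply: (negligibleS _ positive_version_ae) => x /=; apply: contra_not => /= ->.
apply: ge0_subset_integral => //; first exact: compact_borel.
exact: measurable_funTS.
Qed.

Lemma cube_hcube Q : cube Q = hcube (\row_i (side Q * (Q.2 i)%:~R)) (side (R := R) Q).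
Proof.
rewrite /cube /hcube; apply/seteqP; split=> x H i; have := H i;
  by rewrite mxE intrD mulrDr mulr1.
Qed.

Definition Ap_const : R := fine (Ap_constant mu p p' w).

Lemma Ap_le Q : vol mu Q != 0 -> (((vol mu Q)^-1 * mass mu positive_version Q)%:E *
  ((vol mu Q)^-1%:E * \int[mu]_(x in cube Q) (dual_weight x)%:E) `^ (p - 1)
  <= Ap_const%:E)%E.
Proof.
move=> vQ; have mQ := @cube_measurable R n Q; have [_ [mw _] Ap] := w_Ap.
have muQ : (0 < mu (cube Q))%E.
  by rewrite lt0e measure_ge0 andbT; apply: contra_neq vQ; rewrite /vol => ->.
have IE : (average mu (fun x => (w x `^ (1 - p'))%:E) (cube Q) =
    (vol mu Q)^-1%:E * \int[mu]_(x in cube Q) (dual_weight x)%:E)%E.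
  rewrite /average /vol; congr (_ * _)%E; apply: ge0_ae_eq_integral => //.
  - apply/measurable_EFinP; apply: measurable_funTS.
    apply: (@measurableT_comp _ _ _ _ _ _ (@powR R ^~ (1 - p')) _ w).
      exact: measurable_powR.
    exact: mw.
  - by apply/measurable_EFinP; apply: measurable_funTS; exact: measurable_dual_weight.
  - by move=> x _; rewrite lee_fin powR_ge0.
  - by move=> x _; rewrite lee_fin powR_ge0.
  - by apply: (negligibleS _ positive_version_ae) => x /=; apply: contra_not;
      rewrite /dual_weight => ->.
have WE : average mu (EFin \o w) (cube Q) = ((vol mu Q)^-1 * mass mu positive_version Q)%:E.
  rewrite /average EFinM /vol /mass /Rintegral fineK; last first.
    exact: integrable_fin_num (integrable_positive_version Q).
  congr (_ * _)%E; apply: ae_eq_integral => //.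
  - by apply/measurable_EFinP; exact: measurable_funTS.
  - by apply/measurable_EFinP; apply: measurable_funTS; exact: measurable_positive_version.
  - by apply: (negligibleS _ positive_version_ae) => x /=; apply: contra_not => /= ->.
rewrite -IE -WE; set z := (_ * _)%E.
have zA : (z <= Ap_constant mu p p' w)%E.
  apply: ereal_sup_ubound; exists (cube Q) => //; split=> //.
  by exists (\row_i (side Q * (Q.2 i)%:~R)), (side Q); rewrite cube_hcube side_gt0.
have z0 : (0 <= z)%E.
  rewrite /z mule_ge0 ?poweR_ge0// WE lee_fin mulr_ge0 ?invr_ge0 ?vol_ge0//.
  by apply: mass_ge0 => x; exact: ltW (positive_version_gt0 x).
rewrite /Ap_const fineK// ge0_fin_numE//; exact: le_trans z0 zA.
Qed.

Let mu_cube := radon_cube.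

Lemma mass_positive_version_gt0 Q : vol mu Q != 0 -> 0 < mass mu positive_version Q.
Proof.
move=> vQ; apply: Rintegral_gt0; first exact: cube_measurable.
- exact: integrable_positive_version.
- exact: positive_version_gt0.
- by apply: contra_neq vQ; rewrite /vol => ->.
Qed.

(** If the integral of the dual weight over a cube were infinite, so would be the
    [A_p] quotient of the cube. *)
Lemma integrable_dual_weight : integrable_on_cubes mu dual_weight.
Proof.
move=> Q; have mQ := @cube_measurable R n Q.
have ms : measurable_fun (cube Q : set (borelRn R n)) (fun x => (dual_weight x)%:E).
  by apply/measurable_EFinP; apply: measurable_funTS; exact: measurable_dual_weight.
apply/integrableP; split => //.
rewrite (eq_integral (fun x => (dual_weight x)%:E)); last first.
  by move=> x _ /=; rewrite ger0_norm// ltW// dual_weight_gt0.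
have [vQ|vQ] := eqVneq (vol mu Q) 0.
  by rewrite null_set_integral// volE// vQ.
have := Ap_le vQ; have := mass_positive_version_gt0 vQ => W0.
have v0 : 0 < (vol mu Q)^-1 by rewrite invr_gt0 lt0r vQ vol_ge0.
rewrite ltey; apply: contraTneq => ->.
rewrite gt0_muley ?lte_fin// poweRyr ?subr_eq0 ?gt_eqF//.
by rewrite gt0_muley// lte_fin mulr_gt0.
Qed.

Lemma mass_dual_weight_gt0 Q : vol mu Q != 0 -> 0 < mass mu dual_weight Q.
Proof.
move=> vQ; apply: Rintegral_gt0; first exact: cube_measurable.
- exact: integrable_dual_weight.
- exact: dual_weight_gt0.
- by apply: contra_neq vQ; rewrite /vol => ->.
Qed.

Lemma Ap_real Q : vol mu Q != 0 ->
  mass mu positive_version Q / vol mu Q * (mass mu dual_weight Q / vol mu Q) `^ (p - 1)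
  <= Ap_const.
Proof.
move=> vQ; have := Ap_le vQ.
have -> : (\int[mu]_(x in cube Q) (dual_weight x)%:E)%E = (mass mu dual_weight Q)%:E.
  rewrite /mass /Rintegral fineK//.
  by apply: integrable_fin_num (integrable_dual_weight Q); exact: cube_measurable.
by rewrite -[X in (_ * X `^ _)%E]EFinM poweR_EFin -EFinM lee_fin ![_^-1 * _]mulrC.
Qed.

Lemma persp_scale (q m t : R) : 0 < m -> 0 < t -> persp q m (m * t) = m * t `^ (1 - q).
Proof.
move=> m0 t0; rewrite /persp powRM ?ltW// mulrA -powRD ?(gt_eqF m0) ?implybT//.
by rewrite addrC subrK powRr1// ltW.
Qed.

(** Raising the [A_p] inequality to the power [p' - 1 = 1 / (p - 1)] exchanges
    the weight and its dual. *)
Lemma Ap_dual_weights :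
  dual_weights mu p p' (`|Ap_const| + `|Ap_const| `^ (p' - 1)) positive_version dual_weight.
Proof.
have p'1 := conj_gt1; set A := `|Ap_const|.
have A0 : 0 <= A by exact: normr_ge0.
have Ap0 : 0 <= A `^ (p' - 1) by exact: powR_ge0.
have main Q : vol mu Q != 0 -> exists m u t,
    [/\ vol mu Q = m, mass mu positive_version Q = m * u, mass mu dual_weight Q = m * t,
        [/\ 0 < m, 0 < u & 0 < t] & u * t `^ (p - 1) <= A].
  move=> vQ; have v0 : 0 < vol mu Q by rewrite lt0r vQ vol_ge0.
  exists (vol mu Q), (mass mu positive_version Q / vol mu Q), (mass mu dual_weight Q / vol mu Q).
  split => //; try by rewrite [RHS]mulrC divfK.
  - split=> //; apply: divr_gt0 => //.
      exact: mass_positive_version_gt0.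
    exact: mass_dual_weight_gt0.
  - by apply: le_trans (Ap_real vQ) _; exact: ler_norm.
split=> //.
- exact: addr_ge0.
- exact: positive_version_gt0.
- exact: dual_weight_gt0.
- exact: measurable_positive_version.
- exact: measurable_dual_weight.
- exact: integrable_positive_version.
- exact: integrable_dual_weight.
- move=> x; rewrite /dual_weight -powRrM.
  have -> : (1 - p') * (1 - p) = (p - 1) * (p' - 1) by ring.
  by rewrite conj_mul powRr1// ltW// positive_version_gt0.
- move=> Q; have [vQ|vQ] := eqVneq (vol mu Q) 0.
    rewrite (mass_null mu_cube integrable_positive_version vQ).
    by apply: mulr_ge0; [exact: addr_ge0|exact: persp_ge0].
  have [m [u [t [-> -> -> [m0 u0 t0] H]]]] := main Q vQ.
  rewrite persp_scale// mulrCA ler_pM2l//.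
  apply: (@le_trans _ _ (A * t `^ (1 - p))); last first.
    by rewrite ler_wpM2r ?powR_ge0// lerDl.
  by rewrite -opprB powRN -ler_pdivrMr ?invr_gt0 ?powR_gt0// invrK.
- move=> Q; have [vQ|vQ] := eqVneq (vol mu Q) 0.
    rewrite (mass_null mu_cube integrable_dual_weight vQ).
    by apply: mulr_ge0; [exact: addr_ge0|exact: persp_ge0].
  have [m [u [t [-> -> -> [m0 u0 t0] H]]]] := main Q vQ.
  rewrite persp_scale// mulrCA ler_pM2l//.
  apply: (@le_trans _ _ (A `^ (p' - 1) * u `^ (1 - p'))); last first.
    by rewrite ler_wpM2r ?powR_ge0// lerDr.
  have tE : t = (t `^ (p - 1)) `^ (p' - 1) by rewrite -powRrM conj_mul powRr1// ltW.
  have -> : 1 - p' = - (p' - 1) by rewrite opprB.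
  rewrite powRN -ler_pdivrMr ?invr_gt0 ?powR_gt0// invrK {1}tE -powRM ?powR_ge0 ?(ltW u0)//.
  apply: ge0_ler_powR; rewrite ?nnegrE ?mulr_ge0 ?powR_ge0 ?(ltW u0) ?subr_ge0 ?(ltW p'1)//.
  by rewrite mulrC.
Qed.

End ApDual.

Section MultiplierCompactness.
Context {R : realType} {n : nat}.
Hypothesis n_gt0 : (0 < n)%N.
Variable mu : {measure set (borelRn R n) -> \bar R}.
Hypothesis mu_cube : forall Q : dyadic n, (mu (cube Q) < +oo)%E.
Variables (p p' K : R) (w s : borelRn R n -> R).
Hypothesis dw : dual_weights mu p p' K w s.
Variable eps : dyadic n -> R.
Hypothesis eps_bounded : exists C : R, forall Q, `|eps Q| <= C.
Hypotheses (eps_large : vanishing_at_large_side (R := R) eps)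
  (eps_small : vanishing_at_small_side (R := R) eps)
  (eps_far : vanishing_at_far_center eps).
Implicit Types (f g u : borelRn R n -> R) (Q : dyadic n).

Let p_gt0 : 0 < p. Proof. exact: lt_trans ltr01 (dw_p dw). Qed.

Lemma haar_multiplierE f : haar_multiplier mu eps f =
  haar_lim mu (fun Q => eps Q * inner mu f (haar mu Q)).
Proof.
apply/funext => x; rewrite /haar_multiplier /haar_lim.
rewrite (_ : (fun M => haar_partial_sum mu eps M f x) =
  (fun M => haar_sum mu (fam_seq mu M) (fun Q => eps Q * inner mu f (haar mu Q)) x))//.
by apply/funext => M; rewrite haar_partial_sumE.
Qed.

Lemma multiplier_converges_ae c U : admissible mu p w c U ->
  {ae mu, forall x, converges mu (fun Q => eps Q * c Q) x}.
Proof.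
move=> adm; have [C HC] := eps_bounded.
exact: (converges_ae n_gt0 mu_cube dw adm HC (small_level eps_small)).
Qed.

Lemma finite_energy_multiplier c U : admissible mu p w c U ->
  finite_energy mu p w (haar_lim mu (fun Q => eps Q * c Q)).
Proof.
move=> adm; have [C HC] := eps_bounded.
have C0 : 0 <= C by apply: le_trans (HC (0, [ffun=> 0])).
exact: (energy_haar_lim_le n_gt0 mu_cube dw adm C0 HC (small_level eps_small)).1.
Qed.

Lemma admissible_le c U U' : U <= U' -> admissible mu p w c U -> admissible mu p w c U'.
Proof.
move=> UU' [U0 H]; have U'0 := le_trans U0 UU'; split=> // F e d uF d0 ed.
apply: le_trans (H F e d uF d0 ed) _; apply: ge0_ler_powR; rewrite ?nnegrE.
- exact: ltW.
- exact: mulr_ge0.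
- exact: mulr_ge0.
- exact: ler_wpM2l.
Qed.

Lemma inner_bounded C : 0 <= C -> exists B : dyadic n -> R, forall u Q,
  finite_energy mu p w u -> energy mu p w u <= C `^ p -> `|inner mu u (haar mu Q)| <= B Q.
Proof.
move=> C0; pose b Q := C * dual_size mu p s Q / vol mu Q.
exists (fun Q => Num.sqrt (vol mu Q) * (b Q + b (parent Q))) => u Q Eu uC.
have Iu := finite_energy_integrable_on_cubes dw Eu.
have avg_le v : `|avg (vol mu) (mass mu u) v| <= b v.
  rewrite /avg normrM [X in _ * X]ger0_norm ?invr_ge0 ?vol_ge0//.
  rewrite ler_wpM2r ?invr_ge0 ?vol_ge0//.
  apply: le_trans (mass_norm_le mu_cube dw v C0 Eu uC).
  by apply: le_normr_Rintegral; [exact: cube_measurable|exact: Iu].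
rewrite inner_haar// normrM [X in X * _]ger0_norm ?sqrtr_ge0// ler_wpM2l ?sqrtr_ge0//.
by apply: le_trans (ler_normB _ _) _; exact: lerD.
Qed.

(** The limit is the image of a family of coefficients, the cluster point of the
    coefficients of the functions, and not that of a weak limit of the functions
    themselves. *)
Lemma multiplier_compact (u : nat -> borelRn R n -> R) C : 0 <= C ->
  (forall k, finite_energy mu p w (u k)) -> (forall k, energy mu p w (u k) <= C `^ p) ->
  exists (phi : nat -> nat) g, [/\ {homo phi : i j / (i < j)%N}, finite_energy mu p w g &
    forall i, let h := haar_multiplier mu eps (u (phi i)) \- g in
      finite_energy mu p w h /\ energy mu p w h <= i.+1%:R^-1].
Proof.
move=> C0 Eu uC; pose c k Q := inner mu (u k) (haar mu Q).
pose U := norm_const p p' K * C.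
have adm k : admissible mu p w (c k) U.
  apply: admissible_le (admissible_inner mu_cube dw (Eu k)).
  rewrite ler_wpM2l ?(ltW (norm_const_gt0 dw))//.
  have -> : C = (C `^ p) `^ p^-1 by rewrite -powRrM divff ?gt_eqF// powRr1.
  rewrite ge0_ler_powR ?invr_ge0 ?(ltW p_gt0)// ?nnegrE ?powR_ge0//.
  by apply: energy_ge0; exact: dw_w dw.
have [B HB] := inner_bounded C0.
have cB k Q : `|c k Q| <= B Q by exact: HB.
have [l adml Hl] := haar_lim_cluster n_gt0 mu_cube dw eps_bounded eps_large eps_small
  eps_far adm cB.
have next (i m : nat) : {k | (m <= k)%N &
    energy mu p w (haar_lim mu (fun Q => eps Q * (c k Q - l Q))) <= i.+1%:R^-1}.
  by apply: cid2; apply: Hl; rewrite invr_gt0.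
pose phi := fix phi (i : nat) : nat := if i is j.+1 then s2val (next i (phi j).+1)
  else s2val (next 0%N 0%N).
exists phi, (haar_lim mu (fun Q => eps Q * l Q)); split.
- apply: homo_ltn => [a b d|i]; first exact: ltn_trans.
  exact: (s2valP (next i.+1 (phi i).+1)).
- exact: finite_energy_multiplier adml.
move=> i h.
have Ei : energy mu p w (haar_lim mu (fun Q => eps Q * (c (phi i) Q - l Q))) <= i.+1%:R^-1.
  by case: i {h} => [|i] /=; exact: (s2valP' (next _ _)).
have adms := admissible_sub dw (adm (phi i)) adml.
apply: (@energy_lim _ _ _ mu p w p_gt0 (dw_w dw) (dw_mw dw)
  (fun=> haar_lim mu (fun Q => eps Q * (c (phi i) Q - l Q)))) => //.
- apply: measurable_funB; last exact: measurable_haar_lim.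
  by rewrite haar_multiplierE; exact: measurable_haar_lim.
- by move=> _; exact: finite_energy_multiplier adms.
apply: (negligibleS _ (negligibleU (multiplier_converges_ae adml)
   (multiplier_converges_ae adms))) => x nx.
apply: contrapT => nN; apply: nx.
have cl : converges mu (fun Q => eps Q * l Q) x by apply: contrapT => h1; apply: nN; left.
have cd : converges mu (fun Q => eps Q * (c (phi i) Q - l Q)) x.
  by apply: contrapT => h1; apply: nN; right.
suff E : haar_lim mu (fun Q => eps Q * (c (phi i) Q - l Q)) x = h x.
  by rewrite /= E; exact: cvg_cst.
apply/esym.
rewrite /h /= haar_multiplierE.
have -> : (fun Q => eps Q * inner mu (u (phi i)) (haar mu Q)) =
    (fun Q => 1 * (eps Q * (c (phi i) Q - l Q)) + eps Q * l Q).
  by apply/funext => Q; rewrite /c; ring.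
by rewrite haar_lim_linear// mul1r addrK.
Qed.

End MultiplierCompactness.


Theorem theorem1p4 (R : realType) (n : nat) (hn : (0 < n)%N)
  (mu : {measure set (borelRn R n) -> \bar R}) (hmu : radon mu)
  (eps : dyadic n -> R)
  (eps_bounded : exists C : R, forall Q, `|eps Q| <= C)
  (eps_large : vanishing_at_large_side eps)
  (eps_small : vanishing_at_small_side eps)
  (eps_far : vanishing_at_far_center eps)
  (p p' : R) (hp : 1 < p) (hpp' : p^-1 + p'^-1 = 1)
  (w : {mfun borelRn R n >-> R}) (hw : Ap_weight mu p p' w) :
  (forall f : borelRn R n -> R, f \in Lfun (weighted mu w) p%:E ->
     {ae mu, forall x, cvg (haar_partial_sum mu eps M f x @[M --> +oo])}) /\
  compact_operator_on_Lp (weighted mu w) p (haar_multiplier mu eps).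
Proof.
have mu_cube := radon_cube hmu.
have dw := Ap_dual_weights hmu hp hpp' hw.
have p0 : 0 < p := lt_trans ltr01 hp.
have LE := Lfun_finite_energy p0 (positive_version_gt0 w) (measurable_positive_version w)
  (funrpos_ae hw).
have LN := Lnorm_energy (positive_version_gt0 w) (measurable_positive_version w)
  (funrpos_ae hw).
have adm f (Ef : f \in Lfun (weighted mu w) p%:E) :=
  admissible_inner mu_cube dw ((LE f).1 Ef).
have cae f (Ef : f \in Lfun (weighted mu w) p%:E) :=
  multiplier_converges_ae hn mu_cube dw eps_bounded eps_small (adm f Ef).
split.
  move=> f Ef; apply: (negligibleS _ (cae f Ef)) => x; apply: contra_not => /=.
  rewrite /converges /= (_ : (fun M => haar_partial_sum mu eps M f x) =
    (fun M => haar_sum mu (fam_seq mu M) (fun Q => eps Q * inner mu f (haar mu Q)) x))//.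
  by apply/funext => M; rewrite haar_partial_sumE.
split.
- move=> f Ef; apply/LE; rewrite haar_multiplierE//.
  exact: (finite_energy_multiplier hn mu_cube dw eps_bounded eps_small (adm f Ef)).
- move=> a f g Ef Eg; apply: weighted_negligible.
  apply: (negligibleS _ (negligibleU (cae f Ef) (cae g Eg))) => x nx.
  apply: contrapT => nN; apply: nx => /=.
  have cf : converges mu (fun Q => eps Q * inner mu f (haar mu Q)) x.
    by apply: contrapT => h; apply: nN; left.
  have cg : converges mu (fun Q => eps Q * inner mu g (haar mu Q)) x.
    by apply: contrapT => h; apply: nN; right.
  rewrite !haar_multiplierE// -haar_lim_linear//; congr (haar_lim mu _ x).
  apply/funext => Q.
  have If := finite_energy_integrable_on_cubes dw ((LE f).1 Ef).
  have Ig := finite_energy_integrable_on_cubes dw ((LE g).1 Eg).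
  rewrite -[inner mu g _]mul1r mulrCA -mulrDr -inner_haarD//; congr (_ * inner mu _ _).
  by apply/funext => y; rewrite mul1r.
move=> u Eu [C HC].
have Eu' k := (LE (u k)).1 (Eu k).
have C0 : 0 <= C by rewrite -lee_fin; apply: le_trans (HC 0%N); exact: Lnorm_ge0.
have uC k : energy mu p (positive_version w) (u k) <= C `^ p.
  have := HC k; rewrite LN// lee_fin => h.
  have e0 : 0 <= energy mu p (positive_version w) (u k).
    by apply: energy_ge0; exact: positive_version_gt0.
  rewrite -[leLHS]powRr1// -(mulVf (lt0r_neq0 p0)) powRrM.
  by rewrite ge0_ler_powR ?(ltW p0)// ?nnegrE ?powR_ge0.
have [phi [g [phi_lt Eg H]]] := multiplier_compact hn mu_cube dw eps_bounded eps_large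
  eps_small eps_far C0 Eu' uC.
exists phi, g; split=> //; first exact/LE.
rewrite (_ : (fun k => _) = EFin \o (fun k =>
    energy mu p (positive_version w) (haar_multiplier mu eps (u (phi k)) \- g) `^ p^-1)).
  apply: cvg_EFin; first by near=> k.
  rewrite -(@powR0 R p^-1) ?invr_neq0 ?gt_eqF//.
  apply: cvg_powR; first by rewrite invr_gt0.
    by move=> k; apply: energy_ge0; exact: positive_version_gt0.
  apply: (@squeeze_cvgr _ _ _ _ (fun=> 0) (fun k : nat => k.+1%:R^-1)); last 2 first.
  - exact: cvg_cst.
  - exact: cvg_harmonic.
  near=> k; rewrite (H k).2 andbT; apply: energy_ge0; exact: positive_version_gt0.
by apply/funext => k; rewrite /= LN//; exact: (H k).1.
Unshelve. all: by end_near.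
Qed.
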